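(* Let $N\ge2$, $\lambda<\left(\frac{N-1}{2}\right)^2$, and $1<p<\frac{N+2}{N-2}$ (with $1<p<\infty$ if $N=2$). Then there exists a sequence $(u_k)$ of solutions of $$-\Delta_{\mathbb{B}^N}u-\lambda u=|u|^{p-1}u\quad\text{in }\mathbb{B}^N,\qquad u\in H^1(\mathbb{B}^N),$$ such that $\|u_k\|\to\infty$ as $k\to\infty$.
   Context: $\mathbb{B}^N=\{x\in\mathbb{R}^N:|x|<1\}$ is the ball model of hyperbolic space, with metric $g_{ij}=\left(\frac{2}{1-|x|^2}\right)^2\delta_{ij}$, volume $dV_{\mathbb{B}^N}=\left(\frac{2}{1-|x|^2}\right)^N dx$, and Laplace-Beltrami operator $\Delta_{\mathbb{B}^N}=\left(\frac{1-|x|^2}{2}\right)^2\Delta+(N-2)\frac{1-|x|^2}{2}\langle x,\nabla\cdot\rangle$. $H^1(\mathbb{B}^N)$ is the Sobolev space of this Riemannian manifold, with norm $\|u\|$ given by $\|u\|^2=\int_{\mathbb{B}^N}(|\nabla_{\mathbb{B}^N}u|^2_{\mathbb{B}^N}+u^2)\,dV_{\mathbb{B}^N}$, where $|\nabla_{\mathbb{B}^N}u|^2_{\mathbb{B}^N}=\left(\frac{1-|x|^2}{2}\right)^2|\nabla u|^2$. Solutions are understood in the weak sense. *)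

(* Defs.v *)
From HB Require Import structures.
From mathcomp Require Import all_boot all_order all_algebra.
From mathcomp Require Import all_classical all_reals all_analysis.

Set Implicit Arguments.
Unset Strict Implicit.
Unset Printing Implicit Defensive.

Import Order.TTheory GRing.Theory Num.Theory.
Import numFieldNormedType.Exports.

Local Open Scope classical_set_scope.
Local Open Scope ring_scope.

Definition measure_row_display : measure_display -> measure_display.
Proof. exact. Qed.

Section measurable_row.
Context {R : realType} (n : nat).

Let coord (i : 'I_n) (x : 'rV[R]_n) : R := x 0 i.

Let row_set0 : g_sigma_preimage coord set0.
Proof. exact: sigma_algebra0. Qed.

Let row_setC A : g_sigma_preimage coord A -> g_sigma_preimage coord (~` A).
Proof. exact: sigma_algebraC. Qed.

Let row_bigcup (F : _^nat) : (forall i, g_sigma_preimage coord (F i)) ->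
  g_sigma_preimage coord (\bigcup_i F i).
Proof. exact: sigma_algebra_bigcup. Qed.

(* The Borel sigma-algebra of R^n, as the product sigma-algebra generated by
   the n coordinate maps. *)
HB.instance Definition _ :=
  @isMeasurable.Build (measure_row_display default_measure_display) 'rV[R]_n
    (g_sigma_preimage coord) row_set0 row_setC row_bigcup.

End measurable_row.

Section row_cons.
Context {R : realType}.

Definition row_cons n (p : measurableTypeR R * 'rV[R]_n) : 'rV[R]_n.+1 :=
  row_mx (const_mx p.1 : 'rV_1) p.2.

Lemma row_consE0 n p : @row_cons n p 0 ord0 = p.1.
Proof.
have -> : (ord0 : 'I_n.+1) = lshift n (ord0 : 'I_1) by apply: val_inj.
by apply: etrans (row_mxEl (const_mx p.1) p.2 0 ord0) _; rewrite mxE.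
Qed.

Lemma row_consES n p i : @row_cons n p 0 (lift ord0 i) = p.2 0 i.
Proof.
have -> : lift ord0 i = rshift 1 i by apply: val_inj.
exact: row_mxEr (const_mx p.1) p.2 0 i.
Qed.

Lemma measurable_coord n (i : 'I_n) :
  measurable_fun setT (fun x : 'rV[R]_n => x 0 i).
Proof.
move=> _ Y mY; rewrite setTI; apply: sub_sigma_algebra => /=.
rewrite -bigcup_seq/=; exists i => /=; first by rewrite mem_index_enum.
by exists Y => //; rewrite setTI.
Qed.

Lemma measurable_to_row d (T : measurableType d) n (f : T -> 'rV[R]_n) :
  (forall i, measurable_fun setT (fun t => f t 0 i)) -> measurable_fun setT f.
Proof.
move=> mf; apply: (@measurability _ _ _ _ _ _
  (\big[setU/set0]_(i < n) preimage_set_system setT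
     (fun x : 'rV[R]_n => x 0 i) measurable)) => //.
move=> _ [A + <-]; rewrite -bigcup_seq => -[i _ [B mB <-]].
by rewrite setTI; exact: mf.
Qed.

Lemma measurable_row_cons n : measurable_fun setT (@row_cons n).
Proof.
apply: measurable_to_row => i; case: (unliftP ord0 i) => [j ->|->].
  under eq_fun do rewrite row_consES.
  exact: (measurableT_comp (measurable_coord j) measurable_snd).
under eq_fun do rewrite row_consE0.
exact: measurable_fst.
Qed.

HB.instance Definition _ n := isMeasurableFun.Build _ _ _ _ (@row_cons n)
  (@measurable_row_cons n).

End row_cons.

Section lebesgue_row.
Context {R : realType}.

Definition lebesgue_row_step n
    (mu : {sigma_finite_measure set 'rV[R]_n -> \bar R}) :=
  pushforward (lebesgue_measure \x mu)%E (@row_cons R n).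

Section step.
Variables (n : nat) (mu : {sigma_finite_measure set 'rV[R]_n -> \bar R}).

Let lebesgue_row_step0 : lebesgue_row_step mu set0 = 0%E.
Proof. exact: measure0. Qed.

Let lebesgue_row_step_ge0 A : (0 <= lebesgue_row_step mu A)%E.
Proof. exact: measure_ge0. Qed.

Let lebesgue_row_step_sigma_additive :
  semi_sigma_additive (lebesgue_row_step mu).
Proof. exact: measure_semi_sigma_additive. Qed.

HB.instance Definition _ := isMeasure.Build _ _ _ (lebesgue_row_step mu)
  lebesgue_row_step0 lebesgue_row_step_ge0 lebesgue_row_step_sigma_additive.

Let lebesgue_row_step_sigma_finite :
  sigma_finite setT (lebesgue_row_step mu).
Proof.
have [F TF Foo] : sigma_finite setT (lebesgue_measure \x mu)%E.
  have /sigma_finiteP[F [TF ndF Foo]] := sigma_finiteT (@lebesgue_measure R).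
  have /sigma_finiteP[G [TG ndG Goo]] := sigma_finiteT mu.
  exists (fun k => F k `*` G k).
    rewrite -setXTT TF TG predeqE => -[x y]; split.
      move=> [/= [k _ Fkx] [l _ Gly]]; exists (maxn k l) => //; split.
      - by move: x Fkx; exact/subsetPset/ndF/leq_maxl.
      - by move: y Gly; exact/subsetPset/ndG/leq_maxr.
    by move=> [k _ []/= ? ?]; split; exists k.
  move=> k; have [? ?] := Foo k; have [? ?] := Goo k.
  split; first exact: measurableX.
  by rewrite product_measure1E// lte_mul_pinfty// ge0_fin_numE.
pose g (x : 'rV[R]_n.+1) : measurableTypeR R * 'rV[R]_n :=
  (x 0 ord0, \row_i x 0 (lift ord0 i)).
have gK p : g (row_cons p) = p.
  case: p => a v; rewrite /g row_consE0; congr pair.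
  by apply/rowP => i; rewrite mxE row_consES.
have mg : measurable_fun setT g.
  apply/measurable_fun_pairP; split; first exact: measurable_coord.
  apply: measurable_to_row => i.
  rewrite (_ : (fun _ => _) = fun x : 'rV[R]_n.+1 => x 0 (lift ord0 i)).
    exact: measurable_coord.
  by apply/funext => x; rewrite /= mxE.
exists (fun k => g @^-1` F k).
  by rewrite -preimage_bigcup -TF preimage_setT.
move=> k; have [mF Fk] := Foo k; split.
  by rewrite -[X in measurable X]setTI; exact: mg.
rewrite /lebesgue_row_step /pushforward -comp_preimage.
by rewrite (_ : g \o _ = id)//; apply/funext => p /=; rewrite gK.
Qed.

HB.instance Definition _ := Measure_isSigmaFinite.Build _ _ _
  (lebesgue_row_step mu) lebesgue_row_step_sigma_finite.

End step.

(* Lebesgue measure on R^n: the point mass for n = 0, and otherwise the product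
   of the Lebesgue measure of R with that of R^(n-1). *)
Fixpoint lebesgue_row n : {sigma_finite_measure set 'rV[R]_n -> \bar R} :=
  match n with
  | 0%N => \d_ (0 : 'rV[R]_0)
  | m.+1 => lebesgue_row_step (lebesgue_row m)
  end.

Lemma measurable_box n (A : 'I_n -> set R) : (forall i, measurable (A i)) ->
  measurable [set x : 'rV[R]_n | forall i, A i (x 0 i)].
Proof.
move=> mA.
rewrite (_ : [set _ | _] =
    \bigcap_(i in [set: 'I_n]) ((fun x : 'rV[R]_n => x 0 i) @^-1` A i)).
  apply: fin_bigcap_measurable => // i _.
  by rewrite -[X in measurable X]setTI; exact: measurable_coord.
by apply/seteqP; split => [x Ax i _|x Ax i]; exact: Ax.
Qed.

Lemma lebesgue_row_box n (A : 'I_n -> set R) : (forall i, measurable (A i)) ->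
  lebesgue_row n [set x | forall i, A i (x 0 i)] =
  (\prod_(i < n) lebesgue_measure (A i))%E.
Proof.
elim: n A => [|n IHn] A mA.
  rewrite big_ord0 (_ : [set _ | _] = setT) /= ?diracT//.
  by apply/seteqP; split => // x _ [].
have mB := @measurable_box _ (fun i => A (lift ord0 i)) (fun i => mA _).
rewrite big_ord_recl -IHn// -product_measure1E//; last exact: (mA ord0).
rewrite [LHS]/= /lebesgue_row_step /pushforward.
congr (product_measure1 _ _ _); apply/seteqP; split => -[a v] /= Aav.
  split => [|i]; first by have := Aav ord0; rewrite row_consE0.
  by have := Aav (lift ord0 i); rewrite row_consES.
move=> i; case: (unliftP ord0 i) => [j ->|->].
  by rewrite row_consES; exact: Aav.2.
by rewrite row_consE0; exact: Aav.1.
Qed.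

End lebesgue_row.

Section weak_gradient.
Context {R : realType} {N : nat}.
Implicit Types (f u v phi : 'rV[R]_N -> R) (g : 'rV[R]_N -> 'rV[R]_N).

Definition partial (i : 'I_N) f : 'rV[R]_N -> R :=
  fun x => 'D_(delta_mx 0 i) f x.

Definition gradient f : 'rV[R]_N -> 'rV[R]_N :=
  fun x => \row_i partial i f x.

(* The iterated partial derivative along the directions listed in s. *)
Definition iter_partial (s : seq 'I_N) f := foldr partial f s.

Definition smooth f := forall s : seq 'I_N,
  continuous (iter_partial s f) /\
  forall i x, derivable (iter_partial s f) x (delta_mx 0 i).

Definition test_function (D : set 'rV[R]_N) phi :=
  let supp := closure [set x | phi x != 0] in
  [/\ smooth phi, compact supp & supp `<=` D].

Definition locally_integrable_row (D : set 'rV[R]_N) f :=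
  measurable_fun D f /\
  forall K, compact K -> K `<=` D ->
    (lebesgue_row N).-integrable K (EFin \o f).

Definition is_weak_partial (D : set 'rV[R]_N) (i : 'I_N) u v :=
  [/\ locally_integrable_row D u, locally_integrable_row D v &
    forall phi, test_function D phi ->
      \int[lebesgue_row N]_(x in D) (u x * partial i phi x) =
      - \int[lebesgue_row N]_(x in D) (v x * phi x)].

Definition is_weak_gradient (D : set 'rV[R]_N) u g :=
  forall i, is_weak_partial D i u (fun x => g x 0 i).

(* A weak gradient of u on D, unique up to a null set, if there is one;
   0 otherwise. *)
Definition weak_gradient (D : set 'rV[R]_N) u : 'rV[R]_N -> 'rV[R]_N :=
  xget (fun=> 0) [set g | is_weak_gradient D u g].

End weak_gradient.

Section hyperbolic_space.
Context {R : realType} {N : nat}.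
Implicit Types (f u phi : 'rV[R]_N -> R) (x v w : 'rV[R]_N).

(* Euclidean; the library's norm on 'rV[R]_N is the sup norm. *)
Definition dotr v w : R := \sum_i v 0 i * w 0 i.

Definition hball : set 'rV[R]_N := [set x | dotr x x < 1].

(* The metric is g_ij = conf x ^+ 2 * delta_ij. *)
Definition conf x : R := 2 / (1 - dotr x x).

(* Integrability and integral over the ball for dV = conf x ^+ N dx. *)
Definition hintegrable f :=
  (lebesgue_row N).-integrable hball (EFin \o (fun x => f x * conf x ^+ N)).

Definition hintegral f : R :=
  \int[lebesgue_row N]_(x in hball) (f x * conf x ^+ N).

(* The Riemannian inner product of the Riemannian gradients conf x ^- 2 *: v
   and conf x ^- 2 *: w of functions whose Euclidean gradients at x are v
   and w. *)
Definition hgrad_dot x v w : R := conf x ^- 2 * dotr v w.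

Definition hgrad u := weak_gradient hball u.

Definition H1 u :=
  [/\ exists g, is_weak_gradient hball u g,
    hintegrable (fun x => u x ^+ 2) &
    hintegrable (fun x => hgrad_dot x (hgrad u x) (hgrad u x))].

Definition H1norm u : R :=
  Num.sqrt (hintegral (fun x =>
    hgrad_dot x (hgrad u x) (hgrad u x) + u x ^+ 2)).

(* u is in H^1 and solves - Delta u - lambda u = |u|^(p-1) u weakly.
   In the ball model the Laplace-Beltrami operator
     Delta u = conf^-2 (Euclidean Laplacian of u) + (N-2) conf^-1 <x, grad u>
   is conf^-N div (conf^(N-2) grad u), so pairing - Delta u with phi in
   L^2(dV) gives the integral of hgrad_dot for dV. *)
Definition weak_solution (lambda p : R) u :=
  [/\ H1 u,
    locally_integrable_row hball (fun x => `|u x| `^ (p - 1) * u x) &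
    forall phi, test_function hball phi ->
      hintegral (fun x => hgrad_dot x (hgrad u x) (gradient phi x))
        - lambda * hintegral (fun x => u x * phi x) =
      hintegral (fun x => `|u x| `^ (p - 1) * u x * phi x)].

End hyperbolic_space.

(* Main.v *)
(* The solutions are radial and are found by shooting.  In the variable
   y = cosh r - 1 = 2|x|^2 / (1 - |x|^2), where r is the distance to the origin,
   u(x) = w(y) solves the equation iff
     y (y + 2) w'' + N (y + 1) w' + lambda w + |w|^(p-1) w = 0.
   For a large initial value w(0) = alpha, rescaling y by alpha^(1-p) turns this
   into a perturbation of the Emden-Fowler equation, whose solutions oscillate by
   a Pohozaev identity because p is subcritical; so w has as many zeros as we
   like once alpha is large.  As lambda < ((N-1)/2)^2, a solution which does not
   decay fast enough to lie in L^2(dV) has finitely many zeros, and their number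
   then is locally constant in alpha.  If no solution with alpha >= A decayed
   fast, connectedness of [A, oo) would give infinitely many zeros to all of
   them, a contradiction.  Hence there are fast decaying solutions with
   arbitrarily large alpha.  They are in H^1, and the part of the ball where
   |x|^2 is of order alpha^(1-p) contributes to the energy at least a multiple of
   alpha^(2 - (p-1)(N-2)/2), which tends to infinity. *)

(* The variable y makes the coefficients of the radial operator polynomials, and one family
   [radial_sol N e], with e = alpha^(1-p), contains both the rescaled hyperbolic equation and, at e
   = 0, its Euclidean limit. Perturbation in e and in alpha are then two instances of one Gronwall
   estimate. On the ball y is [conf x - 2], smooth at the origin, so polar coordinates never appear;
   only the bounded quotients x_i^2 / |x|^2 need care there. The obstacle to counting zeros is that
   they may escape to infinity as alpha varies. Signs are therefore compared on a bounded interval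
   [0, T] only, and an open condition on the data at T excludes later zeros: either the energy is
   negative, or (sinh r)^(N-1) u^2 is increasing and the energy small. The second property persists
   because ((N-1)/2)^2 is the bottom of the spectrum. On the side of weak solutions, [hgrad] is
   selected by choice, so the explicit gradient has to be shown equal to it almost everywhere, and
   integrability up to the boundary comes from the divergence theorem. *)
Require Import Defs.
From mathcomp Require Import all_boot all_order all_algebra.
From mathcomp Require Import all_classical all_reals all_analysis.
From mathcomp Require Import measurable_realfun.
From mathcomp Require Import zify ring lra.

Set Implicit Arguments.
Unset Strict Implicit.
Unset Printing Implicit Defensive.

Import Order.TTheory GRing.Theory Num.Theory.
Import numFieldNormedType.Exports.

Local Open Scope classical_set_scope.
Local Open Scope ring_scope.

(** * Directional derivatives *)

(* Unlike [is_derive] this is not a class: the value of the derivative is found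
   by the lemmas below and not by instance resolution. *)
Definition has_derive {R : realType} {V : normedModType R} (u v : V)
  (F : V -> R) (a : R) : Prop := is_derive u v F a.

Section calculus.
Context {R : realType}.
Implicit Types (f g : R -> R) (x y a b c : R).

Section directional.
Context {V : normedModType R}.
Implicit Types (F G : V -> R) (u v : V).

Lemma is_deriveE F u v a b : has_derive u v F a -> a = b -> has_derive u v F b.
Proof. by move=> ? <-. Qed.

Lemma is_derive_cstE c u v : has_derive u v (fun=> c) 0.
Proof. exact: is_derive_cst. Qed.

Lemma is_deriveDE F G u v a b : has_derive u v F a -> has_derive u v G b ->
  has_derive u v (fun t => F t + G t) (a + b).
Proof. exact: is_deriveD. Qed.

Lemma is_deriveNE F u v a : has_derive u v F a ->
  has_derive u v (fun t => - F t) (- a).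
Proof. exact: is_deriveN. Qed.

Lemma is_deriveME F G u v a b : has_derive u v F a -> has_derive u v G b ->
  has_derive u v (fun t => F t * G t) (F u * b + G u * a).
Proof. exact: is_deriveM. Qed.

Lemma is_deriveXE F n u v a : has_derive u v F a ->
  has_derive u v (fun t => F t ^+ n) (n%:R * F u ^+ n.-1 * a).
Proof.
move=> Fa; have := is_deriveX n Fa.
by have -> : F ^+ n = (fun t => F t ^+ n) by apply/funext => t; rewrite fctE.
Qed.

Lemma is_deriveVE F u v a : F u != 0 -> has_derive u v F a ->
  has_derive u v (fun t => (F t)^-1) (- (F u) ^- 2 * a).
Proof.
move=> Fu0 [dF dFa]; apply: DeriveDef; first exact: derivableV.
by rewrite deriveV // dFa.
Qed.

Lemma derive_lineE F u v :
  (fun k : R => k^-1 *: (((fun t : R => F (u + t *: v)) \o shift (0 : R)) (k *: (1 : R)) -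
    F (u + (0 : R) *: v))) = (fun k : R => k^-1 *: ((F \o shift u) (k *: v) - F u)).
Proof.
apply/funext => k /=; rewrite scale0r !addr0 [u + _]addrC.
by rewrite /GRing.scale /= mulr1.
Qed.

Lemma is_derive_line F u v a : has_derive u v F a ->
  has_derive (0 : R) 1 (fun t : R => F (u + t *: v)) a.
Proof.
by case=> dF dFa; split; rewrite /derivable /derive derive_lineE.
Qed.

Lemma line_is_derive F u v a :
  has_derive (0 : R) 1 (fun t : R => F (u + t *: v)) a -> has_derive u v F a.
Proof.
by case; rewrite /derivable /derive derive_lineE.
Qed.

(** A directional derivative is a one-variable derivative along the line u + t v, so the chain rule
    holds although [F] is differentiable in the single direction [v] only. *)
Lemma is_derive_compE f F u v a b : has_derive (F u) 1 f a ->
  has_derive u v F b -> has_derive u v (fun t => f (F t)) (a * b).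
Proof.
move=> fa /is_derive_line Fb; apply: line_is_derive; rewrite -[u in F u]addr0 -(scale0r v) in fa.
exact: (@is_derive1_comp _ f (fun t => F (u + t *: v)) 0 a b fa Fb).
Qed.

Lemma near_is_derive F G u v a : (\forall t \near u, F t = G t) ->
  has_derive u v F a -> has_derive u v G a.
Proof.
move=> FG [dF dFa]; apply: DeriveDef; first exact: near_eq_derivable FG dF.
by rewrite -(near_eq_derive v FG).
Qed.

End directional.

Lemma is_derive_idE x : has_derive x 1 (fun t : R => t) 1.
Proof. exact: is_derive_id. Qed.

Lemma is_derive_continuous f x a : has_derive x 1 f a -> {for x, continuous f}.
Proof. by move=> [fx _]; apply/differentiable_continuous/derivable1_diffP. Qed.

Lemma near_continuous_at (T U : topologicalType) (F G : T -> U) u :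
  (\forall t \near u, F t = G t) -> {for u, continuous F} ->
  {for u, continuous G}.
Proof.
move=> FG cF; rewrite /prop_for /continuous_at -(nbhs_singleton FG).
by apply: cvg_trans cF; apply: near_eq_cvg.
Qed.

Lemma derive_nondecreasing f df a b : a <= b ->
  (forall x, a <= x <= b -> {for x, continuous f}) ->
  (forall x, a < x < b -> has_derive x 1 f (df x)) ->
  (forall x, a < x < b -> 0 <= df x) -> f a <= f b.
Proof.
move=> ab cf dfx df0; rewrite -subr_ge0.
move: ab; rewrite le_eqVlt => /orP[/eqP->|ab]; first by rewrite subrr.
have D x : x \in `]a, b[%R -> is_derive x 1 f (df x).
  by rewrite in_itv /= => /dfx.
have C : {within `[a, b], continuous f}.
  apply: continuous_in_subspaceT => x; rewrite inE /= in_itv /= => xab.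
  exact: cf.
have [c cab ->] := MVT ab D C.
by move: cab; rewrite in_itv /= => cab; rewrite mulr_ge0 ?df0// subr_ge0 ltW.
Qed.

Lemma derive_nonincreasing f df a b : a <= b ->
  (forall x, a <= x <= b -> {for x, continuous f}) ->
  (forall x, a < x < b -> has_derive x 1 f (df x)) ->
  (forall x, a < x < b -> df x <= 0) -> f b <= f a.
Proof.
move=> ab cf dfx df0; rewrite -lerN2.
apply: (@derive_nondecreasing (fun x => - f x) (fun x => - df x)).
- exact: ab.
- by move=> x /cf; exact: continuousN.
- by move=> x /dfx; exact: is_deriveNE.
- by move=> x /df0; rewrite oppr_ge0.
Qed.

Lemma derive_le f df g dg a b : a <= b ->
  (forall x, a <= x <= b -> {for x, continuous f}) ->
  (forall x, a <= x <= b -> {for x, continuous g}) ->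
  (forall x, a < x < b -> has_derive x 1 f (df x)) ->
  (forall x, a < x < b -> has_derive x 1 g (dg x)) ->
  (forall x, a < x < b -> df x <= dg x) -> f b - f a <= g b - g a.
Proof.
move=> ab cf cg dfx dgx le; rewrite -subr_ge0.
have -> : g b - g a - (f b - f a) = (g b - f b) - (g a - f a) by ring.
rewrite subr_ge0.
apply: (@derive_nondecreasing (fun x => g x - f x) (fun x => dg x - df x)).
- exact: ab.
- by move=> x xab; apply: continuousB; [exact: cg|exact: cf].
- by move=> x xab; apply: is_deriveB; [exact: dgx|exact: dfx].
- by move=> x /le; rewrite subr_ge0.
Qed.

Lemma derive_normr_le f df g dg a b : a <= b ->
  (forall x, a <= x <= b -> {for x, continuous f}) ->
  (forall x, a <= x <= b -> {for x, continuous g}) ->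
  (forall x, a < x < b -> has_derive x 1 f (df x)) ->
  (forall x, a < x < b -> has_derive x 1 g (dg x)) ->
  (forall x, a < x < b -> `|df x| <= dg x) -> `|f b - f a| <= g b - g a.
Proof.
move=> ab cf cg dfx dgx le; rewrite ler_norml; apply/andP; split.
  rewrite lerNl opprB.
  have -> : f a - f b = (- f b) - (- f a) by ring.
  apply: (@derive_le (fun x => - f x) (fun x => - df x) g dg).
  - exact: ab.
  - by move=> x /cf; exact: continuousN.
  - exact: cg.
  - by move=> x /dfx; exact: is_deriveNE.
  - exact: dgx.
  - by move=> x /le; rewrite -normrN; apply: le_trans; exact: ler_norm.
apply: (@derive_le f df g dg a b ab cf cg dfx dgx) => x.
by move=> /le; apply: le_trans; exact: ler_norm.
Qed.

Lemma ivt0 f a b : a <= b -> (forall x, a <= x <= b -> {for x, continuous f}) ->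
  f a * f b <= 0 -> exists2 c, a <= c <= b & f c = 0.
Proof.
move=> ab cf fab.
have [||c] := @IVT _ f a b 0 ab; last by rewrite in_itv /=; exists c.
  by apply: continuous_in_subspaceT => x; rewrite inE /= in_itv /=; exact: cf.
by case: (leP (f a) (f b)) => fle; nra.
Qed.

Lemma evt_max f a b : a <= b -> (forall x, a <= x <= b -> {for x, continuous f}) ->
  exists2 c, a <= c <= b & forall t, a <= t <= b -> f t <= f c.
Proof.
move=> ab cf; have [|c] := @EVT_max _ f a b ab.
  by apply: continuous_in_subspaceT => x; rewrite inE /= in_itv /=; exact: cf.
by rewrite in_itv /= => cab H; exists c => // t tab; apply: H; rewrite in_itv.
Qed.

(** The fundamental theorem of calculus needs a fixed left end point. The integrals from - n - 1,
    normalized to vanish at 0, agree wherever two of them are defined; at x the one with n the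
    integer part of |x| is used. *)
Lemma antiderivative f : continuous f -> exists F : R -> R,
  F 0 = 0 /\ forall x, has_derive x 1 F (f x).
Proof.
move=> cf.
have intf a b : (@lebesgue_measure R).-integrable `[a, b] (EFin \o f).
  apply: continuous_compact_integrable; first exact: segment_compact.
  exact: continuous_subspaceT.
pose F n x := (\int[@lebesgue_measure R]_(t in `[(- n%:R - 1)%R, x]) (f t))%R.
have FD n x : - n%:R - 1 < x -> has_derive x 1 (F n) (f x).
  move=> nx; have [] := @continuous_FTC1_closed R f (- n%:R - 1) x (x + 1).
  - by rewrite ltrDl.
  - exact: intf.
  - exact: nx.
  - exact: cf.
  - by move=> dF dFE; apply: DeriveDef; [exact: dF|rewrite -derive1E].
pose G n x := F n x - F n 0.
have GD n x : - n%:R - 1 < x -> has_derive x 1 (G n) (f x).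
  move=> nx; apply: is_deriveE.
    exact: (is_deriveDE (FD n x nx) (is_derive_cstE (- F n 0) x 1)).
  by rewrite addr0.
have n0 n : - (n%:R : R) - 1 < 0 by have := ler0n R n; lra.
have GE m n x : - m%:R - 1 < x -> - n%:R - 1 < x -> G m x = G n x.
  move=> mx nx; pose h (t : R) := G m t - G n t.
  have hD (t : R) : - m%:R - 1 < t -> - n%:R - 1 < t -> has_derive t 1 h 0.
    move=> mt nt; apply: is_deriveE.
      exact: (is_deriveB (GD m t mt) (GD n t nt)).
    by rewrite subrr.
  have hc t : - m%:R - 1 < t -> - n%:R - 1 < t -> {for t, continuous h}.
    by move=> mt nt; exact: is_derive_continuous (hD _ mt nt).
  suff /eqP : h x = h 0 by rewrite /h /G !subrr subr_eq0 => /eqP.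
  have m1 := n0 m; have n1 := n0 n.
  have [x0|/ltW x0] := leP 0 x; apply/eqP; rewrite eq_le; apply/andP; split.
  - apply: (@derive_nonincreasing h (fun=> 0) _ _ x0); last by [].
      by move=> t tx; apply: hc; lra.
    by move=> t tx; apply: hD; lra.
  - apply: (@derive_nondecreasing h (fun=> 0) _ _ x0); last by [].
      by move=> t tx; apply: hc; lra.
    by move=> t tx; apply: hD; lra.
  - apply: (@derive_nondecreasing h (fun=> 0) _ _ x0); last by [].
      by move=> t tx; apply: hc; lra.
    by move=> t tx; apply: hD; lra.
  - apply: (@derive_nonincreasing h (fun=> 0) _ _ x0); last by [].
      by move=> t tx; apply: hc; lra.
    by move=> t tx; apply: hD; lra.
pose k x := Num.truncn `|x|.
have kx x : `|x| < (k x).+1%:R by rewrite truncnS_gt.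
exists (fun x => G (k x) x); split; first by rewrite /G subrr.
move=> x.
(* The index [k t] jumps at integers, so all nearby choices are compared with the single index [k x]
   + 1, whose half-line contains the unit neighbourhood of x. *)
have E : \forall t \near x, G (k x).+1 t = G (k t) t.
  near=> t; apply: GE.
    have : `|x - t| < 1 by near: t; apply: cvgr_dist_lt.
    have := kx x; have := ler_norm (- x); have := ler_norm (x - t).
    by rewrite normrN -!natr1; lra.
  by have := kx t; have := ler_norm (- t); rewrite normrN -!natr1; lra.
apply: near_is_derive E _; apply: GD; have := kx x; have := ler_norm (- x).
by rewrite normrN -!natr1; lra.
Unshelve. all: by end_near.
Qed.

End calculus.

(* [lra] and [nra] reify all comparisons in the context, which dominates their
   cost in long proofs; [flra] and [fnra] first try small sets of hypotheses. *)
Ltac clear_products := repeat match goal with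
  | H : ?T |- _ => lazymatch T with
    | context [GRing.mul _ _] => clear H
    | context [GRing.exp _ _] => clear H
    end
  end.
Ltac clear_nonorder := repeat match goal with
  | H : ?T |- _ => lazymatch T with
    | is_true (Order.le _ _) => fail
    | is_true (Order.lt _ _) => fail
    | is_true (andb _ _) => fail
    | _ => clear H
    end
  end.
Ltac clear_nonarith := repeat match goal with
  | H : ?T |- _ => lazymatch T with
    | is_true (Order.le _ _) => fail
    | is_true (Order.lt _ _) => fail
    | is_true (andb _ _) => fail
    | @eq _ _ _ => fail
    | _ => clear H
    end
  end.
Ltac flra := first [clear_nonorder; clear_products; lra | clear_nonorder; lra | clear_nonarith; lra | lra].
Ltac fnra := first [clear_nonarith; nra | nra].

Ltac is_der :=
  match goal with
  | |- has_derive _ _ (fun t => @?A t + @?B t) _ =>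
      apply: (@is_deriveDE _ _ A B); is_der
  | |- has_derive _ _ (fun t => - (@?A t)) _ => apply: (@is_deriveNE _ _ A); is_der
  | |- has_derive _ _ (fun t => @?A t * @?B t) _ =>
      apply: (@is_deriveME _ _ A B); is_der
  | |- has_derive _ _ (fun t => @?A t ^+ _) _ => apply: (@is_deriveXE _ _ A); is_der
  | |- has_derive _ _ (fun t => (@?A t)^-1) _ => apply: (@is_deriveVE _ _ A); [|is_der]
  | |- has_derive _ _ (fun t => t) _ => exact: is_derive_idE
  | |- has_derive _ _ (fun t => ?c) _ => exact: is_derive_cstE
  | |- _ => solve [eauto]
  | |- _ => idtac
  end.

(** * The radial equation *)

Section radial_equation.
Context {R : realType} (N : nat) (N2 : (2 <= N)%N).
Implicit Types (g G w z : R -> R) (e s t K B L M : R).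

(** In terms of the distance r this is (sinh r)^2 / e, and for e = 0 it is the squared Euclidean
    radius. *)
Definition qf e s : R := s * (e * s + 2).

Definition rho e s : R := Num.sqrt (qf e s).

(* In the variable [s = (cosh r - 1) / e] the radial part of the
   Laplace-Beltrami operator is [q w'' + N (e s + 1) w'], [q = qf e s]; the
   value [e = 0] is its Euclidean limit. *)
Definition radial_sol e g (alpha : R) w z :=
  [/\ w 0 = alpha, forall s, has_derive s 1 w (z s), continuous z,
    z 0 = - g alpha / N%:R &
    forall s, 0 < s ->
      has_derive s 1 z (- (N%:R * (e * s + 1) * z s + g (w s)) / qf e s)].

Lemma qf_gt0 e s : 0 <= e -> 0 < s -> 0 < qf e s.
Proof. by rewrite /qf => e0 s0; rewrite mulr_gt0//; nra. Qed.

Lemma qf_ge0 e s : 0 <= e -> 0 <= s -> 0 <= qf e s.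
Proof. by rewrite /qf => e0 s0; rewrite mulr_ge0//; nra. Qed.

Lemma rho_gt0 e s : 0 <= e -> 0 < s -> 0 < rho e s.
Proof. by move=> e0 s0; rewrite sqrtr_gt0; exact: qf_gt0. Qed.

Lemma rho0 e : rho e 0 = 0.
Proof. by rewrite /rho /qf mul0r sqrtr0. Qed.

Lemma sqr_rho e s : 0 <= e -> 0 <= s -> rho e s ^+ 2 = qf e s.
Proof. by move=> e0 s0; rewrite sqr_sqrtr //; exact: qf_ge0. Qed.

Lemma is_derive_qf e s : has_derive s 1 (qf e) (2 * (e * s + 1)).
Proof.
rewrite /qf; apply: is_deriveE; first by is_der.
by rewrite /=; ring.
Qed.

Lemma continuous_rho e : continuous (rho e).
Proof.
move=> s; apply: (@continuous_comp _ _ _ (qf e) Num.sqrt).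
  exact: is_derive_continuous (is_derive_qf e s).
exact: sqrt_continuous.
Qed.

Lemma is_derive_rho e s : 0 <= e -> 0 < s ->
  has_derive s 1 (rho e) ((e * s + 1) / rho e s).
Proof.
move=> e0 s0; apply: is_deriveE.
  apply: (@is_derive_compE _ _ Num.sqrt (qf e)); last exact: is_derive_qf.
  exact: is_derive1_sqrt (qf_gt0 e0 s0).
rewrite -/(rho e s); have := rho_gt0 e0 s0 => r0; field.
by rewrite gt_eqF.
Qed.

Lemma is_derive_rhoN e s : 0 <= e -> 0 < s ->
  has_derive s 1 (fun t => rho e t ^+ N)
    (N%:R * (e * s + 1) * rho e s ^+ (N - 2)).
Proof.
move=> e0 s0; apply: is_deriveE; first exact: is_deriveXE (is_derive_rho e0 s0).
have r0 := rho_gt0 e0 s0; case: N N2 => [//|[//|m]] _ /=.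
by rewrite subn2 /= exprS; field; rewrite gt_eqF.
Qed.

Lemma continuous_rhoX e n : continuous (fun s => rho e s ^+ n).
Proof.
move=> s; apply: (@continuous_comp _ _ _ (rho e) (fun x => x ^+ n)).
  exact: continuous_rho.
exact: exprn_continuous.
Qed.

(** Since (rho^N)' = N (e t + 1) rho^(N-2), a difference of weighted integrands bounded by B (e t +
    1) integrates to at most B rho^N / N; that B grows only helps. *)
Lemma rhoX_weighted_le e (h1 h2 H1 H2 b B : R -> R) s :
  0 <= e -> 0 <= s -> H1 0 = 0 -> H2 0 = 0 -> continuous H1 -> continuous H2 ->
  (forall t, 0 < t -> has_derive t 1 H1 (rho e t ^+ (N - 2) * h1 t)) ->
  (forall t, 0 < t -> has_derive t 1 H2 (rho e t ^+ (N - 2) * h2 t)) ->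
  continuous B -> (forall t, has_derive t 1 B (b t)) ->
  (forall t, 0 <= t -> 0 <= b t) ->
  (forall t, 0 < t < s -> `|h1 t - h2 t| <= B t * (e * t + 1)) ->
  `|H1 s - H2 s| <= B s * rho e s ^+ N / N%:R.
Proof.
move=> e0 s0 H10 H20 cH1 cH2 dH1 dH2 cB dB b0 hB.
have N0 : (0 : R) < N%:R by rewrite ltr0n; apply: leq_trans N2.
have := @derive_normr_le R (fun t => H1 t - H2 t)
  (fun t => rho e t ^+ (N - 2) * h1 t - rho e t ^+ (N - 2) * h2 t)
  (fun t => B t * rho e t ^+ N / N%:R)
  (fun t => (B t * (N%:R * (e * t + 1) * rho e t ^+ (N - 2)) +
     rho e t ^+ N * b t) / N%:R) 0 s s0.
rewrite H10 H20 !subr0 rho0 expr0n.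
have -> : N == 0%N = false by case: N N2.
rewrite mulr0 mul0r subr0; apply.
- by move=> t _; apply: continuousB; [exact: cH1|exact: cH2].
- move=> t _; apply: cvgMr_tmp; apply: cvgM; [exact: cB|exact: continuous_rhoX].
- by move=> t /andP[t0 _]; apply: is_deriveB; [exact: dH1|exact: dH2].
- move=> t /andP[t0 _]; apply: is_deriveE.
    apply: is_deriveME; last exact: is_derive_cstE.
    by apply: is_deriveME; [exact: dB|exact: is_derive_rhoN].
  by rewrite /=; ring.
move=> t /andP[t0 ts].
rewrite -mulrBr normrM (ger0_norm (exprn_ge0 _ (sqrtr_ge0 _))).
have r0 : 0 <= rho e t ^+ (N - 2) by rewrite exprn_ge0// sqrtr_ge0.
apply: le_trans (ler_wpM2l r0 (hB t _)) _; first by rewrite t0.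
rewrite mulrDl.
have -> : B t * (N%:R * (e * t + 1) * rho e t ^+ (N - 2)) / N%:R =
  rho e t ^+ (N - 2) * (B t * (e * t + 1)) by field; rewrite gt_eqF.
rewrite lerDl mulr_ge0 ?invr_ge0 ?ler0n// mulr_ge0 ?b0 ?(ltW t0)//.
by rewrite exprn_ge0// sqrtr_ge0.
Qed.

(** Chosen once and for all, so that the integral operators built from it are total functions. *)
Definition prim (f : R -> R) : R -> R :=
  xget (fun=> 0) [set F : R -> R | F 0 = 0 /\ forall x : R, has_derive x 1 F (f x)].

Lemma primP (f : R -> R) : continuous f ->
  prim f 0 = 0 /\ forall x : R, has_derive x 1 (prim f) (f x).
Proof.
by move=> /antiderivative[F HF]; exact: (@xgetI _ (fun=> 0)
  [set F : R -> R | F 0 = 0 /\ forall x : R, has_derive x 1 F (f x)] F HF).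
Qed.

Lemma continuous_prim (f : R -> R) : continuous f -> continuous (prim f).
Proof.
by move=> /primP[_ dF] x; exact: is_derive_continuous (dF x).
Qed.

(* [- Jop e g] solves [q z' + N (e s + 1) z + g = 0]: the integrating factor
   is [rho ^ (N - 2)]. *)
Definition Jop e g s : R :=
  if s <= 0 then g 0 / N%:R
  else prim (fun t => rho e t ^+ (N - 2) * g t) s / rho e s ^+ N.

Lemma continuous_rhoXM e g : continuous g ->
  continuous (fun t => rho e t ^+ (N - 2) * g t).
Proof. by move=> cg t; apply: cvgM; [exact: continuous_rhoX|exact: cg]. Qed.

(** [Jop] integrates [g] against a measure on [0, s] of mass at most 1 / N, so it preserves a bound
    by the nondecreasing function [B * expR (K * t)]. *)
Lemma Jop_le e g1 g2 K B s : 0 <= e -> 0 <= K -> 0 <= B ->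
  continuous g1 -> continuous g2 -> 0 <= s ->
  (forall t, 0 <= t -> `|g1 t - g2 t| <= B * expR (K * t)) ->
  `|Jop e g1 s - Jop e g2 s| <= B * expR (K * s).
Proof.
move=> e0 K0 B0 cg1 cg2 s0 gB.
have N1 : (1 : R) <= N%:R by rewrite ler1n; apply: leq_trans N2.
have N0 : (0 : R) < N%:R by lra.
have Ninv : (N%:R : R)^-1 <= 1 by rewrite invf_le1.
rewrite /Jop; case: ifPn => [s0'|].
  have -> : s = 0 by apply/eqP; rewrite eq_le s0 s0'.
  rewrite -mulrBl normrM normfV (gtr0_norm N0).
  by apply: le_trans (gB 0 _) => //; rewrite ler_piMr.
rewrite -ltNge => {}s0.
have [P10 P1d] := primP (@continuous_rhoXM e _ cg1).
have [P20 P2d] := primP (@continuous_rhoXM e _ cg2).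
rewrite -mulrBl normrM normfV.
have r0 : 0 < rho e s ^+ N by rewrite exprn_gt0// rho_gt0.
rewrite (gtr0_norm r0) ler_pdivrMr//.
apply: le_trans (_ : B * expR (K * s) * rho e s ^+ N / N%:R <= _); last first.
  by rewrite ler_piMr// mulr_ge0 ?(ltW r0)// mulr_ge0// expR_ge0.
have dE (t : R) : has_derive t 1 (fun t => B * expR (K * t)) (B * (K * expR (K * t))).
  apply: is_deriveE.
    apply: is_deriveME; first exact: is_derive_cstE.
    apply: (@is_derive_compE _ _ expR (fun t => K * t)); first exact: is_derive_expR.
    by is_der.
  by rewrite /=; ring.
apply: (@rhoX_weighted_le e g1 g2 _ _ (fun t => B * (K * expR (K * t)))
  (fun t => B * expR (K * t))) => //.
- exact: ltW.
- by move=> t; exact: is_derive_continuous (P1d t).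
- by move=> t; exact: is_derive_continuous (P2d t).
- by move=> t; exact: is_derive_continuous (dE t).
- by move=> t _; rewrite !mulr_ge0// expR_ge0.
move=> t /andP[t0 _]; apply: le_trans (gB t (ltW t0)) _.
by rewrite ler_peMr ?mulr_ge0 ?expR_ge0// lerDr mulr_ge0// ltW.
Qed.

Lemma continuous_Jop e g : 0 <= e -> continuous g -> continuous (Jop e g).
Proof.
move=> e0 cg x.
have N0 : (0 : R) < N%:R by rewrite ltr0n; apply: leq_trans N2.
have [P0 Pd] := primP (@continuous_rhoXM e _ cg).
have [x0|x0|->] := ltgtP x 0.
- apply: (near_cst_continuous (g 0 / N%:R)); near=> t.
  by rewrite /Jop ifT//; apply: ltW; near: t; exact: lt_nbhsl.
- have : {for x, continuous (fun s => prim (fun t => rho e t ^+ (N - 2) * g t) s / rho e s ^+ N)}.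
    apply: cvgM; first exact: is_derive_continuous (Pd x).
    apply: (@continuousV _ _ (fun s => rho e s ^+ N)); last exact: continuous_rhoX.
    by rewrite gt_eqF// exprn_gt0// rho_gt0.
  apply: near_continuous_at; near=> t.
  by rewrite /Jop ifF//; apply/negbTE; rewrite -ltNge; near: t; exact: lt_nbhsr.
- apply/cvgrPdist_le => /= d d0.
  have /cvgrPdist_le /(_ (d / 2)) /= := cg 0.
  rewrite divr_gt0// => /(_ isT) /nbhs_ballP[r /= r0 rd].
  near=> s.
  rewrite {1}/Jop lexx /Jop; case: ifPn => [_|]; first by rewrite subrr normr0 ltW.
  rewrite -ltNge => s0.
  have rN : 0 < rho e s ^+ N by rewrite exprn_gt0// rho_gt0.
  (* The constant g 0 is replaced by g 0 (e t + 1), whose weighted primitive is exactly g 0 rho^N /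
     N; the error g 0 e t is small near 0. *)
  have H2d t : 0 < t -> has_derive t 1 (fun t => g 0 / N%:R * rho e t ^+ N)
      (rho e t ^+ (N - 2) * (g 0 * (e * t + 1))).
    move=> t0; apply: is_deriveE.
      by apply: is_deriveME; [exact: is_derive_cstE|exact: is_derive_rhoN].
    by rewrite /=; field; rewrite gt_eqF.
  have := @rhoX_weighted_le e g (fun t => g 0 * (e * t + 1)) _
    (fun t => g 0 / N%:R * rho e t ^+ N) (fun=> 0) (fun=> d) s e0 (ltW s0) P0 _ _ _
    (fun t _ => Pd t) H2d.
  rewrite rho0 expr0n.
  have -> : N == 0%N = false by case: N N2.
  rewrite mulr0 => /(_ erefl) H.
  have : `|prim (fun t => rho e t ^+ (N - 2) * g t) s - g 0 / N%:R * rho e s ^+ N|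
      <= d * rho e s ^+ N / N%:R.
    apply: H => //.
    + by move=> t; exact: is_derive_continuous (Pd t).
    + by move=> t; apply: cvgM; [exact: cvg_cst|exact: continuous_rhoX].
    + by move=> t; exact: cvg_cst.
    + by move=> t; exact: is_derive_cstE.
    + move=> t /andP[t0 ts].
      have : `|g 0 - g t| <= d / 2.
        apply: rd; rewrite /ball /= sub0r normrN gtr0_norm//; apply: lt_trans ts _.
        by near: s; apply: lt_nbhsl.
      have : `|g 0| * (e * t) <= d / 2.
        apply: le_trans (_ : `|g 0| * (e * s) <= _).
          by rewrite ler_wpM2l// ler_wpM2l// ltW.
        have : s < d / (2 * (`|g 0| * e + 1)).
          near: s; apply: lt_nbhsl; rewrite divr_gt0// mulr_gt0//.
          by rewrite ltr_pwDr// mulr_ge0.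
        have ge0 : 0 <= `|g 0| * e by rewrite mulr_ge0.
        rewrite ltr_pdivlMr; last by lra.
        by nra.
      have -> : g t - g 0 * (e * t + 1) = - (g 0 - g t) - g 0 * (e * t) by rewrite /=; ring.
      move=> A1 A2; apply: le_trans (ler_normB _ _) _; rewrite normrN normrM.
      have et : 0 <= e * t by rewrite mulr_ge0// ltW.
      by rewrite (ger0_norm et); nra.
  have -> : g 0 / N%:R - prim (fun t => rho e t ^+ (N - 2) * g t) s / rho e s ^+ N =
    - ((prim (fun t => rho e t ^+ (N - 2) * g t) s - g 0 / N%:R * rho e s ^+ N) /
      rho e s ^+ N) by field; rewrite !gt_eqF.
  rewrite normrN normrM normfV (gtr0_norm rN) ler_pdivrMr// => /le_trans; apply.
  rewrite ler_piMr ?mulr_ge0 ?(ltW d0) ?(ltW rN)//.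
  by rewrite invf_le1// ler1n; apply: leq_trans N2.
Unshelve. all: by end_near.
Qed.

Lemma is_derive_Jop e g s : 0 <= e -> continuous g -> 0 < s ->
  has_derive s 1 (Jop e g) ((g s - N%:R * (e * s + 1) * Jop e g s) / qf e s).
Proof.
move=> e0 cg s0.
have [P0 Pd] := primP (@continuous_rhoXM e _ cg).
have r0 := rho_gt0 e0 s0.
have JE : \forall t \near s,
    prim (fun t => rho e t ^+ (N - 2) * g t) t / rho e t ^+ N = Jop e g t.
  near=> t; rewrite /Jop ifF//; apply/negbTE; rewrite -ltNge; near: t.
  exact: lt_nbhsr.
apply: (near_is_derive JE).
apply: is_deriveE.
  apply: (@is_deriveME R R _ (fun t => (rho e t ^+ N)^-1)); first exact: Pd.
  apply: is_deriveVE; last exact: is_derive_rhoN.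
  by rewrite gt_eqF// exprn_gt0.
rewrite /Jop leNgt s0 /= -sqr_rho ?(ltW s0)//.
set P := prim _ _; have : rho e s ^+ (N - 2) != 0 by rewrite expf_neq0// gt_eqF.
have -> : rho e s ^+ N = rho e s ^+ (N - 2) * rho e s ^+ 2.
  by rewrite -exprD subnK.
set r := rho _ _ ^+ (N - 2) => rn; field.
by rewrite rn gt_eqF.
Unshelve. all: by end_near.
Qed.

(** Completeness by nested intervals: those of radius 2 C / 2^n about [x n], the size of the
    remaining series, decrease. *)
Lemma geometric_limit (x : nat -> R) (C : R) :
  (forall n, `|x n.+1 - x n| <= C / 2 ^+ n) ->
  exists l, forall n, `|l - x n| <= 2 * C / 2 ^+ n.
Proof.
move=> xC; pose a n := x n - 2 * C / 2 ^+ n; pose b n := x n + 2 * C / 2 ^+ n.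
have p2 n : 2 * C / 2 ^+ n.+1 = C / 2 ^+ n :> R.
  by rewrite exprS; field; rewrite expf_neq0.
have q2 n : 2 * C / 2 ^+ n = 2 * (C / 2 ^+ n) :> R by rewrite mulrA.
have aS n : a n <= a n.+1.
  have := xC n; rewrite /a p2 q2 ler_norml => /andP[]; lra.
have bS n : b n.+1 <= b n.
  have := xC n; rewrite /b p2 q2 ler_norml => /andP[]; lra.
have am : {homo a : n m / (n <= m)%N >-> n <= m} := homo_leq (@lexx _ _) (@le_trans _ _) aS.
have bm : {homo b : n m / (n <= m)%N >-> m <= n}.
  by apply: homo_leq => [y|y z t|//]; [exact: lexx|move=> H1 H2; exact: le_trans H2 H1].
have ab n m : a n <= b m.
  apply: le_trans (am _ _ (leq_maxl n m)) (le_trans _ (bm _ _ (leq_maxr n m))).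
  have := le_trans (normr_ge0 _) (xC (maxn n m)); rewrite /a /b q2; lra.
have sa n : a n <= sup (range a).
  apply: ub_le_sup; last by exists n.
  by exists (b 0%N) => _ [m _ <-]; exact: ab.
have sb n : sup (range a) <= b n.
  by apply: ge_sup; [exists (a 0%N), 0%N|move=> _ [m _ <-]; exact: ab].
exists (sup (range a)) => n; rewrite ler_norml.
by have := sa n; have := sb n; rewrite /a /b; lra.
Qed.

Lemma le_geometric0 (x C : R) : (forall n, x <= C / 2 ^+ n) -> x <= 0.
Proof.
move=> xC; rewrite leNgt; apply/negP => x0.
have := xC (Num.truncn (C / x)).+1; rewrite ler_pdivlMr ?exprn_gt0//.
have h : (Num.truncn (C / x)).+1%:R <= 2 ^+ (Num.truncn (C / x)).+1 :> R.
  by rewrite -natrX ler_nat ltnW// ltn_expl.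
have : C / x < (Num.truncn (C / x)).+1%:R by rewrite truncnS_gt.
rewrite ltr_pdivrMr// => h1 h2.
by have := ler_wpM2l (ltW x0) h; lra.
Qed.

End radial_equation.

(** * Global existence for Lipschitz nonlinearities *)

Section existence.
Context {R : realType} (N : nat) (N2 : (2 <= N)%N).
Implicit Types (g G w z : R -> R) (e s t K B L M : R).

Let N0 : (0 : R) < N%:R. Proof. by rewrite ltr0n; apply: leq_trans N2. Qed.

Lemma eq_ler (x y : R) : x = y -> x <= y.
Proof. by move->. Qed.

Definition picard e g (alpha : R) w s : R :=
  alpha - prim (Jop N e (fun t => g (w t))) s.

Lemma continuous_comp_all g w : continuous g -> continuous w ->
  continuous (fun t => g (w t)).
Proof. by move=> cg cw t; apply: (continuous_comp (cw t)); exact: cg. Qed.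

Lemma has_derive_picard e g alpha w s : 0 <= e -> continuous g ->
  continuous w -> has_derive s 1 (picard e g alpha w) (- Jop N e (fun t => g (w t)) s).
Proof.
move=> e0 cg cw.
have cJ := continuous_Jop N2 e0 (continuous_comp_all cg cw).
have [_ dP] := primP cJ.
rewrite -[- _]add0r; apply: is_deriveDE; first exact: is_derive_cstE.
by apply: is_deriveNE; exact: dP.
Qed.

(** Bielecki's weight: integrating a bound [L * B * expR (K * t)] gains a factor 1 / K, so
    [2 * L <= K] makes the iteration a contraction of factor 1/2 on the whole half-line at once,
    without continuation of local solutions. *)
Lemma picard_le e g alpha L K B w1 w2 s : 0 <= e -> continuous g -> 0 < L ->
  (forall x y, `|g x - g y| <= L * `|x - y|) -> 2 * L <= K -> 0 <= B ->
  continuous w1 -> continuous w2 -> 0 <= s ->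
  (forall t, 0 <= t -> `|w1 t - w2 t| <= B * expR (K * t)) ->
  `|picard e g alpha w1 s - picard e g alpha w2 s| <= B / 2 * expR (K * s).
Proof.
move=> e0 cg L0 gL LK B0 c1 c2 s0 wB.
have K0 : 0 < K by lra.
have cJ1 := continuous_Jop N2 e0 (continuous_comp_all cg c1).
have cJ2 := continuous_Jop N2 e0 (continuous_comp_all cg c2).
have [P10 dP1] := primP cJ1; have [P20 dP2] := primP cJ2.
rewrite /picard.
set P1 := prim _ in P10 dP1 *; set P2 := prim _ in P20 dP2 *.
have -> : alpha - P1 s - (alpha - P2 s) = - (P1 s - P2 s) by ring.
rewrite normrN.
have dE (t : R) : has_derive t 1 (fun t => B / 2 * expR (K * t))
    (B / 2 * (K * expR (K * t))).
  apply: is_deriveE.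
    apply: is_deriveME; first exact: is_derive_cstE.
    apply: (@is_derive_compE _ _ expR (fun t => K * t)).
      exact: is_derive_expR.
    by is_der.
  by rewrite /=; ring.
have := @derive_normr_le R (fun t => P1 t - P2 t)
  (fun t => Jop N e (fun t => g (w1 t)) t - Jop N e (fun t => g (w2 t)) t)
  (fun t => B / 2 * expR (K * t)) (fun t => B / 2 * (K * expR (K * t))) 0 s s0.
rewrite P10 P20 !subr0 mulr0 expR0 => H.
apply: (le_trans (H _ _ _ _ _)).
- move=> t _; apply: continuousB; exact: continuous_prim.
- by move=> t _; exact: is_derive_continuous (dE t).
- by move=> t _; apply: is_deriveB; [exact: dP1|exact: dP2].
- by move=> t _; exact: dE.
- move=> t /andP[t0 _]; apply: le_trans (_ : (L * B) * expR (K * t) <= _).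
    apply: (@Jop_le _ _ N2 e _ _ K (L * B)) => //.
    + exact: ltW.
    + by rewrite mulr_ge0// ltW.
    + exact: continuous_comp_all.
    + exact: continuous_comp_all.
    + exact: ltW.
    + move=> r r0; apply: le_trans (gL _ _) _; rewrite -mulrA.
      by apply: ler_wpM2l; [exact: ltW|exact: wB].
  rewrite mulrA ler_wpM2r ?expR_ge0//.
  have -> : B / 2 * K = K / 2 * B by ring.
  by rewrite ler_wpM2r//; lra.
by rewrite lerBlDr lerDl mulr1 divr_ge0.
Qed.

Fixpoint picard_iter e g (alpha : R) n : R -> R :=
  if n is m.+1 then picard e g alpha (picard_iter e g alpha m) else fun=> alpha.

Lemma continuous_picard_iter e g alpha n : 0 <= e -> continuous g ->
  continuous (picard_iter e g alpha n).
Proof.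
move=> e0 cg; elim: n => [|n IH] /= x; first exact: cvg_cst.
exact: is_derive_continuous (has_derive_picard _ _ e0 cg IH).
Qed.

Lemma lipschitz_continuous_at (f : R -> R) L : 0 < L ->
  (forall x y, `|f x - f y| <= L * `|x - y|) -> continuous f.
Proof.
move=> L0 fL x; apply/cvgrPdist_le => /= d d0; near=> y.
apply: le_trans (fL x y) _; rewrite mulrC -ler_pdivlMr//.
by apply: ltW; near: y; apply: cvgr_dist_lt => //; rewrite divr_gt0.
Unshelve. all: by end_near.
Qed.

Lemma picard_fixpoint e g alpha L : 0 <= e -> 0 < L ->
  (forall x y, `|g x - g y| <= L * `|x - y|) ->
  exists2 u : R -> R, continuous u & u 0 = alpha /\
    forall s, 0 <= s -> u s = picard e g alpha u s.
Proof.
move=> e0 L0 gL; have cg : continuous g := lipschitz_continuous_at L0 gL.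
pose K := 2 * L; have K0 : 0 < K by rewrite mulr_gt0.
pose W := picard_iter e g alpha; pose B := `|g alpha| / K.
have B0 : 0 <= B by rewrite divr_ge0// ltW.
have cW n : continuous (W n) by exact: continuous_picard_iter.
have W10 s : 0 <= s -> `|W 1%N s - W 0%N s| <= B * expR (K * s).
  move=> s0; rewrite /W /= /picard /=.
  set J := Jop _ _ _.
  have cJ : continuous J by apply: continuous_Jop => // x; exact: cvg_cst.
  have [P0 dP] := primP cJ.
  have -> : alpha - prim J s - alpha = - prim J s by ring.
  have dE (t : R) : has_derive t 1 (fun t => B * expR (K * t))
      (B * (K * expR (K * t))).
    apply: is_deriveE.
      apply: is_deriveME; first exact: is_derive_cstE.
      apply: (@is_derive_compE _ _ expR (fun t => K * t)).
        exact: is_derive_expR.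
      by is_der.
    by rewrite /=; ring.
  have := @derive_normr_le R (prim J) J
    (fun t => B * expR (K * t)) (fun t => B * (K * expR (K * t))) 0 s s0.
  rewrite normrN P0 !subr0 mulr0 expR0 => H.
  apply: (le_trans (H _ _ _ _ _)).
  - by move=> t _; exact: continuous_prim.
  - by move=> t _; exact: is_derive_continuous (dE t).
  - by move=> t _; exact: dP.
  - by move=> t _; exact: dE.
  - move=> t /andP[t0 _].
    have -> : B * (K * expR (K * t)) = `|g alpha| * expR (K * t).
      by rewrite mulrA /B divfK// gt_eqF.
    have J0 : Jop N e (fun=> 0) t = 0.
      rewrite /Jop; case: ifP => _; first by rewrite mul0r.
      have c0 : continuous (fun t => rho e t ^+ (N - 2) * (0 : R)).
        by move=> x; under eq_fun do rewrite mulr0; exact: cvg_cst.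
      have [p0 dp] := primP c0.
      suff -> : prim (fun t => rho e t ^+ (N - 2) * 0) t = 0 by rewrite mul0r.
      have := @derive_normr_le R _ _ (fun=> 0) (fun=> 0) 0 t (ltW t0)
        (fun x _ => @continuous_prim _ _ c0 x) (fun x _ => @cvg_cst _ _ _ _ _)
        (fun x _ => dp x) (fun x _ => is_derive_cstE _ _ _).
      rewrite p0 !subr0 => h0; apply/eqP; rewrite -normr_le0; apply: h0 => x _.
      by rewrite mulr0 normr0.
    rewrite -[J t]subr0 -J0; apply: (@Jop_le _ _ N2 e _ _ K) => //.
    + exact: ltW.
    + by move=> x; exact: cvg_cst.
    + by move=> x; exact: cvg_cst.
    + exact: ltW.
    + move=> r r0; rewrite subr0 ler_peMr//.
      have := @expR_ge1Dx R (K * r); apply: le_trans.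
      by rewrite lerDl mulr_ge0// ltW.
  by rewrite lerBlDr lerDl mulr1.
have WS n s : 0 <= s -> `|W n.+1 s - W n s| <= B * expR (K * s) / 2 ^+ n.
  elim: n s => [|n IH] s s0; first by rewrite expr0 divr1; exact: W10.
  have := @picard_le e g alpha L K (B / 2 ^+ n) (W n.+1) (W n) s e0 cg L0 gL.
  rewrite lexx => /(_ isT) H; apply: le_trans (H _ _ _ s0 _) _ => //.
  - by rewrite divr_ge0// exprn_ge0.
  - by move=> t t0; rewrite mulrAC; exact: IH.
  by rewrite exprS invfM; apply: eq_ler; ring.
have /choice[u0 Hu0] (s : R) : exists l, 0 <= s -> forall n,
    `|l - W n s| <= 2 * (B * expR (K * s)) / 2 ^+ n.
  have [s0|s0] := leP 0 s; last by exists 0.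
  by have [l Hl] := geometric_limit (fun n => WS n s s0); exists l.
(* The iterates converge for s >= 0 only. The limit is extended by a constant to the left, because
   [prim] and [Jop] need continuity on the whole line. *)
pose u s := u0 (Num.max 0 s).
have m0 s : 0 <= Num.max 0 s by rewrite le_max lexx.
have uW n s : `|u s - W n (Num.max 0 s)| <= 2 * (B * expR (K * Num.max 0 s)) / 2 ^+ n.
  exact: Hu0.
have uE s : 0 <= s -> u s = u0 s by move=> s0; rewrite /u max_r.
have cu : continuous u.
  move=> x; apply/cvgrPdist_le => /= d d0.
  pose C := 2 * (B * expR (K * (`|x| + 1))).
  have C0 : 0 <= C by apply: mulr_ge0 => //; apply: mulr_ge0 => //; exact: expR_ge0.
  have [n hn] : exists n, C / 2 ^+ n <= d / 3.
    apply: contrapT => /forallNP H; suff : d / 3 <= 0 by lra.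
    by apply: (@le_geometric0 _ _ C) => n; move/negP: (H n); rewrite -ltNge => /ltW.
  have cWm : {for x, continuous (fun s => W n (Num.max 0 s))}.
    apply: (@continuous_comp _ _ _ (fun s => Num.max 0 s) (W n)); last exact: cW.
    by apply: continuous_max; [exact: cvg_cst|exact: cvg_id].
  have uC t : `|x - t| < 1 -> `|u t - W n (Num.max 0 t)| <= d / 3.
    move=> xt; apply: le_trans (uW n t) (le_trans _ hn).
    rewrite ler_pM2r ?invr_gt0 ?exprn_gt0// ler_pM2l// ler_wpM2l// ler_expR.
    rewrite ler_pM2l// ge_max addr_ge0//=.
    by have := ler_norm x; have := ler_norm (- (x - t)); rewrite normrN; lra.
  near=> t.
  have xt : `|x - t| < 1 by near: t; apply: cvgr_dist_lt.
  have h1 := uC t xt.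
  have h2 : `|u x - W n (Num.max 0 x)| <= d / 3 by apply: uC; rewrite subrr normr0.
  have h3 : `|W n (Num.max 0 x) - W n (Num.max 0 t)| <= d / 3.
    by near: t; move/cvgrPdist_le: cWm; apply; rewrite divr_gt0.
  by move: h1 h2 h3; rewrite !ler_norml; lra.
exists u => //; split.
  have : u 0 - alpha = 0; last by lra.
  apply/eqP; rewrite -normr_le0; apply: (@le_geometric0 _ _ (2 * B)) => n.
  have := uW n 0; rewrite maxxx mulr0 expR0 mulr1.
  suff -> : W n 0 = alpha by [].
  case: n => [//|n]; rewrite /W /= /picard.
  have cJ := continuous_Jop N2 e0 (continuous_comp_all cg (cW n)).
  by have [-> _] := primP cJ; rewrite subr0.
move=> s s0; suff : u s - picard e g alpha u s = 0 by lra.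
apply/eqP; rewrite -normr_le0.
apply: (@le_geometric0 _ _ (2 * (B * expR (K * s)))) => n.
have h1 := uW n.+1 s; rewrite (max_r s0) in h1.
have := @picard_le e g alpha L K (2 * B / 2 ^+ n) u (W n) s e0 cg L0 gL.
rewrite lexx => /(_ isT) H.
have {H} h2 : `|picard e g alpha u s - W n.+1 s| <= 2 * B / 2 ^+ n / 2 * expR (K * s).
  apply: H => //; first by apply: divr_ge0; [exact: mulr_ge0|exact: exprn_ge0].
  by move=> t t0; have := uW n t; rewrite (max_r t0) => h; apply: le_trans h _;
    apply: eq_ler; ring.
have -> : u s - picard e g alpha u s =
  (u s - W n.+1 s) - (picard e g alpha u s - W n.+1 s) by ring.
apply: le_trans (ler_normB _ _) _.
have h3 : 2 * (B * expR (K * s)) / 2 ^+ n.+1 = B * expR (K * s) / 2 ^+ n.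
  by rewrite exprS; field; rewrite expf_neq0.
have h4 : 2 * B / 2 ^+ n / 2 * expR (K * s) = B * expR (K * s) / 2 ^+ n.
  by field; rewrite expf_neq0.
have h5 : 2 * (B * expR (K * s)) / 2 ^+ n = 2 * (B * expR (K * s) / 2 ^+ n).
  by ring.
by move: h1 h2; rewrite h3 h4 h5; lra.
Unshelve. all: by end_near.
Qed.

Lemma radial_sol_lipschitz e g alpha L : 0 <= e -> 0 < L ->
  (forall x y, `|g x - g y| <= L * `|x - y|) ->
  exists w z, radial_sol N e g alpha w z.
Proof.
move=> e0 L0 gL; have cg : continuous g := lipschitz_continuous_at L0 gL.
have [u cu [u0 uP]] := picard_fixpoint alpha e0 L0 gL.
have cgu := continuous_comp_all cg cu.
(* The image of u is taken instead of u: they agree for s >= 0, but only the image is known to be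
   differentiable at every s, as [radial_sol] demands. *)
exists (picard e g alpha u), (fun s => - Jop N e (fun t => g (u t)) s); split.
- by rewrite -uP.
- by move=> s; exact: has_derive_picard.
- by move=> s; apply: continuousN; exact: continuous_Jop.
- by rewrite /Jop lexx u0 mulNr.
move=> s s0; rewrite -uP ?ltW//; apply: is_deriveE.
  by apply: is_deriveNE; exact: is_derive_Jop.
by have := qf_gt0 e0 s0 => q0; rewrite /=; field; rewrite gt_eqF.
Qed.

End existence.

(** * The nonlinearity |u|^(p-1) u *)

Section signed_power.
Context {R : realType}.
Implicit Types (u v x y M : R).

Definition spow (p u : R) : R := `|u| `^ (p - 1) * u.

Lemma dist_maxr_le (a x y : R) : `|Num.max a x - Num.max a y| <= `|x - y|.
Proof.
wlog xy : x y / x <= y.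
  by move=> H; have [|/ltW] := leP x y => /H //; rewrite distrC [leRHS]distrC.
rewrite distrC [leRHS]distrC !ger0_norm ?subr_ge0 ?le_max2 // lerBlDr ge_max.
have h1 : a <= Num.max a x by rewrite le_max lexx.
have h2 : x <= Num.max a x by rewrite le_max lexx orbT.
by apply/andP; split; flra.
Qed.

Lemma dist_minr_le (b x y : R) : `|Num.min x b - Num.min y b| <= `|x - y|.
Proof.
wlog xy : x y / x <= y.
  by move=> H; have [|/ltW] := leP x y => /H //; rewrite distrC [leRHS]distrC.
rewrite distrC [leRHS]distrC !ger0_norm ?subr_ge0 ?le_min2 // lerBlDr -lerBlDl le_min.
have h1 : Num.min y b <= y by rewrite ge_min lexx.
have h2 : Num.min y b <= b by rewrite ge_min lexx orbT.
by apply/andP; split; flra.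
Qed.

Lemma ler_powR_norm (k u v : R) : 0 <= k -> `|u| <= `|v| -> `|u| `^ k <= `|v| `^ k.
Proof. by move=> k0 uv; apply: ge0_ler_powR => //; rewrite nnegrE. Qed.

Lemma continuous_powR_norm (k : R) : 0 < k -> continuous (fun u : R => `|u| `^ k).
Proof.
move=> k0 u; have [->|u0] := eqVneq u 0.
  apply/cvgrPdist_le => /= d d0; rewrite normr0 powR0 ?gt_eqF//.
  have dk : 0 < d `^ k^-1 by rewrite powR_gt0.
  have dkn : \forall t \near (0 : R), `|t| < d `^ k^-1.
    by apply/nbhs_ballP; exists (d `^ k^-1) => //= t; rewrite /ball /= sub0r normrN.
  near=> t; rewrite sub0r normrN ger0_norm ?powR_ge0//.
  have td : `|t| <= d `^ k^-1.
    by apply: ltW; near: t.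
  have -> : d = `|d `^ k^-1| `^ k.
    by rewrite gtr0_norm// -powRrM mulVf ?gt_eqF// powRr1// ltW.
  by apply: ler_powR_norm; [exact: ltW|rewrite (gtr0_norm dk)].
apply: (@continuous_comp _ _ _ (fun t : R => `|t|) (fun x => x `^ k)).
  exact: norm_continuous.
apply: is_derive_continuous (is_derive1_powR k _).
by rewrite normr_gt0.
Unshelve. all: by end_near.
Qed.

Lemma has_derive_spow (p u : R) : 1 < p ->
  has_derive u 1 (spow p) (p * `|u| `^ (p - 1)).
Proof.
move=> p1; have k0 : 0 < p - 1 by flra.
have [u0|u0|->] := ltgtP u 0.
- have E : \forall t \near u, - (- t) `^ p = spow p t.
    near=> t; have t0 : t < 0 by near: t; exact: lt_nbhsl.
    have -> : (- t) `^ p = - t * (- t) `^ (p - 1).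
      by rewrite mulr_powRB1 ?oppr_ge0 ?(ltW t0)//; flra.
    by rewrite /spow ltr0_norm//; ring.
  apply: (near_is_derive E).
  apply: is_deriveE.
    apply: is_deriveNE; apply: (@is_derive_compE _ _ (fun x => x `^ p) (fun t => - t)).
      by apply: is_derive1_powR; rewrite oppr_gt0.
    by apply: is_deriveNE; exact: is_derive_idE.
  by rewrite ltr0_norm//; ring.
- have E : \forall t \near u, t `^ p = spow p t.
    near=> t; have t0 : 0 < t by near: t; exact: lt_nbhsr.
    rewrite /spow gtr0_norm// [RHS]mulrC mulr_powRB1 ?(ltW t0)//; flra.
  apply: (near_is_derive E); rewrite (gtr0_norm u0); exact: is_derive1_powR.
(* At 0 the difference quotient is |u|^(p-1) itself, which tends to 0 because p > 1. *)
- apply/is_derive1_caratheodory; exists (fun u => `|u| `^ (p - 1)); split.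
  + by move=> z; rewrite /spow mulr0 !subr0.
  + exact: continuous_powR_norm.
  + by rewrite normr0 powR0 ?mulr0// gt_eqF.
Unshelve. all: by end_near.
Qed.

Lemma continuous_spow (p : R) : 1 < p -> continuous (spow p).
Proof. by move=> p1 u; exact: is_derive_continuous (has_derive_spow u p1). Qed.

Lemma spowN (p u : R) : spow p (- u) = - spow p u.
Proof. by rewrite /spow normrN mulrN. Qed.

Lemma mul_spow (p u : R) : u * spow p u = `|u| `^ (p - 1) * u ^+ 2.
Proof. by rewrite /spow; ring. Qed.

Lemma mul_spow_ge0 (p u : R) : 0 <= u * spow p u.
Proof. by rewrite mul_spow mulr_ge0 ?powR_ge0// sqr_ge0. Qed.

Lemma has_derive_spow_primitive (p u : R) : 1 < p ->
  has_derive u 1 (fun u => u * spow p u / (p + 1)) (spow p u).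
Proof.
move=> p1; apply: is_deriveE.
  apply: is_deriveME; last exact: is_derive_cstE.
  by apply: is_deriveME; [exact: is_derive_idE|exact: has_derive_spow].
by rewrite /= /spow; field; rewrite gt_eqF//; flra.
Qed.

Lemma lipschitz_of_derive (f df : R -> R) (L M : R) :
  (forall x, has_derive x 1 f (df x)) ->
  (forall x, `|x| <= M -> `|df x| <= L) ->
  forall x y, `|x| <= M -> `|y| <= M -> `|f x - f y| <= L * `|x - y|.
Proof.
move=> fd dfL x y; wlog xy : x y / y <= x.
  move=> H xM yM; have [yx|/ltW yx] := leP y x; first exact: H.
  by rewrite distrC [`|x - y|]distrC; exact: H.
move=> /ler_normlP[x1 x2] /ler_normlP[y1 y2].
rewrite (ger0_norm (_ : 0 <= x - y)) ?subr_ge0// mulrBr.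
have := @derive_normr_le _ f df (fun t => L * t) (fun=> L) y x xy; apply.
- by move=> t _; exact: is_derive_continuous (fd t).
- move=> t _; apply: cvgM; [exact: cvg_cst|exact: cvg_id].
- by move=> t _; exact: fd.
- move=> t _; apply: is_deriveE.
    apply: is_deriveME; [exact: is_derive_cstE|exact: is_derive_idE].
  by rewrite /=; ring.
by move=> t /andP[yt tx]; apply: dfL; rewrite ler_norml; flra.
Qed.

End signed_power.

(** * Energy, and global solutions for superlinear nonlinearities *)

Section truncated_existence.
Context {R : realType} (N : nat) (N2 : (2 <= N)%N).
Implicit Types (g G w z : R -> R) (e s t u v x y alpha K B L M : R).

Lemma radial_sol_continuous e g alpha w z : radial_sol N e g alpha w z ->
  continuous w.
Proof. by case=> _ dw _ _ _ s; exact: is_derive_continuous (dw s). Qed.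

(** Mechanical energy: for e = 1, q z^2 is the square of the derivative of u with respect to the
    hyperbolic distance. The term q' z^2 / 2 = (e s + 1) z^2 takes one unit off the damping N (e s +
    1) z^2, and N - 1 units remain. *)
Lemma has_derive_energy e g G alpha w z s : 0 <= e ->
  radial_sol N e g alpha w z -> (forall u, has_derive u 1 G (g u)) -> 0 < s ->
  has_derive s 1 (fun s => qf e s * z s ^+ 2 / 2 + G (w s))
    (- (N%:R - 1) * (e * s + 1) * z s ^+ 2).
Proof.
move=> e0 [_ dw cz _ dz] dG s0; apply: is_deriveE.
  apply: is_deriveDE; last first.
    by apply: is_derive_compE (dG _) (dw s).
  apply: is_deriveME; last exact: is_derive_cstE.
  by apply: is_deriveME; [exact: is_derive_qf|apply: is_deriveXE; exact: dz].
have := qf_gt0 e0 s0 => q0; rewrite /=; field.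
by rewrite gt_eqF.
Qed.

Lemma continuous_qf e : continuous (@qf R e).
Proof. by move=> s; exact: is_derive_continuous (is_derive_qf e s). Qed.

Lemma continuous_energy e g G alpha w z : radial_sol N e g alpha w z ->
  (forall u, has_derive u 1 G (g u)) ->
  continuous (fun s => qf e s * z s ^+ 2 / 2 + G (w s)).
Proof.
move=> sol dG s; have cw := radial_sol_continuous sol.
case: sol => _ _ cz _ _; apply: cvgD.
  apply: cvgM; last exact: cvg_cst.
  apply: cvgM; first exact: continuous_qf.
  by apply: (@continuous_comp _ _ _ z (fun x => x ^+ 2)); [exact: cz|exact: exprn_continuous].
by apply: (@continuous_comp _ _ _ w G); [exact: cw|exact: is_derive_continuous (dG _)].
Qed.

Lemma energy_nonincreasing e g G alpha w z s t : 0 <= e ->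
  radial_sol N e g alpha w z -> (forall u, has_derive u 1 G (g u)) ->
  0 <= s -> s <= t ->
  qf e t * z t ^+ 2 / 2 + G (w t) <= qf e s * z s ^+ 2 / 2 + G (w s).
Proof.
move=> e0 sol dG s0 st.
have N1 : (1 : R) <= N%:R by rewrite ler1n; apply: leq_trans N2.
have := @derive_nonincreasing _ (fun s => qf e s * z s ^+ 2 / 2 + G (w s))
  (fun s => - (N%:R - 1) * (e * s + 1) * z s ^+ 2) s t st; apply.
- by move=> x _; exact: (continuous_energy sol dG).
- by move=> x /andP[sx _]; apply: (has_derive_energy e0 sol dG); flra.
- move=> x /andP[sx _]; rewrite !mulNr oppr_le0.
  have ex : 0 <= e * x by rewrite mulr_ge0//; flra.
  by rewrite mulr_ge0 ?sqr_ge0// mulr_ge0//; flra.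
Qed.

(** Freezing [g] outside [-M, M] makes it globally Lipschitz. The energy of the modified equation
    starts at the potential of alpha, since [qf] vanishes at 0, and never increases; so w cannot
    reach M or - M, where the potential is higher, and the modification is never felt. *)
Lemma radial_sol_bounded e g G alpha M L : 0 <= e -> 0 < L -> `|alpha| < M ->
  (forall u, has_derive u 1 G (g u)) ->
  (forall u v, `|u| <= M -> `|v| <= M -> `|g u - g v| <= L * `|u - v|) ->
  G alpha < G M -> G alpha < G (- M) ->
  exists w z, radial_sol N e g alpha w z /\ forall s, 0 <= s -> `|w s| <= M.
Proof.
move=> e0 L0 aM dG gL GM GNM.
have M0 : 0 < M by apply: le_lt_trans aM.
pose cl u := Num.max (- M) (Num.min u M).
have clM u : `|cl u| <= M.
  by rewrite ler_norml /cl le_max ge_max ge_min !lexx /= !orbT /= andbT; flra.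
have clE u : `|u| <= M -> cl u = u.
  by rewrite ler_norml => /andP[u1 u2]; rewrite /cl (min_l u2) max_r.
have clL u v : `|cl u - cl v| <= `|u - v|.
  exact: le_trans (dist_maxr_le _ _ _) (dist_minr_le _ _ _).
pose gM u := g (cl u).
have gML u v : `|gM u - gM v| <= L * `|u - v|.
  by apply: le_trans (gL _ _ (clM _) (clM _)) _; rewrite ler_pM2l.
have [w [z sol]] := radial_sol_lipschitz N2 alpha e0 L0 gML.
have cgM : continuous gM := lipschitz_continuous_at L0 gML.
have [P0 dP] := primP cgM.
have cP := continuous_prim cgM.
have cG : continuous G by move=> x; exact: is_derive_continuous (dG x).
have same a b : - M <= a -> a <= b -> b <= M -> prim gM b - prim gM a = G b - G a.
  move=> Ma ab bM.
  have gE x : a < x < b -> gM x = g x.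
    by move=> /andP[xa xb]; rewrite /gM clE// ler_norml; flra.
  apply/eqP; rewrite eq_le; apply/andP; split.
    have := @derive_le _ (prim gM) gM G g a b ab; apply.
    - by move=> x _; exact: cP.
    - by move=> x _; exact: cG.
    - by move=> x _; exact: dP.
    - by move=> x _; exact: dG.
    - by move=> x /gE ->.
  have := @derive_le _ G g (prim gM) gM a b ab; apply.
  - by move=> x _; exact: cG.
  - by move=> x _; exact: cP.
  - by move=> x _; exact: dG.
  - by move=> x _; exact: dP.
  - by move=> x /gE ->.
(* On [-M, M] the potentials of the truncated and of the original equation differ by a constant, so
   the barrier inequalities for [G] hold for the former. *)
have PE u : `|u| <= M -> prim gM u - G u = - G 0.
  rewrite ler_norml => /andP[u1 u2]; have [u0|/ltW u0] := leP 0 u.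
    have H : prim gM u - prim gM 0 = G u - G 0 by apply: same; flra.
    by move: H; rewrite P0; flra.
  have H : prim gM 0 - prim gM u = G 0 - G u by apply: same; flra.
  by move: H; rewrite P0; flra.
have cw := radial_sol_continuous sol.
have w0 : w 0 = alpha by case: sol.
have wM s : 0 <= s -> `|w s| <= M.
  move=> s0; rewrite leNgt; apply/negP => Ms.
  have [t /andP[t0 ts] /eqP] : exists2 t, 0 <= t <= s & `|w t| - M = 0.
    apply: (@ivt0 _ (fun t => `|w t| - M)) => //.
      move=> x _; apply: cvgB; last exact: cvg_cst.
      by apply: (@continuous_comp _ _ _ w (fun x => `|x|)); [exact: cw|exact: norm_continuous].
    by rewrite w0; fnra.
  rewrite subr_eq0 => /eqP wt.
  have := energy_nonincreasing e0 sol dP (lexx 0) t0.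
  rewrite w0 /qf mul0r !mul0r add0r -/(qf e t).
  have := PE alpha (ltW aM); have := PE (w t); rewrite wt lexx => /(_ isT).
  have : G alpha < G (w t).
    by move: wt; case: (ger0P (w t)) => _ wt; [rewrite wt|rewrite -(opprK (w t)) wt].
  have := mulr_ge0 (qf_ge0 e0 t0) (sqr_ge0 (z t)).
  by set E := qf e t * _; flra.
exists w, z; split => //; case: sol => s1 s2 s3 s4 s5; split => //.
  by rewrite s4 /gM clE// ltW.
by move=> s s0; rewrite -[w s]clE; [exact: s5|apply: wM; exact: ltW].
Qed.

End truncated_existence.

(** * Continuous dependence on the data and on e, and uniqueness *)

Section dependence.
Context {R : realType} (N : nat) (N2 : (2 <= N)%N).
Implicit Types (g G w z : R -> R) (e s t u v x y alpha K B L M T : R).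

Lemma continuous_phase e w z : continuous w -> continuous z ->
  continuous (fun s => qf e s * z s ^+ 2 + w s ^+ 2).
Proof.
move=> cw cz s; apply: cvgD.
  apply: cvgM; first exact: continuous_qf.
  by apply: (@continuous_comp _ _ _ z (fun x => x ^+ 2));
    [exact: cz|exact: exprn_continuous].
by apply: (@continuous_comp _ _ _ w (fun x => x ^+ 2));
  [exact: cw|exact: exprn_continuous].
Qed.

Lemma has_derive_expRZ K s : has_derive s 1 (fun s => expR (K * s)) (expR (K * s) * K).
Proof.
apply: is_deriveE.
  apply: (@is_derive_compE _ _ expR (fun t => K * t)); first exact: is_derive_expR.
  by is_der.
by rewrite /=; ring.
Qed.

Lemma continuous_expRZ K : continuous (fun s => expR (K * s)).
Proof. by move=> s; exact: is_derive_continuous (has_derive_expRZ K s). Qed.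

(** Gronwall's inequality for q (z1 - z2)^2 + (w1 - w2)^2. As q vanishes at 0, this quantity does
    not control z1 - z2 there; instead the damping leaves a term -2 (z1 - z2)^2, because N >= 2, and
    a completed square absorbs into it everything linear in z1 - z2. So no factor 1 / q enters the
    constant. *)
Lemma radial_sol_dist e1 e2 g1 g2 alpha1 alpha2 w1 z1 w2 z2 T L M B (d : R) :
  0 <= e1 -> 0 <= e2 -> 0 <= L -> 0 <= T -> 0 <= B -> 0 <= d ->
  radial_sol N e1 g1 alpha1 w1 z1 -> radial_sol N e2 g2 alpha2 w2 z2 ->
  (forall s, 0 <= s <= T -> `|w1 s| <= M) ->
  (forall s, 0 <= s <= T -> `|w2 s| <= M) ->
  (forall u v, `|u| <= M -> `|v| <= M -> `|g1 u - g1 v| <= L * `|u - v|) ->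
  (forall u, `|u| <= M -> `|g1 u - g2 u| <= d) ->
  (forall s, 0 <= s <= T -> `|z2 s| <= B /\ `|g2 (w2 s)| <= B) ->
  let C := T * (B * (N%:R * (e2 * T + 1) + 1)) + N%:R * T * B in
  forall s, 0 <= s <= T ->
    qf e1 s * (z1 s - z2 s) ^+ 2 + (w1 s - w2 s) ^+ 2 <=
    expR ((L + 1) ^+ 2 * T) *
      ((alpha1 - alpha2) ^+ 2 + (d + `|e1 - e2| * C) ^+ 2).
Proof.
move=> e10 e20 L0 T0 B0 d0 sol1 sol2 wM1 wM2 gL gd zB C s sT.
have N1 : 2 <= N%:R :> R by rewrite ler_nat.
have cw1 := radial_sol_continuous sol1; have cw2 := radial_sol_continuous sol2.
case: sol1 => w10 dw1 cz1 _ dz1; case: sol2 => w20 dw2 cz2 _ dz2.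
set K := (L + 1) ^+ 2; set eta := d + _ * C.
have K1 : 1 <= K by rewrite /K; fnra.
pose D s := qf e1 s * (z1 s - z2 s) ^+ 2 + (w1 s - w2 s) ^+ 2.
have cD : continuous D.
  by apply: continuous_phase => t; apply: continuousB; try exact: cw1;
    try exact: cw2; try exact: cz1; exact: cz2.
pose dD s := qf e1 s * (2 * (z1 s - z2 s) ^+ 1 *
   (- (N%:R * (e1 * s + 1) * z1 s + g1 (w1 s)) / qf e1 s
   + - (- (N%:R * (e2 * s + 1) * z2 s + g2 (w2 s)) / qf e2 s))) +
  (z1 s - z2 s) ^+ 2 * (2 * (e1 * s + 1)) +
  2 * (w1 s - w2 s) ^+ 1 * (z1 s - z2 s).
have DD t : 0 < t -> has_derive t 1 D (dD t).
  move=> t0; apply: is_deriveDE.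
    apply: is_deriveME; first exact: is_derive_qf.
    apply: is_deriveXE; apply: is_deriveDE; first exact: dz1.
    by apply: is_deriveNE; exact: dz2.
  by apply: is_deriveXE; apply: is_deriveDE;
    [exact: dw1|apply: is_deriveNE; exact: dw2].
have DK t : 0 < t <= T -> dD t <= K * D t + eta ^+ 2.
  move=> /andP[t0 tT].
  have tI : 0 <= t <= T by rewrite ltW.
  set om := w1 t - w2 t; set ze := z1 t - z2 t.
  (* What remains of the difference of the equations once the operator with parameter e1 acts on
     both solutions; the last term comes from qf e1 t / qf e2 t - 1 = (e1 - e2) t / (e2 t + 2). *)
  pose X := N%:R * (e1 - e2) * t * z2 t + (g1 (w1 t) - g2 (w2 t)) -
    (e1 - e2) * t * (N%:R * (e2 * t + 1) * z2 t + g2 (w2 t)) / (e2 * t + 2).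
  have e2t : 0 <= e2 * t by rewrite mulr_ge0// ltW.
  have e1t : 0 <= e1 * t by rewrite mulr_ge0// ltW.
  have dDE : dD t = - 2 * (N%:R - 1) * (e1 * t + 1) * ze ^+ 2 - 2 * ze * X +
      2 * om * ze.
    rewrite /dD /X /ze /om /qf; field.
    by rewrite !gt_eqF//; flra.
  have [zB1 gB1] := zB t tI.
  have X1 : `|X| <= L * `|om| + eta.
    have h1 : `|g1 (w1 t) - g2 (w2 t)| <= L * `|om| + d.
      have -> : g1 (w1 t) - g2 (w2 t) = (g1 (w1 t) - g1 (w2 t)) +
        (g1 (w2 t) - g2 (w2 t)) by ring.
      apply: le_trans (ler_normD _ _) _; apply: lerD; last exact: gd (wM2 _ tI).
      exact: gL (wM1 _ tI) (wM2 _ tI).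
    have h2 : `|N%:R * (e1 - e2) * t * z2 t| <= `|e1 - e2| * (N%:R * T * B).
      rewrite !normrM (ger0_norm (_ : 0 <= N%:R)) ?ler0n// (gtr0_norm t0).
      have -> : N%:R * `|e1 - e2| * t * `|z2 t| =
        `|e1 - e2| * (N%:R * (t * `|z2 t|)) by ring.
      by rewrite ler_wpM2l// -mulrA ler_wpM2l ?ler0n// ler_pM// ltW.
    have h3 : `|(e1 - e2) * t * (N%:R * (e2 * t + 1) * z2 t + g2 (w2 t)) /
        (e2 * t + 2)| <= `|e1 - e2| * (T * (B * (N%:R * (e2 * T + 1) + 1))).
      have -> : (e1 - e2) * t * (N%:R * (e2 * t + 1) * z2 t + g2 (w2 t)) /
        (e2 * t + 2) = (e1 - e2) * ((N%:R * (e2 * t + 1) * z2 t + g2 (w2 t)) *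
          (t / (e2 * t + 2))).
        by field; rewrite gt_eqF//; flra.
      rewrite normrM ler_wpM2l// normrM mulrC ler_pM//.
        have p2 : 0 < e2 * t + 2 by flra.
        rewrite ger0_norm; last by rewrite divr_ge0 ?(ltW t0) ?(ltW p2).
        by rewrite ler_pdivrMr//; fnra.
      have -> : B * (N%:R * (e2 * T + 1) + 1) = N%:R * (e2 * T + 1) * B + B by ring.
      apply: le_trans (ler_normD _ _) (lerD _ _) => //.
      rewrite normrM ler_pM// ger0_norm ?mulr_ge0 ?ler0n//; last flra.
      by rewrite ler_wpM2l ?ler0n// lerD2r ler_wpM2l.
    rewrite /X /eta /C.
    apply: le_trans (ler_normB _ _) _; apply: le_trans (lerD (ler_normD _ _) (lexx _)) _.
    by move: h1 h2 h3; rewrite mulrDr; flra.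
  rewrite dDE /D -/om -/ze.
  have q0 := mulr_ge0 (qf_ge0 e10 (ltW t0)) (sqr_ge0 ze).
  have Kq : 0 <= K * (qf e1 t * ze ^+ 2) by rewrite mulr_ge0//; flra.
  have eta0 : 0 <= eta.
    rewrite /eta addr_ge0// mulr_ge0// /C.
    by rewrite addr_ge0// !mulr_ge0 ?ler0n// addr_ge0// mulr_ge0 ?ler0n// addr_ge0// mulr_ge0.
  have om2 : om ^+ 2 = `|om| ^+ 2 by rewrite real_normK// num_real.
  have ze2 : ze ^+ 2 = `|ze| ^+ 2 by rewrite real_normK// num_real.
  have f1 : - 2 * (N%:R - 1) * (e1 * t + 1) * ze ^+ 2 <= - 2 * ze ^+ 2.
    have : 0 <= ((N%:R - 1) * (e1 * t + 1) - 1) * ze ^+ 2.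
      have h : 0 <= (N%:R - 2) * (e1 * t) by apply: mulr_ge0 => //; flra.
      by apply: mulr_ge0; [flra|exact: sqr_ge0].
    by flra.
  have f2 : - 2 * ze * X <= 2 * (`|ze| * (L * `|om| + eta)).
    apply: le_trans (ler_norm _) _.
    rewrite !normrM normrN (ger0_norm (_ : 0 <= 2))// -mulrA.
    by rewrite ler_pM2l// ler_wpM2l.
  have f3 : 2 * om * ze <= 2 * (`|ze| * `|om|).
    apply: le_trans (ler_norm _) _.
    by rewrite !normrM (ger0_norm (_ : 0 <= 2))//; flra.
  move: f1 f2 f3 Kq; rewrite mulrDr om2 ze2.
  move: (normr_ge0 ze) (normr_ge0 om).
  set a := `|ze|; set b := `|om| => a0 b0.
  have : 0 <= (2 * a - ((L + 1) * b + eta)) ^+ 2 by rewrite sqr_ge0.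
  have : 0 <= ((L + 1) * b - eta) ^+ 2 by rewrite sqr_ge0.
  rewrite /K; flra.
move: (sT) => /andP[s0 sT'].
pose H t := expR (- K * t) * (D t + eta ^+ 2).
have : H s <= H 0.
  have := @derive_nonincreasing _ H (fun t => expR (- K * t) * (dD t + 0) +
    (D t + eta ^+ 2) * (expR (- K * t) * - K)) 0 s s0; apply.
  - move=> t _; apply: cvgM; first exact: continuous_expRZ.
    by apply: cvgD; [exact: cD|exact: cvg_cst].
  - move=> t /andP[t0 ts]; apply: is_deriveME; first exact: has_derive_expRZ.
    by apply: is_deriveDE; [exact: DD|exact: is_derive_cstE].
  - move=> t /andP[t0 ts].
    have : dD t <= K * D t + eta ^+ 2 by apply: DK; flra.
    have E0 := expR_gt0 (- K * t); set E := expR _ in E0 *.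
    have eta2 := sqr_ge0 eta.
    have -> : E * (dD t + 0) + (D t + eta ^+ 2) * (E * - K) =
      E * (dD t - K * D t - K * eta ^+ 2) by ring.
    by move=> h; rewrite pmulr_rle0//; fnra.
rewrite /H mulr0 expR0 mul1r.
have -> : D 0 = (alpha1 - alpha2) ^+ 2 by rewrite /D /qf !mul0r add0r w10 w20.
have E0 := expR_gt0 (K * s); move=> /(ler_wpM2l (ltW E0)).
rewrite mulrA -expRD mulNr addrN expR0 mul1r => h.
have h2 : expR (K * s) <= expR (K * T) by rewrite ler_expR ler_pM2l//; flra.
have h3 : 0 <= (alpha1 - alpha2) ^+ 2 + eta ^+ 2 by rewrite addr_ge0// sqr_ge0.
have := le_trans h (ler_wpM2r h3 h2).
by have := sqr_ge0 eta; rewrite /D; flra.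
Qed.

(** Backward uniqueness. On [c, s] with c > 0 the phase satisfies D' >= - K D, so a zero at s would
    spread to every c in (0, s]. [K] involves 1 / qf e c and blows up at the origin; the
    contradiction with w 0 = alpha is reached by continuity of w as c tends to 0. *)
Lemma phase_gt0 e g alpha w z L M s : 0 <= e -> alpha != 0 -> 0 <= L ->
  g 0 = 0 -> radial_sol N e g alpha w z -> (forall s, 0 <= s -> `|w s| <= M) ->
  (forall u v, `|u| <= M -> `|v| <= M -> `|g u - g v| <= L * `|u - v|) ->
  0 <= s -> 0 < qf e s * z s ^+ 2 + w s ^+ 2.
Proof.
move=> e0 al0 L0 g0 sol wM gL s0.
have N1 : 2 <= N%:R :> R by rewrite ler_nat.
have cw := radial_sol_continuous sol; case: sol => w0 dw cz _ dz.
have D0 t : 0 <= t -> 0 <= qf e t * z t ^+ 2 + w t ^+ 2.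
  by move=> t0; rewrite addr_ge0 ?sqr_ge0// mulr_ge0 ?sqr_ge0// qf_ge0.
rewrite lt_neqAle D0// andbT eq_sym; apply/negP => /eqP Ds.
have M0 : 0 <= M by apply: le_trans (wM 0 (lexx _)).
have wc c : 0 < c -> c <= s -> w c = 0.
  move=> c0 cs.
  have qc0 := qf_gt0 e0 c0.
  pose K := 2 * (N%:R * (e * s + 1)) / qf e c + (L + 1) * (1 + (qf e c)^-1).
  pose D t := qf e t * z t ^+ 2 + w t ^+ 2.
  pose dD t := qf e t * (2 * z t ^+ 1 *
     (- (N%:R * (e * t + 1) * z t + g (w t)) / qf e t)) +
     z t ^+ 2 * (2 * (e * t + 1)) + 2 * w t ^+ 1 * z t.
  have DD t : 0 < t -> has_derive t 1 D (dD t).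
    move=> t0; apply: is_deriveDE.
      by apply: is_deriveME; [exact: is_derive_qf|apply: is_deriveXE; exact: dz].
    by apply: is_deriveXE; exact: dw.
  have DK t : c < t < s -> 0 <= dD t + K * D t.
    move=> /andP[ct ts]; have t0 : 0 < t by flra.
    have qt := qf_gt0 e0 t0.
    have et : 0 <= e * t by rewrite mulr_ge0// ltW.
    have ets : e * t <= e * s by rewrite ler_wpM2l// ltW.
    have qct : qf e c <= qf e t.
      have ec : e * c <= e * t by rewrite ler_wpM2l// ltW.
      have ec0 : 0 <= e * c by rewrite mulr_ge0// ltW.
      by rewrite /qf ler_pM//; flra.
    have -> : dD t = - 2 * (N%:R - 1) * (e * t + 1) * z t ^+ 2 -
        2 * z t * g (w t) + 2 * w t * z t.
      by rewrite /dD; field; rewrite gt_eqF.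
    have gw : `|g (w t)| <= L * `|w t|.
      by have := gL (w t) 0 (wM _ (ltW t0)); rewrite g0 !subr0 normr0; apply.
    have f1 : `|- 2 * z t * g (w t) + 2 * w t * z t| <=
        2 * (L + 1) * (`|z t| * `|w t|).
      apply: le_trans (ler_normD _ _) _.
      rewrite !normrM normrN (ger0_norm (_ : 0 <= 2))//.
      have := ler_wpM2l (normr_ge0 (z t)) gw; flra.
    have zD : z t ^+ 2 <= D t / qf e c.
      rewrite ler_pdivlMr// /D.
      have := ler_wpM2r (sqr_ge0 (z t)) qct; have := sqr_ge0 (w t); flra.
    have wD : w t ^+ 2 <= D t.
      by rewrite /D lerDr mulr_ge0 ?sqr_ge0// ltW.
    have f2 : 2 * (`|z t| * `|w t|) <= z t ^+ 2 + w t ^+ 2.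
      have : 0 <= (`|z t| - `|w t|) ^+ 2 by rewrite sqr_ge0.
      by rewrite sqrrB !real_normK ?num_real//; flra.
    have f3 : (N%:R - 1) * (e * t + 1) * z t ^+ 2 <= N%:R * (e * s + 1) * (D t / qf e c).
      apply: ler_pM => //; [by apply: mulr_ge0; flra|exact: sqr_ge0|].
      by apply: ler_pM; flra.
    have f4 : 2 * (L + 1) * (`|z t| * `|w t|) <= (L + 1) * (D t + D t / qf e c).
      have -> : 2 * (L + 1) * (`|z t| * `|w t|) = (L + 1) * (2 * (`|z t| * `|w t|)) by ring.
      by rewrite ler_wpM2l//; flra.
    move: f1; rewrite ler_norml => /andP[f1 _].
    have -> : K * D t = 2 * (N%:R * (e * s + 1) * (D t / qf e c)) +
      (L + 1) * (D t + D t / qf e c) by rewrite /K; ring.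
    by flra.
  pose H t := expR (K * t) * D t.
  have : H c <= H s.
    have := @derive_nondecreasing _ H (fun t => expR (K * t) * dD t +
      D t * (expR (K * t) * K)) c s cs; apply.
    - move=> t _; apply: cvgM; first exact: continuous_expRZ.
      exact: continuous_phase.
    - move=> t /andP[ct ts]; apply: is_deriveME; first exact: has_derive_expRZ.
      by apply: DD; flra.
    - move=> t /DK h.
      have -> : expR (K * t) * dD t + D t * (expR (K * t) * K) =
        expR (K * t) * (dD t + K * D t) by ring.
      by rewrite mulr_ge0// expR_ge0.
  rewrite /H [D s]Ds mulr0 pmulr_rle0 ?expR_gt0// => Dc.
  have : w c ^+ 2 <= 0.
    apply: le_trans Dc; rewrite /D lerDr mulr_ge0 ?sqr_ge0// ltW//.
  by move=> h; apply/eqP; rewrite -sqrf_eq0 eq_le h sqr_ge0.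
have := sqr_ge0 (w s); have [s00|s00] := eqVneq s 0.
  move: Ds; rewrite s00 /qf !mul0r add0r w0 => /eqP; rewrite sqrf_eq0.
  by rewrite (negbTE al0).
have {}s0 : 0 < s by rewrite lt_neqAle eq_sym s00.
move=> _; move/negP: al0; apply; rewrite -normr_le0 leNgt; apply/negP => al0.
have /cvgrPdist_lt /(_ _ al0) /nbhs_ballP[r /= r0 H] := cw 0.
pose c := Num.min s (r / 2).
have c0 : 0 < c by rewrite lt_min s0 divr_gt0.
have cr : c < r by rewrite gt_min ltr_pdivrMr// ltr_pMr// ltr1n orbT.
have /H : ball 0 r c by rewrite /ball /= sub0r normrN gtr0_norm.
by rewrite /= w0 (wc c)// ?ge_min ?lexx// subr0 ltxx.
Qed.

End dependence.

(** * Oscillation of the Emden-Fowler equation *)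

Section emden_fowler.
Context {R : realType} (N : nat) (N2 : (2 <= N)%N).
Implicit Types (g G w z : R -> R) (e s t u v x y alpha K B L M T p : R).

Lemma spow_le p u v : 1 < p -> 0 <= u -> u <= v -> spow p u <= spow p v.
Proof.
move=> p1 u0 uv; have v0 := le_trans u0 uv.
rewrite /spow ler_pM ?powR_ge0//; apply: ler_powR_norm; first flra.
by rewrite !ger0_norm.
Qed.

Lemma spow_gt0 p u : 0 < u -> 0 < spow p u.
Proof. by move=> u0; rewrite /spow mulr_gt0// powR_gt0// normr_gt0 gt_eqF. Qed.

Lemma radial_sol_opp e p (lam alpha : R) w z :
  radial_sol N e (fun u => lam * u + spow p u) alpha w z ->
  radial_sol N e (fun u => lam * u + spow p u) (- alpha) (fun s => - w s) (fun s => - z s).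
Proof.
case=> w0 dw cz z0 dz; split.
- by rewrite w0.
- by move=> s; apply: is_deriveNE.
- by move=> s; apply: continuousN; exact: cz.
- by rewrite z0 spowN; ring.
move=> s s0; apply: is_deriveE; first by apply: is_deriveNE; exact: dz.
by rewrite spowN /=; ring.
Qed.

(** With the Euclidean radius t = [rho 0 s] and u_t = t z, this is the classical t^N (u_t^2 / 2 +
    |u|^(p+1) / (p+1) + (N-2) u u_t / (2 t)). *)
Lemma has_derive_pohozaev p alpha w z s : 1 < p -> 0 < s ->
  radial_sol N 0 (fun u => 0 * u + spow p u) alpha w z ->
  has_derive s 1 (fun s => rho 0 s ^+ N * (s * z s ^+ 2 +
     w s * spow p (w s) / (p + 1) + (N%:R - 2) / 2 * (w s * z s)))
   (2 * rho 0 s ^+ (N - 2) * ((N%:R / (p + 1) - (N%:R - 2) / 2) / 2 *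
      (w s * spow p (w s)))).
Proof.
move=> p1 s0 [_ dw cz _ dz]; apply: is_deriveE.
  apply: is_deriveME; first exact: is_derive_rhoN.
  apply: is_deriveDE; first apply: is_deriveDE.
  - apply: is_deriveME; first exact: is_derive_idE.
    by apply: is_deriveXE; exact: dz.
  - apply: (@is_derive_compE _ _ (fun u => u * spow p u / (p + 1)) w); last exact: dw.
    exact: has_derive_spow_primitive.
  - apply: is_deriveME; first exact: is_derive_cstE.
    by apply: is_deriveME; [exact: dw|exact: dz].
have -> : rho 0 s ^+ N = rho 0 s ^+ (N - 2) * (s * 2).
  have <- : rho 0 s ^+ 2 = s * 2 by rewrite sqr_rho ?(ltW s0)// /qf; ring.
  by rewrite -exprD subnK.
rewrite /= /qf; field.
by rewrite !gt_eqF//; flra.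
Qed.

(** While w >= 0 the flux rho^N z decreases. It becomes negative, since otherwise w >= w T would
    drive it to minus infinity. From then on w decreases, the flux equation gives z <= - w^p / (2
    N), and this differential inequality is integrated for w^(1-p). *)
Lemma emden_fowler_decay p alpha w z T : 1 < p ->
  radial_sol N 0 (fun u => 0 * u + spow p u) alpha w z ->
  0 <= T -> 0 < w T -> (forall y, T <= y -> 0 <= w y) ->
  exists s3 K, [/\ 0 < s3, 0 < K & forall s, s3 <= s ->
    [/\ z s < 0, 0 < w s & w s `^ (p - 1) <= K / s]].
Proof.
move=> p1 sol T0 wT w0.
have N1 : 2 <= N%:R :> R by rewrite ler_nat.
have Nge0 : 0 < N%:R :> R by flra.
have cw := radial_sol_continuous sol.
have [wal dw cz _ dz] := sol.
have e0 : 0 <= 0 :> R by [].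
pose r := @rho R 0.
have r0 s : 0 < s -> 0 < r s by exact: rho_gt0.
have r2 s : 0 <= s -> r s ^+ 2 = s * 2 by move=> s0; rewrite /r sqr_rho// /qf; ring.
have rN2 s : 0 <= s -> r s ^+ N = r s ^+ (N - 2) * (s * 2).
  by move=> s0; rewrite -r2// -exprD subnK.
have crN : continuous (fun s => r s ^+ N) by exact: continuous_rhoX.
have drN s : 0 < s -> has_derive s 1 (fun s => r s ^+ N) (N%:R * r s ^+ (N - 2)).
  by move=> s0; apply: is_deriveE; [exact: is_derive_rhoN|rewrite /= /r; ring].
have rN0 s : 0 < s -> 0 < r s ^+ (N - 2) by move=> s0; rewrite exprn_gt0// r0.
have rNN0 s : 0 < s -> 0 < r s ^+ N by move=> s0; rewrite exprn_gt0// r0.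
have rle s t : 0 <= s -> s <= t -> r s ^+ N <= r t ^+ N.
  move=> s0 st; rewrite lerXn2r ?nnegrE ?sqrtr_ge0// ler_sqrt /qf; fnra.
have h0 s : T <= s -> 0 <= spow p (w s).
  by move=> Ts; rewrite /spow mulr_ge0 ?powR_ge0// w0.
have dA s : 0 < s -> has_derive s 1 (fun s => r s ^+ N * z s)
    (- (r s ^+ (N - 2) * spow p (w s))).
  move=> s0; apply: is_deriveE; first by apply: is_deriveME; [exact: drN|exact: dz].
  by rewrite /= rN2 ?(ltW s0)// /qf; field; rewrite gt_eqF//; flra.
have cA : continuous (fun s => r s ^+ N * z s).
  by move=> s; apply: cvgM; [exact: crN|exact: cz].
have dW s : has_derive s 1 (fun s => spow p (w s)) (p * `|w s| `^ (p - 1) * z s).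
  by apply: is_derive_compE (dw s); exact: has_derive_spow.
have cW : continuous (fun s => spow p (w s)).
  by move=> s; exact: is_derive_continuous (dW s).
have [s1 [Ts1 s10 zs1]] : exists s1, [/\ T <= s1, 0 < s1 & z s1 < 0].
  apply: contrapT => Hz.
  have z0 s : T <= s -> 0 < s -> 0 <= z s.
    by move=> Ts s0; rewrite leNgt; apply/negP => zs; apply: Hz; exists s.
  have wge s : T <= s -> w T <= w s.
    move=> Ts; have := @derive_nondecreasing _ w z T s Ts; apply.
    - by move=> x _; exact: cw.
    - by move=> x _; exact: dw.
    - by move=> x /andP[Tx _]; apply: z0; flra.
  pose hc := spow p (w T); have hc0 : 0 < hc by exact: spow_gt0.
  pose C := r (T + 1) ^+ N * z (T + 1) + hc * r (T + 1) ^+ N / N%:R.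
  have bd s : T + 1 <= s -> r s ^+ N * z s + hc * r s ^+ N / N%:R <= C.
    move=> Ts.
    have := @derive_nonincreasing _
      (fun s => r s ^+ N * z s + hc * r s ^+ N / N%:R)
      (fun s => - (r s ^+ (N - 2) * spow p (w s)) +
        hc * (N%:R * r s ^+ (N - 2)) / N%:R) (T + 1) s Ts; apply.
    - move=> x _; apply: cvgD; first exact: cA.
      apply: cvgM; last exact: cvg_cst.
      by apply: cvgM; [exact: cvg_cst|exact: crN].
    - move=> x /andP[Tx _]; have x0 : 0 < x by flra.
      apply: is_deriveDE; first exact: dA.
      apply: is_deriveE.
        apply: is_deriveME; last exact: is_derive_cstE.
        by apply: is_deriveME; [exact: is_derive_cstE|exact: drN].
      by rewrite /=; ring.
    - move=> x /andP[Tx _]; have x0 : 0 < x by flra.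
      have -> : - (r x ^+ (N - 2) * spow p (w x)) +
        hc * (N%:R * r x ^+ (N - 2)) / N%:R = r x ^+ (N - 2) * (hc - spow p (w x)).
        by field; rewrite gt_eqF.
      rewrite pmulr_rle0 ?rN0// subr_le0 /hc; apply: spow_le => //; first exact: ltW.
      by apply: wge; flra.
  (* Far enough out that hc rho^N / N is at least |C| + 1, by rho^N >= s; together with z >= 0 this
     contradicts [bd]. *)
  pose s := T + 1 + (`|C| + 1) * N%:R / hc.
  have s1 : T + 1 <= s.
    by rewrite /s lerDl divr_ge0 ?(ltW hc0)// mulr_ge0// addr_ge0.
  have s0 : 0 < s by flra.
  have zs : 0 <= z s by apply: z0 => //; flra.
  have := bd s s1; have := ler_norm C.
  have : 0 <= r s ^+ N * z s by rewrite mulr_ge0// ltW// rNN0.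
  suff : `|C| + 1 <= hc * r s ^+ N / N%:R by flra.
  rewrite ler_pdivlMr// -ler_pdivrMl//.
  have rs1 : 1 <= r s by rewrite -[1]sqrtr1 ler_sqrt /qf; fnra.
  rewrite rN2 ?(ltW s0)//; have : 1 <= r s ^+ (N - 2) by exact: exprn_ege1.
  have : (`|C| + 1) * N%:R / hc <= s by rewrite /s; flra.
  by rewrite mulrC; fnra.
have zneg s : s1 <= s -> z s < 0.
  move=> ss; have s0 : 0 < s by flra.
  have : r s ^+ N * z s <= r s1 ^+ N * z s1.
    have := @derive_nonincreasing _ (fun s => r s ^+ N * z s)
      (fun s => - (r s ^+ (N - 2) * spow p (w s))) s1 s ss; apply.
    - by move=> x _; exact: cA.
    - by move=> x /andP[sx _]; apply: dA; flra.
    - move=> x /andP[sx _]; rewrite oppr_le0 mulr_ge0//; last by apply: h0; flra.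
      by rewrite ltW// rN0//; flra.
  have : r s1 ^+ N * z s1 < 0 by rewrite pmulr_rlt0// rNN0.
  move=> a1 a2; have : r s ^+ N * z s < 0 by flra.
  by rewrite pmulr_rlt0// rNN0.
have wdec s t : s1 <= s -> s <= t -> w t <= w s.
  move=> ss st; have := @derive_nonincreasing _ w z s t st; apply.
  - by move=> x _; exact: cw.
  - by move=> x _; exact: dw.
  - by move=> x /andP[sx _]; apply/ltW/zneg; flra.
have mvt s t : s < t -> exists2 c, s < c < t & w t - w s = z c * (t - s).
  move=> st; have [] := @MVT _ w z s t st.
  - by move=> x _; exact: dw.
  - by apply: continuous_subspaceT => x; exact: cw.
  by move=> c; rewrite in_itv /=; exists c.
have wpos s : s1 <= s -> 0 < w s.
  move=> ss; rewrite lt_neqAle w0 ?andbT; last flra.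
  apply/negP => /eqP ws.
  have [|c cs] := mvt s (s + 1); first flra.
  have := zneg c; have := w0 (s + 1); rewrite -ws subr0.
  have -> : s + 1 - s = 1 by ring.
  by rewrite mulr1 => a1 a2 a3; have := a1 _; rewrite a3; have := a2 _; flra.
(* Beyond 4 s1 one has rho^N >= 4 rho(s1)^N, as rho^2 = 2 s and N >= 2, so rho^N - rho(s1)^N is at
   least half of rho^N. *)
pose s2 := 4 * s1.
have zle s : s2 <= s -> z s <= - (spow p (w s) / (2 * N%:R)).
  rewrite /s2 => ss; have s0 : 0 < s by flra.
  have s1s : s1 <= s by flra.
  (* The derivative reduces to (rho^N - rho(s1)^N) / N times that of [spow p (w s)], which is
     nonpositive because w decreases. *)
  have Y : r s ^+ N * z s + spow p (w s) * ((r s ^+ N - r s1 ^+ N) / N%:R) <=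
      r s1 ^+ N * z s1 + spow p (w s1) * ((r s1 ^+ N - r s1 ^+ N) / N%:R).
    have := @derive_nonincreasing _
      (fun s => r s ^+ N * z s + spow p (w s) * ((r s ^+ N - r s1 ^+ N) / N%:R))
      (fun s => - (r s ^+ (N - 2) * spow p (w s)) +
       (spow p (w s) * (r s ^+ (N - 2)) +
        (r s ^+ N - r s1 ^+ N) / N%:R * (p * `|w s| `^ (p - 1) * z s)))
      s1 s s1s; apply.
    - move=> x _; apply: cvgD; first exact: cA.
      apply: cvgM; first exact: cW.
      apply: cvgM; last exact: cvg_cst.
      by apply: cvgB; [exact: crN|exact: cvg_cst].
    - move=> x /andP[Tx _]; have x0 : 0 < x by flra.
      apply: is_deriveDE; first exact: dA.
      apply: is_deriveE.
        apply: is_deriveME; first exact: dW.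
        apply: is_deriveME; last exact: is_derive_cstE.
        by apply: is_deriveDE; [exact: drN|apply: is_deriveNE; exact: is_derive_cstE].
      by rewrite /=; field; rewrite gt_eqF.
    - move=> x /andP[sx _].
      have -> : forall a b, - (r x ^+ (N - 2) * a) + (a * r x ^+ (N - 2) + b) = b.
        by move=> a b; ring.
      rewrite mulr_ge0_le0//.
        by rewrite divr_ge0 ?ler0n// subr_ge0 rle//; flra.
      rewrite mulr_ge0_le0 ?mulr_ge0 ?powR_ge0//; first flra.
      by apply/ltW/zneg; flra.
  have r4 : 4 * r s1 ^+ N <= r s ^+ N.
    apply: le_trans (rle (4 * s1) s _ ss); last flra.
    rewrite !rN2; try flra.
    have : r s1 ^+ (N - 2) <= r (4 * s1) ^+ (N - 2).
      by rewrite lerXn2r ?nnegrE ?sqrtr_ge0// ler_sqrt /qf; fnra.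
    by have := rN0 _ s10; fnra.
  have r1p := rNN0 _ s10.
  have hs : 0 <= spow p (w s) by apply: h0; flra.
  have a1 : r s1 ^+ N * z s1 < 0 by rewrite pmulr_rlt0.
  have a2 : spow p (w s) * (r s ^+ N / (2 * N%:R)) <=
      spow p (w s) * ((r s ^+ N - r s1 ^+ N) / N%:R).
    rewrite ler_wpM2l// invfM mulrA ler_pM2r ?invr_gt0//; flra.
  have : r s ^+ N * (z s + spow p (w s) / (2 * N%:R)) <= 0.
    move: Y a2; rewrite subrr mul0r mulr0 addr0.
    have -> : r s ^+ N * (z s + spow p (w s) / (2 * N%:R)) =
      r s ^+ N * z s + spow p (w s) * (r s ^+ N / (2 * N%:R)) by ring.
    by flra.
  by rewrite pmulr_rle0 ?rNN0//; flra.
(* By z <= - w^p / (2 N), the derivative (1 - p) w^(-p) z of w^(1-p) is at least this constant. *)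
pose c := (p - 1) / (2 * N%:R).
have c0 : 0 < c by rewrite divr_gt0; flra.
have s20 : 0 < s2 by rewrite /s2; flra.
have s12 : s1 <= s2 by rewrite /s2; flra.
have wK s : 2 * s2 <= s -> w s `^ (p - 1) <= 2 / c / s.
  move=> ss; have s0 : 0 < s by flra.
  have s2s : s2 <= s by flra.
  have ws : 0 < w s by apply: wpos; flra.
  have : c * s - c * s2 <= w s `^ (1 - p) - w s2 `^ (1 - p).
    have := @derive_le _ (fun s => c * s) (fun=> c)
      (fun s => w s `^ (1 - p)) (fun s => (1 - p) * w s `^ (1 - p - 1) * z s)
      s2 s s2s; apply.
    - by move=> x _; apply: cvgM; [exact: cvg_cst|exact: cvg_id].
    - move=> x /andP[sx _]; apply: (@continuous_comp _ _ _ w (fun u => u `^ (1 - p))).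
        exact: cw.
      by apply: is_derive_continuous (is_derive1_powR _ _); apply: wpos; flra.
    - move=> x _; apply: is_deriveE.
        by apply: is_deriveME; [exact: is_derive_cstE|exact: is_derive_idE].
      by rewrite /=; ring.
    - move=> x /andP[sx _].
      apply: (@is_derive_compE _ _ (fun u => u `^ (1 - p)) w); last exact: dw.
      by apply: is_derive1_powR; apply: wpos; flra.
    - move=> x /andP[sx _].
      have wx : 0 < w x by apply: wpos; flra.
      have E : w x `^ (1 - p - 1) * spow p (w x) = 1.
        rewrite /spow gtr0_norm// -{3}[w x]powRr1 ?(ltW wx)//.
        rewrite -!powRD ?(gt_eqF wx) ?implybT//.
        have -> : 1 - p - 1 + (p - 1 + 1) = 0 by ring.
        by rewrite powRr0.
      have zx : z x <= - (spow p (w x) / (2 * N%:R)) by apply: zle; flra.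
      have -> : c = (1 - p) * w x `^ (1 - p - 1) * - (spow p (w x) / (2 * N%:R)).
        transitivity ((p - 1) * (w x `^ (1 - p - 1) * spow p (w x)) / (2 * N%:R)).
          by rewrite E mulr1.
        by ring.
      rewrite ler_wnM2l// mulr_le0_ge0 ?powR_ge0//; flra.
  have : 0 < w s2 `^ (1 - p) by rewrite powR_gt0// wpos.
  have -> : 1 - p = - (p - 1) by ring.
  rewrite !powRN => a1 a2.
  have a3 : c * s / 2 <= (w s `^ (p - 1))^-1.
    have : c * s2 <= c * s / 2 by rewrite -mulrA ler_pM2l//; flra.
    by flra.
  rewrite -[w s `^ _]invrK -[2 / c / s]invrK lef_pV2 ?posrE.
  - by apply: le_trans a3; apply: eq_ler; field; rewrite !gt_eqF.
  - by rewrite invr_gt0; exact: powR_gt0.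
  - by rewrite invr_gt0; apply: divr_gt0 => //; exact: divr_gt0.
exists (2 * s2), (2 / c); split; [flra|exact: divr_gt0|].
by move=> s ss; split; [apply: zneg; flra|apply: wpos; flra|exact: wK].
Qed.

(** The Pohozaev function starts at 0, increases strictly as long as w is near alpha, and never
    decreases afterwards; subcriticality is the positivity of the coefficient [k]. *)
Lemma pohozaev_gt0 p alpha w z s1 : 1 < p ->
  ((2 < N)%N -> p < (N%:R + 2) / (N%:R - 2)) -> alpha != 0 ->
  radial_sol N 0 (fun u => 0 * u + spow p u) alpha w z -> 0 < s1 ->
  exists2 c, 0 < c & forall s, s1 <= s -> c <= rho 0 s ^+ N * (s * z s ^+ 2 +
     w s * spow p (w s) / (p + 1) + (N%:R - 2) / 2 * (w s * z s)).
Proof.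
move=> p1 pN al0 sol s10.
have N1 : 2 <= N%:R :> R by rewrite ler_nat.
have cw := radial_sol_continuous sol.
have [wal dw cz _ dz] := sol.
pose r := @rho R 0.
have r0 s : 0 < s -> 0 < r s by exact: rho_gt0.
have rN0 s : 0 < s -> 0 < r s ^+ (N - 2) by move=> s0; rewrite exprn_gt0// r0.
have crN : continuous (fun s => r s ^+ N) by exact: continuous_rhoX.
have cW : continuous (fun s => spow p (w s)).
  by apply: continuous_comp_all => //; exact: continuous_spow.
pose P s := r s ^+ N * (s * z s ^+ 2 + w s * spow p (w s) / (p + 1) +
  (N%:R - 2) / 2 * (w s * z s)).
pose k := (N%:R / (p + 1) - (N%:R - 2) / 2) / 2.
have k0 : 0 < k.
  rewrite /k divr_gt0// subr_gt0.
  have [N3|N3] := ltnP 2 N; last first.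
    have -> : N%:R = 2 :> R by congr (_%:R); apply/eqP; rewrite eqn_leq N2 N3.
    by rewrite subrr mul0r divr_gt0//; flra.
  have N3' : 0 < N%:R - 2 :> R by rewrite subr_gt0 ltr_nat.
  have := pN N3; rewrite ltr_pdivlMr// => pN'.
  by rewrite ltr_pdivlMr; flra.
have dP s : 0 < s -> has_derive s 1 P (2 * r s ^+ (N - 2) * (k * (w s * spow p (w s)))).
  by move=> s0; apply: has_derive_pohozaev sol.
have cP : continuous P.
  move=> s; apply: cvgM; first exact: crN.
  apply: cvgD; first apply: cvgD.
  - apply: cvgM; first exact: cvg_id.
    by apply: (@continuous_comp _ _ _ z (fun x => x ^+ 2)); [exact: cz|exact: exprn_continuous].
  - apply: cvgM; last exact: cvg_cst.
    by apply: cvgM; [exact: cw|exact: cW].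
  - apply: cvgM; first exact: cvg_cst.
    by apply: cvgM; [exact: cw|exact: cz].
have [a /andP[a0 as1] Pa] : exists2 a, 0 < a <= s1 & 0 < P a.
  have al : 0 < `|alpha| by rewrite normr_gt0.
  have /cvgrPdist_lt /(_ _ al) /nbhs_ballP[d /= d0 H] := cw 0.
  pose a := Num.min s1 (d / 2).
  have a0 : 0 < a by rewrite lt_min s10 divr_gt0.
  have ad : a < d by rewrite gt_min ltr_pdivrMr// ltr_pMr// ltr1n orbT.
  exists a; first by rewrite a0 ge_min lexx.
  have DP x : x \in `]0, a[ -> is_derive x 1 P (2 * r x ^+ (N - 2) * (k * (w x * spow p (w x)))).
    by rewrite in_itv /= => /andP[x0 _]; exact: dP.
  have CP : {within `[0, a], continuous P} by apply: continuous_subspaceT => x; exact: cP.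
  have [x] := MVT a0 DP CP.
  rewrite in_itv /= {2}/P /r rho0 expr0n => /andP[x0 xa].
  have -> : N == 0%N = false by case: N N2.
  rewrite mul0r !subr0 => ->; apply: mulr_gt0 => //; apply: mulr_gt0.
    by apply: mulr_gt0 => //; exact: rN0.
  apply: mulr_gt0 => //.
  rewrite mul_spow; have wx : w x != 0.
    have /H : ball 0 d x by rewrite /ball /= sub0r normrN gtr0_norm//; flra.
    by rewrite /= wal; apply: contraTneq => ->; rewrite subr0 ltxx.
  by rewrite mulr_gt0 ?powR_gt0 ?normr_gt0// lt_neqAle eq_sym sqrf_eq0 wx sqr_ge0.
have PaP s : s1 <= s -> P a <= P s.
  move=> ss; have := @derive_nondecreasing _ P
    (fun s => 2 * r s ^+ (N - 2) * (k * (w s * spow p (w s)))) a s; apply.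
  - by flra.
  - by move=> x _; exact: cP.
  - by move=> x /andP[ax _]; apply: dP; flra.
  - move=> x /andP[ax _]; apply: mulr_ge0.
      by rewrite mulr_ge0// ltW// rN0//; flra.
    by apply: mulr_ge0; [exact: ltW|exact: mul_spow_ge0].
by exists (P a) => // s /PaP.
Qed.

(** A solution staying nonnegative would decay so fast that its Pohozaev function tends to 0,
    against the positive lower bound. *)
Lemma emden_fowler_neg p alpha w z T : 1 < p ->
  ((2 < N)%N -> p < (N%:R + 2) / (N%:R - 2)) -> alpha != 0 ->
  radial_sol N 0 (fun u => 0 * u + spow p u) alpha w z ->
  0 <= T -> 0 < w T -> exists2 y, T < y & w y < 0.
Proof.
move=> p1 pN al0 sol T0 wT; apply: contrapT => Hneg.
have w0 y : T <= y -> 0 <= w y.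
  rewrite le_eqVlt => /orP[/eqP <-|Ty]; first exact: ltW.
  by rewrite leNgt; apply/negP => wy; apply: Hneg; exists y.
have [s3 [K [s30 K0 wK']]] := emden_fowler_decay p1 sol T0 wT w0.
have [P0 Pa PaP] := pohozaev_gt0 p1 pN al0 sol s30.
have N1 : 2 <= N%:R :> R by rewrite ler_nat.
have cw := radial_sol_continuous sol.
have [wal dw cz _ dz] := sol.
pose r := @rho R 0.
have r0 s : 0 < s -> 0 < r s by exact: rho_gt0.
have r2 s : 0 <= s -> r s ^+ 2 = s * 2 by move=> s0; rewrite /r sqr_rho// /qf; ring.
have rN2 s : 0 <= s -> r s ^+ N = r s ^+ (N - 2) * (s * 2).
  by move=> s0; rewrite -r2// -exprD subnK.
have rN0 s : 0 < s -> 0 < r s ^+ (N - 2) by move=> s0; rewrite exprn_gt0// r0.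
have rNN0 s : 0 < s -> 0 < r s ^+ N by move=> s0; rewrite exprn_gt0// r0.
have zneg s : s3 <= s -> z s < 0 by move=> /wK'[].
have wpos s : s3 <= s -> 0 < w s by move=> /wK'[].
have wK s : s3 <= s -> w s `^ (p - 1) <= K / s by move=> /wK'[].
have wdec s t : s3 <= s -> s <= t -> w t <= w s.
  move=> ss st; have := @derive_nonincreasing _ w z s t st; apply.
  - by move=> x _; exact: cw.
  - by move=> x _; exact: dw.
  - by move=> x /andP[sx _]; apply/ltW/zneg; flra.
have mvt s t : s < t -> exists2 c, s < c < t & w t - w s = z c * (t - s).
  move=> st; have [] := @MVT _ w z s t st.
  - by move=> x _; exact: dw.
  - by apply: continuous_subspaceT => x; exact: cw.
  by move=> c; rewrite in_itv /=; exists c.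
(* The mean value theorem on [s, 2 s] yields a t with |z t| <= w s / s. Estimating the Pohozaev
   function at such points is enough, because its lower bound holds at every point beyond s3. *)
have main s : s3 <= s -> P0 <= 4 ^+ N * (2 + K) * (r s ^+ (N - 2) * w s ^+ 2).
  move=> ss; have s0 : 0 < s by flra.
  have [|t /andP[st t2] wt] := mvt s (2 * s); first flra.
  have ws : 0 < w s by apply: wpos; flra.
  have wt0 : 0 < w t by apply: wpos; flra.
  have wts : w t <= w s by apply: wdec; flra.
  have zt : z t < 0 by apply: zneg; flra.
  have w2s : 0 < w (2 * s) by apply: wpos; flra.
  have zb : - z t * s <= w s.
    by move: wt; rewrite (_ : 2 * s - s = s); [flra|ring].
  apply: le_trans (PaP t _) _; [flra|rewrite -/(r t)].
  have q1 : t * z t ^+ 2 <= 2 * w s ^+ 2 / s.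
    rewrite ler_pdivlMr//.
    have : (- z t * s) ^+ 2 <= w s ^+ 2.
      by rewrite lerXn2r ?nnegrE ?(ltW ws)// mulr_ge0 ?(ltW s0)//; flra.
    rewrite exprMn sqrrN => h.
    have : t * (z t ^+ 2 * s) <= 2 * s * (z t ^+ 2 * s).
      by apply: ler_wpM2r; [apply: mulr_ge0; [exact: sqr_ge0|exact: ltW]|flra].
    by flra.
  have q2 : w t * spow p (w t) / (p + 1) <= w s ^+ 2 * (K / s).
    have : w t * spow p (w t) / (p + 1) <= w t * spow p (w t).
      rewrite ler_pdivrMr ?ler_peMr ?mul_spow_ge0//; flra.
    move=> /le_trans; apply; rewrite mul_spow mulrC ler_pM ?sqr_ge0 ?powR_ge0//.
      by rewrite lerXn2r ?nnegrE ?(ltW wt0) ?(ltW ws).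
    rewrite gtr0_norm//; apply: le_trans (wK s ss).
    by apply: ge0_ler_powR; rewrite ?nnegrE ?(ltW wt0) ?(ltW ws)//; flra.
  have q3 : (N%:R - 2) / 2 * (w t * z t) <= 0.
    apply: mulr_ge0_le0; first by apply: divr_ge0 => //; flra.
    by apply: mulr_ge0_le0; exact: ltW.
  have rt : r t ^+ N <= 4 ^+ N / 2 * (r s ^+ N).
    have : r t <= 2 * r s.
      rewrite -(@ler_pXn2r _ 2) ?nnegrE ?sqrtr_ge0//; last by rewrite mulr_ge0// sqrtr_ge0.
      by rewrite exprMn !r2; flra.
    move=> h; have : r t ^+ N <= (2 * r s) ^+ N.
      by rewrite lerXn2r ?nnegrE ?sqrtr_ge0// mulr_ge0// sqrtr_ge0.
    rewrite exprMn => /le_trans; apply; rewrite ler_pM2r ?rNN0//.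
    rewrite (_ : 4 = 2 * 2 :> R); last by ring.
    rewrite exprMn -mulrA ler_peMr ?exprn_ge0// ler_pdivlMr// mul1r.
    by apply: le_trans (_ : 2 ^+ 1 <= _); [rewrite expr1|rewrite ler_weXn2l ?ler1n//; exact: leq_trans N2].
  have rsN : r s ^+ N = r s ^+ (N - 2) * (s * 2) by rewrite rN2 ?(ltW s0).
  apply: le_trans (_ : r t ^+ N * (2 * w s ^+ 2 / s + w s ^+ 2 * (K / s)) <= _).
    by rewrite ler_pM2l ?rNN0//; flra.
  have q4 : 0 <= 2 * w s ^+ 2 / s + w s ^+ 2 * (K / s).
    by apply: addr_ge0; [apply: divr_ge0; [apply: mulr_ge0 => //; exact: sqr_ge0|exact: ltW]|apply: mulr_ge0; [exact: sqr_ge0|apply: divr_ge0; exact: ltW]].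
  apply: le_trans (ler_wpM2r q4 rt) _; rewrite rsN.
  by apply: eq_ler; field; rewrite gt_eqF.
(* The Pohozaev function is at most a constant times rho^(N-2) w^2, and w^2 at most a constant times
   the power -4 / (p-1) of rho. The total exponent is - gam, and gam > 0 is again subcriticality. *)
pose gam := 4 / (p - 1) - (N%:R - 2).
have gam0 : 0 < gam.
  rewrite subr_gt0 ltr_pdivlMr; last flra.
  have [N3|N3] := ltnP 2 N; last first.
    have -> : N%:R = 2 :> R by congr (_%:R); apply/eqP; rewrite eqn_leq N2 N3.
    by rewrite subrr mul0r.
  have N3' : 0 < N%:R - 2 :> R by rewrite subr_gt0 ltr_nat.
  by have := pN N3; rewrite ltr_pdivlMr// => pN'; flra.
pose C := 4 ^+ N * (2 + K) * (2 * K) `^ (2 / (p - 1)).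
have bound s : s3 <= s -> P0 * r s `^ gam <= C.
  move=> ss; have s0 : 0 < s by flra.
  have rs := r0 s s0.
  have ws : 0 < w s by apply: wpos; flra.
  have w2 : w s ^+ 2 <= (2 * K) `^ (2 / (p - 1)) * r s `^ (- (4 / (p - 1))).
    have -> : w s ^+ 2 = (w s `^ (p - 1)) `^ (2 / (p - 1)).
      rewrite -powRrM -powR_mulrn ?(ltW ws)//; congr (_ `^ _); field; flra.
    have -> : r s `^ (- (4 / (p - 1))) = ((r s ^+ 2)^-1) `^ (2 / (p - 1)).
      rewrite -powR_mulrn ?(ltW rs)// -powRN -powRrM; congr (_ `^ _); field; flra.
    rewrite -powRM ?mulr_ge0 ?invr_ge0 ?sqr_ge0 ?(ltW K0)//.
    apply: ge0_ler_powR; rewrite ?nnegrE ?powR_ge0//.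
    - by rewrite divr_ge0//; flra.
    - by rewrite !mulr_ge0 ?invr_ge0 ?sqr_ge0 ?(ltW K0).
    - apply: le_trans (wK s ss) _; rewrite r2 ?(ltW s0)//; apply: eq_ler.
      by field; rewrite gt_eqF.
  have := main s ss.
  have h1 : r s ^+ (N - 2) = r s `^ (N%:R - 2).
    by rewrite -powR_mulrn ?(ltW rs)// natrB.
  have h2 : r s ^+ (N - 2) * w s ^+ 2 <= (2 * K) `^ (2 / (p - 1)) * r s `^ (- gam).
    apply: le_trans (ler_wpM2l (ltW (rN0 s s0)) w2) _; rewrite h1.
    have -> : r s `^ (- gam) = r s `^ (N%:R - 2) * r s `^ (- (4 / (p - 1))).
      rewrite -powRD ?(gt_eqF rs) ?implybT//; congr (_ `^ _).
      by rewrite /gam; ring.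
    by apply: eq_ler; ring.
  have A0 : 0 <= 4 ^+ N * (2 + K) by rewrite mulr_ge0 ?exprn_ge0//; flra.
  move=> /le_trans /(_ (ler_wpM2l A0 h2)) h3.
  have := ler_wpM2r (powR_ge0 (r s) gam) h3.
  rewrite -!mulrA -powRD ?(gt_eqF rs) ?implybT// addNr powRr0 mulr1.
  by rewrite /C !mulrA.
pose X := (`|C| / P0 + 1) `^ gam^-1.
have X0 : 0 <= X by rewrite powR_ge0.
pose s := s3 + X ^+ 2.
have ss : s3 <= s by rewrite /s lerDl sqr_ge0.
have s0 : 0 < s by flra.
have rX : X <= r s.
  rewrite -(@ler_pXn2r _ 2) ?nnegrE ?sqrtr_ge0// r2 ?(ltW s0)// /s.
  by have := sqr_ge0 X; flra.
have := bound s ss; apply/negP; rewrite -ltNge.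
have : X `^ gam <= r s `^ gam by apply: ge0_ler_powR; rewrite ?nnegrE ?sqrtr_ge0 ?(ltW gam0).
rewrite /X -powRrM mulVf ?(gt_eqF gam0)// powRr1; last first.
  by apply: addr_ge0 => //; apply: divr_ge0 => //; exact: ltW.
move=> /(ler_wpM2l (ltW Pa)); rewrite mulrDr mulr1 mulrC divfK ?(gt_eqF Pa)//.
by have := ler_norm C; flra.
Qed.

End emden_fowler.

(** * Decay at infinity *)

Section asymptotics.
Context {R : realType} (N : nat) (N2 : (2 <= N)%N) (p lam : R) (p1 : 1 < p).
Implicit Types (w z : R -> R) (e s t u v x y alpha K B L M T C eta : R).

Definition ahalf : R := (N%:R - 1) / 2.
Definition nonlin (u : R) : R := lam * u + spow p u.
Definition nonlin_prim (u : R) : R := lam * u ^+ 2 / 2 + u * spow p u / (p + 1).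
(** Distance from [lam] to the bottom ((N-1)/2)^2 of the L^2 spectrum of hyperbolic space. *)
Definition gap : R := ahalf ^+ 2 - lam.
Definition energy (y u z : R) : R := qf 1 y * z ^+ 2 / 2 + nonlin_prim u.
(* [M] is, up to a positive factor, the derivative of [(sinh r)^(N-1) u^2]
   with respect to the hyperbolic distance [r]. *)
Definition mder (y u z : R) : R := u * (qf 1 y * z + ahalf * (y + 1) * u).

Lemma has_derive_nonlin_prim u : has_derive u 1 nonlin_prim (nonlin u).
Proof.
apply: is_deriveE.
  apply: is_deriveDE; last exact: has_derive_spow_primitive.
  apply: is_deriveME; last exact: is_derive_cstE.
  apply: is_deriveME; first exact: is_derive_cstE.
  by apply: is_deriveXE; exact: is_derive_idE.
by rewrite /nonlin /=; field.
Qed.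

Lemma has_derive_rhoX n s : 0 < s ->
  has_derive s 1 (fun s => rho 1 s ^+ n) (n%:R * (s + 1) * rho 1 s ^+ n / qf 1 s).
Proof.
move=> s0; apply: is_deriveE; first by apply: is_deriveXE; exact: is_derive_rho.
rewrite -sqr_rho ?(ltW s0)//; have := @rho_gt0 R 1 s ler01 s0 => r0.
case: n => [|n]; first by rewrite !mul0r.
by rewrite exprS /=; field; rewrite gt_eqF.
Qed.

Section solution.
Variables (alpha : R) (w z : R -> R) (sol : radial_sol N 1 nonlin alpha w z).

Let cw : continuous w. Proof. exact: radial_sol_continuous sol. Qed.
Let cz : continuous z. Proof. by case: sol. Qed.
Let dw s : has_derive s 1 w (z s). Proof. by case: sol. Qed.
Let dz s : 0 < s -> has_derive s 1 z (- (N%:R * (1 * s + 1) * z s + nonlin (w s)) / qf 1 s).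
Proof. by case: sol => _ _ _ _; apply. Qed.

(** With [rho 1 y] = sinh r this is v v', where v = (sinh r)^((N-1)/2) u and the prime is the
    derivative in r; [vfun] is v^2. *)
Definition pfun y := rho 1 y ^+ (N - 2) * mder y (w y) (z y).
(** For the same v, this is v' times (sinh r)^(1 - (N-1)/2). *)
Definition xfun y := qf 1 y * z y + ahalf * (y + 1) * w y.

Lemma continuous_mder : continuous (fun y => mder y (w y) (z y)).
Proof.
move=> y; apply: cvgM; first exact: cw.
apply: cvgD; first by apply: cvgM; [exact: continuous_qf|exact: cz].
apply: cvgM; last exact: cw.
by apply: cvgM; [exact: cvg_cst|apply: cvgD; [exact: cvg_id|exact: cvg_cst]].
Qed.

Lemma continuous_pfun : continuous pfun.
Proof.
by move=> y; apply: cvgM; [exact: continuous_rhoX|exact: continuous_mder].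
Qed.

(** The substitution v removes the first-order term: v'' = (gap - |u|^(p-1) + (N-1)(N-3) / (4 sinh^2
    r)) v. The formula is (v v')' = v'^2 + v v'', divided by sinh r to pass from r to y. *)
Lemma has_derive_pfun y : 0 < y ->
  has_derive y 1 pfun (rho 1 y ^+ (N - 2) / qf 1 y * (xfun y ^+ 2 +
    ((gap - `|w y| `^ (p - 1)) * qf 1 y + (N%:R - 1) * (N%:R - 3) / 4) * w y ^+ 2)).
Proof.
move=> y0; apply: is_deriveE.
  apply: is_deriveME; first exact: has_derive_rhoX.
  apply: is_deriveME; first exact: dw.
  apply: is_deriveDE.
    by apply: is_deriveME; [exact: is_derive_qf|exact: dz].
  apply: is_deriveME; last exact: dw.
  apply: is_deriveME; first exact: is_derive_cstE.
  by apply: is_deriveDE; [exact: is_derive_idE|exact: is_derive_cstE].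
have q0 := qf_gt0 ler01 y0.
rewrite /mder /xfun /gap /nonlin /spow /ahalf natrB//.
set r := rho 1 y ^+ (N - 2); set k := `|w y| `^ (p - 1).
have qE : qf 1 y = (y + 1) ^+ 2 - 1 by rewrite /qf; ring.
have yy : (y + 1) ^+ 2 - 1 != 0 by rewrite -qE gt_eqF.
by rewrite qE /=; field.
Qed.

Lemma xfun_mder y : w y * xfun y = mder y (w y) (z y).
Proof. by []. Qed.

Definition vfun y := rho 1 y ^+ (N - 1) * w y ^+ 2.

Lemma has_derive_vfun y : 0 < y -> has_derive y 1 vfun (2 * pfun y / rho 1 y).
Proof.
move=> y0; apply: is_deriveE.
  apply: is_deriveME; first exact: has_derive_rhoX.
  by apply: is_deriveXE; exact: dw.
have q0 := qf_gt0 ler01 y0; have r0 := @rho_gt0 R 1 y ler01 y0.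
rewrite /pfun /mder /ahalf natrB; last exact: ltnW.
have -> : (N - 1 = (N - 2).+1)%N by rewrite -subSn// subSS.
rewrite exprS -(sqr_rho ler01 (ltW y0)) /=; field.
by rewrite gt_eqF.
Qed.

Lemma continuous_vfun : continuous vfun.
Proof.
move=> y; apply: cvgM; first exact: continuous_rhoX.
by apply: (@continuous_comp _ _ _ w (fun x => x ^+ 2)); [exact: cw|exact: exprn_continuous].
Qed.

Lemma rho_le y : 0 <= y -> rho 1 y <= y + 2.
Proof.
move=> y0; rewrite -(@ler_pXn2r _ 2) ?nnegrE ?sqrtr_ge0//; last lra.
by rewrite sqr_rho// /qf; nra.
Qed.

(** (N-1)(N-3) >= -1, with equality for N = 2, so the curvature term costs at most 1/4; of the
    available c q / 2 one half pays for it once c q >= 1. *)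
Lemma derive_pfun_ge c T y : 0 < T -> T <= y -> 0 < c -> c^-1 <= qf 1 T ->
  `|w y| `^ (p - 1) <= gap - c / 2 ->
  rho 1 y ^+ (N - 2) / qf 1 y * (xfun y ^+ 2 + c / 4 * qf 1 y * w y ^+ 2) <=
  rho 1 y ^+ (N - 2) / qf 1 y * (xfun y ^+ 2 +
    ((gap - `|w y| `^ (p - 1)) * qf 1 y + (N%:R - 1) * (N%:R - 3) / 4) * w y ^+ 2).
Proof.
move=> T0 Ty c0 cT wy; have y0 : 0 < y by lra.
have q0 := qf_gt0 ler01 y0; have r0 := @rho_gt0 R 1 y ler01 y0.
have N1 : 2 <= N%:R :> R by rewrite ler_nat.
have qT : qf 1 T <= qf 1 y by rewrite /qf; nra.
apply: ler_wpM2l; first by rewrite divr_ge0 ?exprn_ge0// ltW.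
rewrite lerD2l; apply: ler_wpM2r; first exact: sqr_ge0.
have h1 : 1 <= c * qf 1 y by rewrite -ler_pdivrMl// mulr1; lra.
have sq : 0 <= (N%:R - 2) ^+ 2 :> R by exact: sqr_ge0.
have h2 : - 1 <= (N%:R - 1) * (N%:R - 3) :> R by lra.
have h3 : c / 2 * qf 1 y <= (gap - `|w y| `^ (p - 1)) * qf 1 y.
  by rewrite ler_pM2r//; lra.
by lra.
Qed.

(** For |w|^(p-1) <= gap / 2 the derivative of [pfun] is nonnegative, so v^2 keeps increasing once
    it increases, whereas [pfun] vanishes at a zero of w. *)
Lemma mder_pos_forward T T1 : 0 < T -> 0 < gap -> gap^-1 <= qf 1 T ->
  (forall y, T <= y -> `|w y| `^ (p - 1) <= gap / 2) ->
  T <= T1 -> 0 < mder T1 (w T1) (z T1) -> forall y, T1 <= y -> w y != 0.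
Proof.
move=> T0 g0 gT wT TT1 m1 y T1y.
have pp : pfun T1 <= pfun y.
  have := @derive_nondecreasing _ pfun (fun y => rho 1 y ^+ (N - 2) / qf 1 y * (xfun y ^+ 2 +
    ((gap - `|w y| `^ (p - 1)) * qf 1 y + (N%:R - 1) * (N%:R - 3) / 4) * w y ^+ 2)) T1 y T1y.
  apply.
  - by move=> x _; exact: continuous_pfun.
  - by move=> x /andP[x1 _]; apply: has_derive_pfun; lra.
  move=> x /andP[x1 _]; apply: le_trans (@derive_pfun_ge gap T x _ _ g0 gT _) => //; try lra.
    have q0 : 0 <= qf 1 x by apply: qf_ge0; lra.
    apply: mulr_ge0; first by apply: divr_ge0 => //; rewrite exprn_ge0// sqrtr_ge0.
    apply: addr_ge0; first exact: sqr_ge0.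
    by apply: mulr_ge0; [apply: mulr_ge0 => //; lra|exact: sqr_ge0].
  have -> : gap - gap / 2 = gap / 2 by field.
  by apply: wT; lra.
have : 0 < pfun T1.
  by rewrite /pfun mulr_gt0// exprn_gt0// rho_gt0//; lra.
move=> p0; have : 0 < pfun y by lra.
apply: contraTneq => wy; rewrite /pfun /mder wy mul0r mulr0 ltxx.
by [].
Qed.

(** The radial volume element grows like y^(N-2) dy, so the exponent 1 - N is critical for
    integrability and 2 eta is the gain. The bound eta <= 1/4 is a normalization that keeps later
    exponents in range. *)
Definition fast_decay w z := exists C eta T,
  [/\ 0 < eta, eta <= 4^-1, 0 < T & forall y, T <= y ->
   w y ^+ 2 <= C * (y + 2) `^ (1 - 2 * eta - N%:R) /\
   qf 1 y * z y ^+ 2 <= C * (y + 2) `^ (1 - 2 * eta - N%:R)].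

Lemma has_derive_powR_shift (b : R) y : 0 <= y ->
  has_derive y 1 (fun y => (y + 2) `^ b) (b * (y + 2) `^ (b - 1)).
Proof.
move=> y0; apply: is_deriveE.
  apply: (@is_derive_compE _ _ (fun x => x `^ b) (fun y => y + 2)).
    by apply: is_derive1_powR; lra.
  by apply: is_deriveDE; [exact: is_derive_idE|exact: is_derive_cstE].
by rewrite addr0 mulr1.
Qed.

Lemma powR_shiftD (b1 b2 y : R) : 0 <= y ->
  (y + 2) `^ (b1 + b2) = (y + 2) `^ b1 * (y + 2) `^ b2.
Proof. by move=> y0; rewrite powRD// (gt_eqF (_ : 0 < y + 2)) ?implybT//; lra. Qed.

Lemma powR_shiftX n y : 0 <= y -> (y + 2) ^+ n = (y + 2) `^ n%:R.
Proof. by move=> y0; rewrite powR_mulrn//; lra. Qed.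

(** v^2 alone need not decrease at a definite rate, as v v' may vanish. Subtracting a multiple of
    [pfun] <= 0 gives a quantity S >= v^2 with S' <= - 2 eta S / rho, because the derivative of
    [pfun] is at least gap v^2 / (4 rho). *)
Lemma decay_function T : 0 < T -> 0 < gap -> gap^-1 <= qf 1 T ->
  (forall y, T <= y -> `|w y| `^ (p - 1) <= gap / 2) ->
  (forall y, T <= y -> mder y (w y) (z y) <= 0) ->
  exists C eta, [/\ 0 < eta, eta <= 4^-1, 0 <= C & forall y, T <= y ->
    vfun y <= C * (y + 2) `^ (- (2 * eta))].
Proof.
move=> T0 g0 gT wT mT.
(* With beta = 8 eta / gap one has beta gap / 4 = 2 eta, and the two bounds on eta give eta beta = 8
   eta^2 / gap <= 1. *)
pose eta := Num.min 4^-1 (gap / 2).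
have eta0 : 0 < eta by rewrite lt_min invr_gt0 ltr0n divr_gt0.
have eta4 : eta <= 4^-1 by rewrite ge_min lexx.
have etag : eta <= gap / 2 by rewrite ge_min lexx orbT.
pose beta := 8 * eta / gap.
have beta0 : 0 < beta by rewrite divr_gt0// mulr_gt0.
have be : eta * beta <= 1.
  by rewrite /beta mulrA ler_pdivrMr//; fnra.
pose S y := vfun y - beta * pfun y.
have pn y : T <= y -> pfun y <= 0.
  move=> Ty; rewrite /pfun mulr_ge0_le0 ?mT//.
  by rewrite exprn_ge0// sqrtr_ge0.
have v0 y : 0 <= vfun y.
  by rewrite /vfun mulr_ge0 ?sqr_ge0// exprn_ge0// sqrtr_ge0.
have Sv y : T <= y -> vfun y <= S y.
  by move=> Ty; rewrite /S lerDl oppr_ge0 mulr_ge0_le0 ?pn// ltW.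
exists (S T * (T + 2) `^ (2 * eta)), eta; split => //.
  by rewrite mulr_ge0 ?powR_ge0//; apply: le_trans (Sv T _).
move=> y Ty; apply: le_trans (Sv y Ty) _.
have y0 : 0 < y by flra.
rewrite powRN ler_pdivlMr; last by rewrite powR_gt0//; flra.
have := @derive_nonincreasing _ (fun y => S y * (y + 2) `^ (2 * eta))
  (fun y => S y * (2 * eta * (y + 2) `^ (2 * eta - 1)) + (y + 2) `^ (2 * eta) *
    (2 * pfun y / rho 1 y - beta * (rho 1 y ^+ (N - 2) / qf 1 y * (xfun y ^+ 2 +
    ((gap - `|w y| `^ (p - 1)) * qf 1 y + (N%:R - 1) * (N%:R - 3) / 4) * w y ^+ 2))))
  T y Ty; apply.
- move=> x /andP[Tx _]; apply: cvgM.
    apply: cvgB; first exact: continuous_vfun.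
    by apply: cvgM; [exact: cvg_cst|exact: continuous_pfun].
  by apply: is_derive_continuous (has_derive_powR_shift _ _); flra.
- move=> x /andP[Tx _]; have x0 : 0 < x by flra.
  apply: is_deriveME; last exact: has_derive_powR_shift (ltW x0).
  apply: is_deriveDE; first exact: has_derive_vfun.
  apply: is_deriveNE; apply: is_deriveE.
    by apply: is_deriveME; [exact: is_derive_cstE|exact: has_derive_pfun].
  by rewrite /=; ring.
move=> x /andP[Tx _]; have x0 : 0 < x by flra.
have Tx' := ltW Tx.
have q0 := qf_gt0 ler01 x0; have r0 := @rho_gt0 R 1 x ler01 x0.
set dP := rho 1 x ^+ (N - 2) / qf 1 x * _.
have dPge : gap / 4 * vfun x / rho 1 x <= dP.
  apply: le_trans (@derive_pfun_ge gap T x T0 Tx' g0 gT _); last first.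
    have -> : gap - gap / 2 = gap / 2 by field.
    exact: wT.
  have -> : gap / 4 * vfun x / rho 1 x = rho 1 x ^+ (N - 2) / qf 1 x * (gap / 4 * qf 1 x * w x ^+ 2).
    rewrite /vfun; have -> : (N - 1 = (N - 2).+1)%N by rewrite -subSn// subSS.
    by rewrite exprS; field; rewrite !gt_eqF.
  apply: ler_wpM2l; last by rewrite lerDr sqr_ge0.
  by apply: divr_ge0; [rewrite exprn_ge0// ltW|exact: ltW].
rewrite powR_shiftD ?(ltW x0)// powRN powRr1; last flra.
set E := (x + 2) `^ (2 * eta); have E0 : 0 <= E by rewrite powR_ge0.
have -> : S x * (2 * eta * (E * (x + 2)^-1)) + E * (2 * pfun x / rho 1 x - beta * dP) =
  E * (2 * eta * (S x / (x + 2)) + (2 * pfun x / rho 1 x - beta * dP)) by ring.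
rewrite mulr_ge0_le0//.
have S0 : 0 <= S x by apply: le_trans (v0 x) (Sv x Tx').
have h1 : S x / (x + 2) <= S x / rho 1 x.
  rewrite ler_wpM2l// lef_pV2 ?posrE//; last flra.
  by apply: rho_le; flra.
have h2 : beta * (gap / 4 * vfun x / rho 1 x) <= beta * dP by rewrite ler_pM2l.
have h3 : beta * (gap / 4 * vfun x / rho 1 x) = 2 * eta * (vfun x / rho 1 x).
  by rewrite /beta; field; rewrite !gt_eqF.
have h4 : pfun x / rho 1 x <= eta * beta * (pfun x / rho 1 x).
  have : pfun x / rho 1 x <= 0 by rewrite mulr_le0_ge0 ?pn// invr_ge0 ltW.
  by fnra.
have h5 : 2 * eta * (S x / rho 1 x) = 2 * eta * (vfun x / rho 1 x) -
   2 * (eta * beta * (pfun x / rho 1 x)) by rewrite /S; ring.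
have : 2 * eta * (S x / (x + 2)) <= 2 * eta * (S x / rho 1 x).
  by apply: ler_wpM2l => //; flra.
by flra.
Qed.

Lemma rho_ge_shift n y : 1 <= y -> (y + 2) ^+ n <= 2 ^+ n * rho 1 y ^+ n.
Proof.
move=> y1; rewrite -exprMn lerXn2r ?nnegrE ?mulr_ge0 ?sqrtr_ge0//; first lra.
rewrite -(@ler_pXn2r _ 2) ?nnegrE ?mulr_ge0 ?sqrtr_ge0//; last lra.
by rewrite exprMn sqr_rho /qf; nra.
Qed.

(** The decay of [vfun] is that of w^2. For z, the flux rho^N z has derivative - rho^(N-2) nonlin
    (w), and |nonlin (w)| is at most a constant times |w|, so the decay of w can be integrated. *)
Lemma fast_decay_of_mder T : 0 < T -> 0 < gap -> gap^-1 <= qf 1 T ->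
  (forall y, T <= y -> `|w y| `^ (p - 1) <= gap / 2) ->
  (forall y, T <= y -> mder y (w y) (z y) <= 0) -> fast_decay w z.
Proof.
move=> T0 g0 gT wT mT.
have [C [eta [eta0 eta4 C0 vC]]] := decay_function T0 g0 gT wT mT.
have N1 : 2 <= N%:R :> R by rewrite ler_nat.
pose b := 1 - 2 * eta - N%:R.
have N1E : (N - 1)%:R = N%:R - 1 :> R by rewrite natrB// ltnW.
pose C1 := 2 ^+ (N - 1) * C.
have C10 : 0 <= C1 by rewrite mulr_ge0// exprn_ge0.
have wC y : T + 1 <= y -> w y ^+ 2 <= C1 * (y + 2) `^ b.
  move=> Ty; have y0 : 0 <= y by flra.
  have Y0 : 0 < (y + 2) ^+ (N - 1) by rewrite exprn_gt0//; flra.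
  have -> : (y + 2) `^ b = (y + 2) `^ (- (2 * eta)) / (y + 2) ^+ (N - 1).
    rewrite powR_shiftX// N1E -powRN -powR_shiftD//; congr (_ `^ _).
    by rewrite /b; ring.
  rewrite mulrA ler_pdivlMr//.
  apply: le_trans (_ : w y ^+ 2 * (2 ^+ (N - 1) * rho 1 y ^+ (N - 1)) <= _).
    by apply: ler_wpM2l; [exact: sqr_ge0|apply: rho_ge_shift; flra].
  rewrite /C1 -mulrA mulrCA ler_wpM2l ?exprn_ge0//.
  by rewrite mulrC; apply: vC; flra.
pose F := `|lam| + gap / 2; have F0 : 0 <= F by rewrite addr_ge0// divr_ge0// ltW.
pose C2 := F * Num.sqrt C1; have C20 : 0 <= C2 by rewrite mulr_ge0// sqrtr_ge0.
have fC y : T + 1 <= y -> `|nonlin (w y)| <= C2 * (y + 2) `^ (b / 2).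
  move=> Ty; have wT' : `|w y| `^ (p - 1) <= gap / 2 by apply: wT; flra.
  apply: le_trans (_ : F * `|w y| <= _).
    rewrite /nonlin /spow -mulrDl normrM ler_wpM2r//.
    apply: le_trans (ler_normD _ _) _; rewrite /F lerD2l ger0_norm ?powR_ge0//.
  rewrite /C2 -mulrA ler_wpM2l//.
  rewrite -(@ler_pXn2r _ 2) ?nnegrE ?mulr_ge0 ?sqrtr_ge0 ?powR_ge0//.
  rewrite real_normK ?num_real// exprMn sqr_sqrtr//.
  rewrite -(powR_mulrn 2 (powR_ge0 _ _)) -powRrM.
  have -> : b / 2 * 2%:R = b by field.
  exact: wC.
(* m - 1 = N - 2 + b / 2 is the exponent of the integrand rho^(N-2) |w|. As eta <= 1/4, m is
   positive, so (y + 2)^m >= 1 also dominates the initial value of the flux. *)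
pose m := (N%:R - 1 - 2 * eta) / 2.
have m0 : 0 < m by rewrite /m; flra.
have dA s : 0 < s -> has_derive s 1 (fun s => rho 1 s ^+ N * z s)
    (- (rho 1 s ^+ (N - 2) * nonlin (w s))).
  move=> s0; apply: is_deriveE.
    by apply: is_deriveME; [exact: is_derive_rhoN|exact: dz].
  have -> : rho 1 s ^+ N = rho 1 s ^+ (N - 2) * qf 1 s.
    by rewrite -sqr_rho ?(ltW s0)// -exprD subnK.
  by have q0 := qf_gt0 ler01 s0; rewrite /=; field; rewrite gt_eqF.
pose T1 := T + 1; have T10 : 0 < T1 by rewrite /T1; flra.
pose A0 := `|rho 1 T1 ^+ N * z T1|.
pose C3 := A0 + C2 / m.
have zC y : T1 <= y -> rho 1 y ^+ N * `|z y| <= C3 * (y + 2) `^ m.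
  move=> Ty.
  have Y1 : 1 <= (y + 2) `^ m.
    by rewrite -[X in X <= _](powRr0 (y + 2)); apply: ler_powR; flra.
  have := @derive_normr_le _ (fun s => rho 1 s ^+ N * z s)
    (fun s => - (rho 1 s ^+ (N - 2) * nonlin (w s)))
    (fun s => C2 / m * (s + 2) `^ m) (fun s => C2 * (s + 2) `^ (m - 1)) T1 y Ty.
  move=> H; have {H} : `|rho 1 y ^+ N * z y - rho 1 T1 ^+ N * z T1| <=
    C2 / m * (y + 2) `^ m - C2 / m * (T1 + 2) `^ m.
    apply: H.
    - by move=> x _; apply: cvgM; [exact: continuous_rhoX|exact: cz].
    - move=> x /andP[x1 _]; apply: cvgM; first exact: cvg_cst.
      by apply: is_derive_continuous (has_derive_powR_shift _ _); flra.
    - by move=> x /andP[x1 _]; apply: dA; flra.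
    - move=> x /andP[x1 _]; apply: is_deriveE.
        apply: is_deriveME; first exact: is_derive_cstE.
        by apply: has_derive_powR_shift; flra.
      by rewrite /=; field; rewrite gt_eqF.
    - move=> x /andP[x1 _]; have x0 : 0 <= x by flra.
      rewrite normrN normrM ger0_norm; last by rewrite exprn_ge0// sqrtr_ge0.
      have r1 : rho 1 x ^+ (N - 2) <= (x + 2) `^ (N%:R - 2).
        rewrite -natrB// -powR_shiftX// lerXn2r ?nnegrE ?sqrtr_ge0//; first flra.
        exact: rho_le.
      have -> : m - 1 = (N%:R - 2) + b / 2 by rewrite /m /b; field.
      rewrite powR_shiftD// mulrCA ler_pM ?exprn_ge0 ?sqrtr_ge0//.
      by apply: fC; rewrite -/T1; flra.
  have a1 : 0 <= C2 / m * (T1 + 2) `^ m.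
    by rewrite mulr_ge0 ?powR_ge0// divr_ge0// ltW.
  have a2 : A0 <= A0 * (y + 2) `^ m by rewrite ler_peMr// /A0.
  have a3 : rho 1 y ^+ N * `|z y| = `|rho 1 y ^+ N * z y|.
    by rewrite normrM [in RHS]ger0_norm// exprn_ge0// sqrtr_ge0.
  have := ler_normB (rho 1 y ^+ N * z y - rho 1 T1 ^+ N * z T1) (- (rho 1 T1 ^+ N * z T1)).
  rewrite opprK subrK normrN -/A0 a3 /C3 mulrDl.
  by flra.
have C30 : 0 <= C3 by rewrite addr_ge0 ?normr_ge0// divr_ge0// ltW.
pose C4 := 4 ^+ N * C3 ^+ 2.
have C40 : 0 <= C4 by rewrite mulr_ge0 ?exprn_ge0.
exists (C1 + C4), eta, T1; split=> // y Ty; split.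
  apply: le_trans (wC y _) _ => //.
  by rewrite -/b ler_wpM2r ?powR_ge0// lerDl.
have y0 : 0 < y by flra.
apply: le_trans (_ : C4 * (y + 2) `^ b <= _); last first.
  by rewrite ler_wpM2r ?powR_ge0// lerDr.
have rN : 0 < rho 1 y ^+ N by rewrite exprn_gt0// rho_gt0.
have zC2 : `|z y| <= C3 * 2 ^+ N * (y + 2) `^ (b / 2 - 1).
  have -> : b / 2 - 1 = m - N%:R by rewrite /b /m; field.
  rewrite powR_shiftD ?(ltW y0)// powRN -powR_shiftX ?(ltW y0)//.
  have YN : 0 < (y + 2) ^+ N by rewrite exprn_gt0//; flra.
  rewrite mulrA ler_pdivlMr//.
  apply: le_trans (_ : `|z y| * (2 ^+ N * rho 1 y ^+ N) <= _).
    by apply: ler_wpM2l => //; apply: rho_ge_shift; rewrite /T1 in Ty; flra.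
  have := zC y Ty; move=> /(ler_wpM2l (exprn_ge0 N (ler0n R 2))).
  by move=> h; apply: le_trans (eq_ler _) (le_trans h (eq_ler _)); ring.
have q2 : qf 1 y <= (y + 2) ^+ 2 by rewrite /qf; fnra.
apply: le_trans (_ : (y + 2) ^+ 2 * (C3 * 2 ^+ N * (y + 2) `^ (b / 2 - 1)) ^+ 2 <= _).
  apply: ler_pM => //; [exact: qf_ge0 ler01 (ltW y0)|exact: sqr_ge0|].
  rewrite -[z y ^+ 2]real_normK ?num_real// lerXn2r ?nnegrE//.
  by rewrite !mulr_ge0 ?powR_ge0 ?exprn_ge0.
apply: eq_ler; rewrite !exprMn -(powR_mulrn 2 (powR_ge0 _ _)) -powRrM.
have -> : (b / 2 - 1) * 2%:R = b + - 2 by field.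
rewrite powR_shiftD ?(ltW y0)// powRN.
have -> : (y + 2) `^ 2 = (y + 2) ^+ 2 by rewrite powR_mulrn//; flra.
have e4 : 4 ^+ N = (2 ^+ N) ^+ 2 :> R.
  by rewrite -exprM mulnC exprM (_ : 2 ^+ 2 = 4 :> R)//; ring.
rewrite /C4 e4; field.
by rewrite gt_eqF//; flra.
Qed.

End solution.
End asymptotics.

(** * Solutions of nonnegative energy tend to zero *)

Section energy_decay.
Context {R : realType} (N : nat) (N2 : (2 <= N)%N) (p lam : R) (p1 : 1 < p).
Implicit Types (w z : R -> R) (e s t u v x y alpha K B L M T C eta : R).

Lemma nonincreasing_cauchy (h : R -> R) B (d : R) : 0 < d ->
  (forall x y, 1 <= x -> x <= y -> h y <= h x) -> (forall x, 1 <= x -> B <= h x) ->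
  exists2 T, 1 <= T & forall x y, T <= x -> T <= y -> h x - h y < d.
Proof.
move=> d0 hn hB; pose S := [set h x | x in [set x | 1 <= x]].
have iS : has_inf S.
  split; first by exists (h 1), 1 => /=.
  by exists B => _ [x x1 <-]; exact: hB.
have [_ [T /= T1 <-] hT] := inf_adherent d0 iS.
exists T => // x y Tx Ty.
have : h x <= h T by exact: hn.
have : inf S <= h y.
  by apply: ge_inf; [case: iS|exists y => //=; apply: le_trans Ty].
by lra.
Qed.

Variables (alpha : R) (w z : R -> R).
Variable (sol : radial_sol N 1 (nonlin p lam) alpha w z).
Variables (M : R) (wM : forall s, 0 <= s -> `|w s| <= M).

Let cw : continuous w. Proof. exact: radial_sol_continuous sol. Qed.
Let cz : continuous z. Proof. by case: sol. Qed.
Let dw s : has_derive s 1 w (z s). Proof. by case: sol. Qed.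
Let dz s : 0 < s -> has_derive s 1 z (- (N%:R * (1 * s + 1) * z s + nonlin p lam (w s)) / qf 1 s).
Proof. by case: sol => _ _ _ _; apply. Qed.

Lemma energy_le s t : 0 <= s -> s <= t ->
  energy p lam t (w t) (z t) <= energy p lam s (w s) (z s).
Proof.
move=> s0 st.
by have := energy_nonincreasing N2 ler01 sol (has_derive_nonlin_prim lam p1) s0 st.
Qed.

(** The energy bounds q z^2 up to the term lam w^2, which may be negative but is bounded with w, and
    y^2 <= q. *)
Lemma gradient_bound : exists2 Z, 0 < Z & forall y, 0 <= y -> y * `|z y| <= Z.
Proof. have p1_ := p1.
have M0 : 0 <= M by apply: le_trans (wM (lexx 0)).
pose Z := 1 + 2 * `|energy p lam 0 (w 0) (z 0)| + `|lam| * M ^+ 2.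
have Z1 : 1 <= Z by rewrite /Z -addrA lerDl addr_ge0// mulr_ge0// sqr_ge0.
exists Z; first lra.
move=> y y0; have := energy_le (lexx 0) y0.
rewrite {1}/energy /nonlin_prim => h.
have h2 : 0 <= w y * spow p (w y) / (p + 1).
  by rewrite divr_ge0 ?mul_spow_ge0//; lra.
have h3 : - (`|lam| * M ^+ 2) <= lam * w y ^+ 2.
  have : `|lam * w y ^+ 2| <= `|lam| * M ^+ 2.
    rewrite normrM ler_wpM2l// ger0_norm ?sqr_ge0// -[w y ^+ 2]real_normK ?num_real//.
    by rewrite lerXn2r ?nnegrE// wM.
  by rewrite ler_norml => /andP[].
have h4 := ler_norm (energy p lam 0 (w 0) (z 0)).
have hq : qf 1 y * z y ^+ 2 <= Z by rewrite /Z; lra.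
rewrite -(@ler_pXn2r _ 2) ?nnegrE ?mulr_ge0//; last lra.
rewrite exprMn real_normK ?num_real//.
apply: le_trans (_ : qf 1 y * z y ^+ 2 <= _).
  by rewrite ler_wpM2r ?sqr_ge0// /qf; nra.
by apply: le_trans hq _; nra.
Qed.

(** The energy only dissipates z^2. This cross term trades half of that for dissipation of the
    potential, so that [lyap] falls at the rate [wfun], which dominates the energy. The part with
    [ahalf] cancels the terms w z except for one divided by q, since (y + 1)^2 = q + 1; K / y
    absorbs the latter. *)
Definition cfun y := (y + 1) * (w y * z y) + ahalf N * w y ^+ 2.
Definition lyap K y :=
  energy p lam y (w y) (z y) / (N%:R - 1) + cfun y / 2 + K * y^-1.
Definition wfun y := energy p lam y (w y) (z y) +
  (2^-1 - (p + 1)^-1) * (w y * spow p (w y)).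

Lemma has_derive_lyap K y : 0 < y -> has_derive y 1 (lyap K)
  (- (wfun y * (y + 1) / qf 1 y) - N%:R * w y * z y / qf 1 y / 2 - K / y ^+ 2).
Proof. have p1_ := p1.
move=> y0; have N1 : 2 <= N%:R :> R by rewrite ler_nat.
apply: is_deriveE.
  apply: is_deriveDE; first apply: is_deriveDE.
  - apply: is_deriveME; last exact: is_derive_cstE.
    exact: (has_derive_energy ler01 sol (has_derive_nonlin_prim lam p1) y0).
  - apply: is_deriveME; last exact: is_derive_cstE.
    apply: is_deriveDE.
      apply: is_deriveME.
        by apply: is_deriveDE; [exact: is_derive_idE|exact: is_derive_cstE].
      by apply: is_deriveME; [exact: dw|exact: dz].
    apply: is_deriveME; first exact: is_derive_cstE.
    by apply: is_deriveXE; exact: dw.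
  - apply: is_deriveME; first exact: is_derive_cstE.
    by apply: is_deriveVE; [rewrite gt_eqF|exact: is_derive_idE].
rewrite /wfun /energy /nonlin_prim /nonlin /ahalf /qf /=; field.
by rewrite !gt_eqF//; lra.
Qed.

Lemma continuous_lyap K y : 0 < y -> {for y, continuous (lyap K)}.
Proof. by move=> y0; exact: is_derive_continuous (has_derive_lyap K y0). Qed.

Section nonnegative.
Hypothesis E0 : forall y, 0 <= y -> 0 <= energy p lam y (w y) (z y).

Let cp0 : 0 < 2^-1 - (p + 1)^-1 :> R.
Proof. have p1_ := p1. by rewrite subr_gt0 ltf_pV2 ?posrE; lra. Qed.

Lemma wfun_ge0 y : 0 <= y -> 0 <= wfun y.
Proof.
move=> y0; apply: addr_ge0; first exact: E0.
by apply: mulr_ge0; [exact: ltW|exact: mul_spow_ge0].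
Qed.

Lemma lyap_exists : exists K B, [/\ 0 <= K,
  (forall y, 1 <= y -> - (wfun y * (y + 1) / qf 1 y) - N%:R * w y * z y / qf 1 y / 2 - K / y ^+ 2
     <= - (wfun y / (2 * y))) &
  forall y, 1 <= y -> B <= lyap K y].
Proof.
have N1 : 2 <= N%:R :> R by rewrite ler_nat.
have [Z Z0 zZ] := gradient_bound.
have M0 : 0 <= M by apply: le_trans (wM (lexx 0)).
exists (N%:R * M * Z / 2), (- (M * Z)); split.
- by rewrite divr_ge0// !mulr_ge0// ltW.
- move=> y y1; have y0 : 0 < y by lra.
  have q0 := qf_gt0 ler01 y0.
  have h1 : `|N%:R * w y * z y / qf 1 y / 2| <= N%:R * M * Z / 2 / y ^+ 2.
    rewrite normrM [`|2^-1|]ger0_norm ?invr_ge0//.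
    have -> : N%:R * M * Z / 2 / y ^+ 2 = N%:R * M * Z / y ^+ 2 / 2 by ring.
    rewrite ler_pM2r ?invr_gt0// normrM normfV (gtr0_norm q0) ler_pdivrMr//.
    rewrite !normrM ger0_norm ?ler0n//.
    have zy : `|z y| <= Z by apply: le_trans (zZ y (ltW y0)); rewrite ler_peMl.
    apply: le_trans (_ : N%:R * M * Z <= _).
      rewrite ler_pM ?mulr_ge0 ?ler0n//.
      by rewrite ler_wpM2l ?ler0n// wM// ltW.
    rewrite [leRHS]mulrAC ler_pdivlMr ?exprn_gt0//; apply: ler_wpM2l; first by rewrite !mulr_ge0 ?ler0n ?(ltW Z0).
    by rewrite /qf; nra.
  have h2 : wfun y / (2 * y) <= wfun y * (y + 1) / qf 1 y.
    rewrite -mulrA ler_wpM2l ?wfun_ge0 ?(ltW y0)//.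
    rewrite ler_pdivlMr// mulrC ler_pdivrMr ?mulr_gt0// /qf; nra.
  by move: h1; rewrite ler_norml => /andP[h1 _]; lra.
- move=> y y1; have y0 : 0 < y by lra.
  have a0 : 0 <= ahalf N * w y ^+ 2.
    by rewrite mulr_ge0 ?sqr_ge0// /ahalf divr_ge0//; lra.
  have h1 : `|(y + 1) * (w y * z y)| <= 2 * (M * Z).
    rewrite !normrM (ger0_norm (_ : 0 <= y + 1)); last lra.
    apply: le_trans (_ : 2 * y * (`|w y| * `|z y|) <= _).
      by rewrite ler_wpM2r ?mulr_ge0//; lra.
    rewrite -mulrA ler_pM2l// mulrCA ler_pM ?mulr_ge0 ?(ltW y0)//.
      by apply: wM; lra.
    by apply: zZ; lra.
  have h2 : 0 <= energy p lam y (w y) (z y) / (N%:R - 1).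
    by rewrite divr_ge0 ?E0//; lra.
  have h3 : 0 <= N%:R * M * Z / 2 * y^-1.
    by rewrite !mulr_ge0 ?invr_ge0 ?(ltW y0) ?(ltW Z0).
  by move: h1; rewrite ler_norml /lyap /cfun => /andP[h1 _]; lra.
Qed.

(** If [wfun] stays above w0 on [y, y (1 + tau)], then [lyap] drops there by at least w0 tau / 4, an
    amount independent of y, because its slope is at most - w0 / (4 y). A bounded monotone function
    cannot do so for large y. *)
Lemma wfun_small (d tau w0 : R) : 0 < tau -> tau <= 1 -> 0 < w0 ->
  exists2 T, 1 <= T & forall y, T <= y ->
    ~ (forall t, y <= t <= y * (1 + tau) -> w0 <= wfun t).
Proof.
move=> tau0 tau1 w00.
have [K [B [K0 lK lB]]] := lyap_exists.
have mono x y : 1 <= x -> x <= y -> lyap K y <= lyap K x.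
  move=> x1 xy.
  have := @derive_nonincreasing _ (lyap K) (fun y => - (wfun y * (y + 1) / qf 1 y) -
    N%:R * w y * z y / qf 1 y / 2 - K / y ^+ 2) x y xy; apply.
  - by move=> t /andP[xt _]; apply: continuous_lyap; flra.
  - by move=> t /andP[xt _]; apply: has_derive_lyap; flra.
  - move=> t /andP[xt _]; apply: le_trans (lK t _) _; first flra.
    by rewrite oppr_le0 divr_ge0 ?wfun_ge0//; flra.
have d0 : 0 < w0 * tau / 4 by rewrite divr_gt0// mulr_gt0.
have [T T1 HT] := nonincreasing_cauchy d0 mono lB.
exists T => // y Ty H.
have y0 : 0 < y by lra.
have yy : y <= y * (1 + tau) by rewrite ler_peMr; lra.
have := HT y (y * (1 + tau)) Ty (le_trans Ty yy).
have := @derive_le _ (lyap K) (fun y => - (wfun y * (y + 1) / qf 1 y) -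
    N%:R * w y * z y / qf 1 y / 2 - K / y ^+ 2)
  (fun t => - (w0 / (4 * y)) * t) (fun=> - (w0 / (4 * y))) y (y * (1 + tau)) yy.
move=> h; have {h} : lyap K (y * (1 + tau)) - lyap K y <=
    - (w0 / (4 * y)) * (y * (1 + tau)) - - (w0 / (4 * y)) * y.
  apply: h.
  - by move=> t /andP[xt _]; apply: continuous_lyap; flra.
  - by move=> t _; apply: cvgM; [exact: cvg_cst|exact: cvg_id].
  - by move=> t /andP[xt _]; apply: has_derive_lyap; flra.
  - move=> t _; apply: is_deriveE.
      by apply: is_deriveME; [exact: is_derive_cstE|exact: is_derive_idE].
    by rewrite /=; ring.
  - move=> t /andP[yt ty]; apply: le_trans (lK t _) _; first flra.
    rewrite lerN2.
    have wt : w0 <= wfun t by apply: H; rewrite !ltW.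
    have t2 : t <= 2 * y by fnra.
    rewrite ler_pM ?(ltW w00) ?invr_ge0//; first by rewrite mulr_ge0// ltW.
    by rewrite lef_pV2 ?posrE; flra.
have -> : - (w0 / (4 * y)) * (y * (1 + tau)) - - (w0 / (4 * y)) * y = - (w0 * tau / 4).
  by field; rewrite gt_eqF.
by flra.
Qed.

(** An energy above d at y is above d on all of [y / 2, y] by monotonicity. A value |w y| > d keeps
    |w| >= d / 2 on [y, y (1 + tau)] by the bound Z / y on the slope. Either one keeps [wfun] large
    on an interval of fixed ratio. *)
Lemma energy_vanishes (d : R) : 0 < d -> exists2 T, 0 < T & forall y, T <= y ->
  energy p lam y (w y) (z y) <= d /\ `|w y| <= d.
Proof. have p1_ := p1.
move=> d0.
have [T1 T11 H1] := wfun_small 0 ltr01 (lexx 1) d0.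
have [Z Z0 zZ] := gradient_bound.
pose tau := Num.min 1 (d / (2 * Z)).
have tau0 : 0 < tau by rewrite lt_min ltr01 divr_gt0// mulr_gt0.
have tau1 : tau <= 1 by rewrite ge_min lexx.
have tauZ : Z * tau <= d / 2.
  have : tau <= d / (2 * Z) by rewrite ge_min lexx orbT.
  by rewrite ler_pdivlMr ?mulr_gt0//; lra.
pose w0 := (2^-1 - (p + 1)^-1) * (d / 2 * spow p (d / 2)).
have d20 : 0 < d / 2 by rewrite divr_gt0.
have w00 : 0 < w0 by apply: mulr_gt0 => //; apply: mulr_gt0 => //; exact: spow_gt0.
have [T2 T21 H2] := wfun_small 0 tau0 tau1 w00.
exists (2 * T1 + T2); first flra.
move=> y Ty; split.
  rewrite leNgt; apply/negP => dE; apply: (H1 (y / 2)); first flra.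
  move=> t /andP[yt ty].
  have : energy p lam y (w y) (z y) <= energy p lam t (w t) (z t).
    by apply: energy_le; flra.
  have : 0 <= (2^-1 - (p + 1)^-1) * (w t * spow p (w t)).
    by rewrite mulr_ge0 ?mul_spow_ge0// ltW.
  by rewrite /wfun; flra.
rewrite leNgt; apply/negP => dw'; apply: (H2 y); first flra.
move=> t /andP[yt ty]; have y0 : 0 < y by flra.
have h1 : `|w t - w y| <= Z / y * t - Z / y * y.
  have := @derive_normr_le _ w z (fun t => Z / y * t) (fun=> Z / y) y t yt; apply.
  - by move=> x _; exact: cw.
  - by move=> x _; apply: cvgM; [exact: cvg_cst|exact: cvg_id].
  - by move=> x _; exact: dw.
  - move=> x _; apply: is_deriveE.
      by apply: is_deriveME; [exact: is_derive_cstE|exact: is_derive_idE].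
    by rewrite /=; ring.
  - move=> x /andP[yx _]; rewrite ler_pdivlMr// mulrC.
    by apply: le_trans (zZ x _); [rewrite ler_wpM2r//; flra|flra].
have h2 : Z / y * t - Z / y * y <= d / 2.
  rewrite -mulrBr; apply: le_trans tauZ.
  rewrite -mulrA ler_pM2l// mulrC ler_pdivrMr//; flra.
have h3 : d / 2 <= `|w t|.
  have := ler_normB (w t) (w t - w y); rewrite opprB addrC subrK; flra.
apply: le_trans (_ : (2^-1 - (p + 1)^-1) * (w t * spow p (w t)) <= _); last first.
  by rewrite /wfun lerDr; apply: E0; flra.
rewrite /w0 ler_pM2l// !mul_spow ler_pM ?powR_ge0 ?sqr_ge0//.
  by apply: ler_powR_norm; [flra|rewrite gtr0_norm].
by rewrite -[w t ^+ 2]real_normK ?num_real// lerXn2r ?nnegrE ?(ltW d20).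
Qed.

End nonnegative.

Lemma mder_le_grad : exists2 C, 0 < C & forall y, 0 <= y -> mder N y (w y) (z y) <= C * (y + 2).
Proof.
have N1 : 2 <= N%:R :> R by rewrite ler_nat.
have [Z Z0 zZ] := gradient_bound.
have M0 : 0 <= M by apply: le_trans (wM (lexx 0)).
have a0 : 0 <= ahalf N :> R by rewrite /ahalf divr_ge0//; lra.
exists (1 + M * Z + ahalf N * M ^+ 2).
  have : 0 <= M * Z by rewrite mulr_ge0// ltW.
  have : 0 <= ahalf N * M ^+ 2 by rewrite mulr_ge0// sqr_ge0.
  by lra.
move=> y y0; rewrite /mder.
have h1 : w y * (qf 1 y * z y) <= M * Z * (y + 2).
  apply: le_trans (ler_norm _) _; rewrite normrM -mulrA ler_pM//; first exact: wM.
  rewrite normrM ger0_norm ?qf_ge0//.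
  have -> : qf 1 y * `|z y| = y * `|z y| * (y + 2) by rewrite /qf; ring.
  by rewrite ler_wpM2r ?zZ//; lra.
have h2 : w y * (ahalf N * (y + 1) * w y) <= ahalf N * M ^+ 2 * (y + 2).
  have -> : w y * (ahalf N * (y + 1) * w y) = ahalf N * w y ^+ 2 * (y + 1) by ring.
  apply: ler_pM; [by rewrite mulr_ge0// sqr_ge0|lra| |lra].
  apply: ler_wpM2l => //; rewrite -[w y ^+ 2]real_normK ?num_real//.
  by rewrite lerXn2r ?nnegrE// wM.
by rewrite mulrDr; lra.
Qed.

(** If [pfun] were positive, (v v')' >= v'^2 + kp^2 v^2 >= 2 kp v v' would make it grow at least
    like y^(2 kp), while bounded w and y z allow no more than y^(2 a), and a < kp because lam <
    0. *)
Lemma mder_not_pos T : 0 < T -> lam < 0 -> (- lam)^-1 <= qf 1 T ->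
  (forall y, T <= y -> `|w y| `^ (p - 1) <= - lam / 2) ->
  mder N T (w T) (z T) <= 0.
Proof.
move=> T0 l0 lT wT; rewrite leNgt; apply/negP => m0.
have N1 : 2 <= N%:R :> R by rewrite ler_nat.
pose a : R := ahalf N; have a0 : 0 < a by rewrite /a /ahalf divr_gt0//; lra.
(* As |w|^(p-1) <= - lam / 2, the potential is at least a^2 - lam / 2 = kp^2 - lam / 4, and the
   spare - lam / 4 pays for the curvature term. *)
pose kp := Num.sqrt (a ^+ 2 - lam / 4).
have kp2 : kp ^+ 2 = a ^+ 2 - lam / 4.
  by rewrite sqr_sqrtr// ltW// subr_gt0 (lt_trans _ (exprn_gt0 2 a0))//; flra.
have kpa : a < kp.
  rewrite -(@ltr_pXn2r _ 2) ?nnegrE ?sqrtr_ge0 ?(ltW a0)// kp2; flra.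
pose th := 2 * kp.
have PT0 : 0 < pfun N w z T by rewrite mulr_gt0// exprn_gt0// rho_gt0.
pose dP y := rho 1 y ^+ (N - 2) / qf 1 y * (xfun N w z y ^+ 2 +
    ((gap N lam - `|w y| `^ (p - 1)) * qf 1 y + (N%:R - 1) * (N%:R - 3) / 4) * w y ^+ 2).
have DP y : 0 < y -> has_derive y 1 (pfun N w z) (dP y).
  by move=> y0; exact: (has_derive_pfun N2 sol).
have dPge y : T <= y -> 2 * kp * `|pfun N w z y| / rho 1 y <= dP y.
  move=> Ty; have y0 : 0 < y by flra.
  have q0 := qf_gt0 ler01 y0; have r0 := @rho_gt0 R 1 y ler01 y0.
  have := wT y Ty.
  rewrite /dP; set k := `|w y| `^ (p - 1) => kl.
  have rN : 0 < rho 1 y ^+ (N - 2) by rewrite exprn_gt0.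
  have qT : qf 1 T <= qf 1 y by rewrite /qf; fnra.
  have h1 : 1 <= - lam * qf 1 y by rewrite -ler_pdivrMl ?oppr_gt0// mulr1; flra.
  have sq : 0 <= (N%:R - 2) ^+ 2 :> R by exact: sqr_ge0.
  have h2 : - 1 <= (N%:R - 1) * (N%:R - 3) :> R by flra.
  have h3 : kp ^+ 2 * qf 1 y <= (gap N lam - k) * qf 1 y + (N%:R - 1) * (N%:R - 3) / 4.
    have : (kp ^+ 2 - lam / 4) * qf 1 y <= (gap N lam - k) * qf 1 y.
      by rewrite ler_pM2r// kp2 /gap -/a; flra.
    by flra.
  have -> : 2 * kp * `|pfun N w z y| / rho 1 y = rho 1 y ^+ (N - 2) / qf 1 y *
      (2 * (kp * rho 1 y * `|w y|) * `|xfun N w z y|).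
    rewrite /pfun -xfun_mder !normrM (gtr0_norm rN) -(sqr_rho ler01 (ltW y0)).
    by field; rewrite gt_eqF.
  apply: ler_wpM2l; first by rewrite divr_ge0 ?ltW.
  apply: le_trans (_ : xfun N w z y ^+ 2 + kp ^+ 2 * qf 1 y * w y ^+ 2 <= _); last first.
    by rewrite lerD2l ler_wpM2r ?sqr_ge0.
  have : 0 <= (`|xfun N w z y| - kp * rho 1 y * `|w y|) ^+ 2 by exact: sqr_ge0.
  rewrite sqrrB !exprMn !real_normK ?num_real// sqr_rho ?(ltW y0)//; flra.
have kp0 : 0 < kp by flra.
have Pmono y : T <= y -> pfun N w z T <= pfun N w z y.
  move=> Ty; have := @derive_nondecreasing _ (pfun N w z) dP T y Ty; apply.
  - by move=> x _; exact: (continuous_pfun sol).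
  - by move=> x /andP[Tx _]; apply: DP; flra.
  - move=> x /andP[Tx _]; apply: le_trans (dPge x (ltW Tx)).
    have x0 : 0 < x by flra.
    by rewrite divr_ge0 ?mulr_ge0 ?(ltW kp0) ?sqrtr_ge0.
have growth y : T <= y -> pfun N w z T * (T + 2) `^ (- th) <= pfun N w z y * (y + 2) `^ (- th).
  move=> Ty; have := @derive_nondecreasing _ (fun y => pfun N w z y * (y + 2) `^ (- th))
    (fun y => pfun N w z y * (- th * (y + 2) `^ (- th - 1)) + (y + 2) `^ (- th) * dP y) T y Ty.
  apply.
  - move=> x /andP[Tx _]; apply: cvgM; first exact: (continuous_pfun sol).
    by apply: is_derive_continuous (has_derive_powR_shift _ _); flra.
  - move=> x /andP[Tx _]; have x0 : 0 < x by flra.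
    by apply: is_deriveME; [exact: DP|exact: has_derive_powR_shift (ltW x0)].
  - move=> x /andP[Tx _]; have x0 : 0 < x by flra.
    have p0 : 0 < pfun N w z x by have := Pmono x (ltW Tx); flra.
    rewrite powR_shiftD ?(ltW x0)// (powRN _ 1) powRr1; last flra.
    set E := (x + 2) `^ (- th); have E0 : 0 <= E by rewrite powR_ge0.
    have -> : pfun N w z x * (- th * (E * (x + 2)^-1)) + E * dP x =
      E * (dP x - th * (pfun N w z x / (x + 2))) by ring.
    rewrite mulr_ge0// subr_ge0; apply: le_trans (dPge x (ltW Tx)).
    rewrite (gtr0_norm p0) /th -(mulrA (2 * kp)) ler_wpM2l//; first flra.
    rewrite ler_pM2l// lef_pV2 ?posrE; [|flra|exact: rho_gt0].
    by apply: rho_le; flra.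
have [C C0 mC] := mder_le_grad.
have upper y : T <= y -> pfun N w z y <= C * (y + 2) `^ (2 * a).
  move=> Ty; have y0 : 0 <= y by flra.
  have -> : 2 * a = (N - 2)%:R + 1 by rewrite natrB// /a /ahalf; field.
  rewrite powR_shiftD// -powR_shiftX// powRr1; last flra.
  apply: le_trans (_ : rho 1 y ^+ (N - 2) * (C * (y + 2)) <= _).
    by rewrite ler_wpM2l ?mC// exprn_ge0// sqrtr_ge0.
  rewrite [leRHS]mulrCA ler_wpM2r ?mulr_ge0 ?(ltW C0)//; first flra.
  by rewrite lerXn2r ?nnegrE ?sqrtr_ge0 ?rho_le//; flra.
pose c1 := pfun N w z T * (T + 2) `^ (- th).
have c10 : 0 < c1 by rewrite mulr_gt0// powR_gt0//; flra.
have sg : 0 < th - 2 * a by rewrite /th; flra.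
have bound y : T <= y -> c1 * (y + 2) `^ (th - 2 * a) <= C.
  move=> Ty; have y0 : 0 <= y by flra.
  have h : c1 <= C * (y + 2) `^ (2 * a - th).
    rewrite powR_shiftD// mulrA; apply: le_trans (growth y Ty) _.
    by rewrite ler_wpM2r ?powR_ge0// upper.
  have := ler_wpM2r (powR_ge0 (y + 2) (th - 2 * a)) h.
  rewrite -(mulrA C) -powR_shiftD//.
  have -> : 2 * a - th + (th - 2 * a) = 0 by ring.
  by rewrite powRr0 mulr1.
pose X := (C / c1 + 1) `^ (th - 2 * a)^-1.
have X0 : 0 <= X by rewrite powR_ge0.
have := bound (T + X); rewrite lerDl => /(_ X0); apply/negP; rewrite -ltNge.
have : X `^ (th - 2 * a) <= (T + X + 2) `^ (th - 2 * a).
  by apply: ge0_ler_powR; rewrite ?nnegrE ?(ltW sg)//; flra.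
rewrite /X -powRrM mulVf ?(gt_eqF sg)// powRr1; last first.
  by rewrite addr_ge0// divr_ge0// ltW.
move=> /(ler_wpM2l (ltW c10)); rewrite mulrDr mulr1 [c1 * (C / c1)]mulrC divfK ?(gt_eqF c10)//.
by flra.
Qed.

End energy_decay.

(** * Fast decay or no further zeros *)

Section dichotomy.
Context {R : realType} (N : nat) (N2 : (2 <= N)%N) (p lam : R) (p1 : 1 < p).
Hypothesis gap0 : 0 < gap N lam.
Implicit Types (w z : R -> R) (e s t u v x y alpha K B L M T C eta : R).

(** The value of |u|^(p+1) / (p+1) where |u|^(p-1) = gap / 2. *)
Definition small_energy : R :=
  gap N lam / 2 * ((gap N lam / 2) `^ (p - 1)^-1) ^+ 2 / (p + 1).

Lemma small_energy_gt0 : 0 < small_energy.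
Proof. have p1_ := p1.
have g20 : 0 < gap N lam / 2 by rewrite divr_gt0.
by rewrite divr_gt0 ?mulr_gt0 ?exprn_gt0 ?powR_gt0//; lra.
Qed.

Lemma small_energyP y u v : 0 <= lam -> 0 <= y ->
  energy p lam y u v < small_energy -> `|u| `^ (p - 1) <= gap N lam / 2.
Proof. have p1_ := p1.
move=> l0 y0 E; rewrite leNgt; apply/negP => gu.
have g20 : 0 < gap N lam / 2 by rewrite divr_gt0.
have pp : 0 < p - 1 by lra.
have h1 : (gap N lam / 2) `^ (p - 1)^-1 <= `|u|.
  have -> : `|u| = (`|u| `^ (p - 1)) `^ (p - 1)^-1.
    by rewrite -powRrM mulfV ?lt0r_neq0// powRr1.
  by apply: ge0_ler_powR; rewrite ?nnegrE ?powR_ge0 ?invr_ge0 ?(ltW pp) ?(ltW g20) ?(ltW gu).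
move: E; rewrite ltNge => /negP; apply.
rewrite /energy /nonlin_prim.
have h2 : 0 <= qf 1 y * v ^+ 2 / 2.
  by rewrite divr_ge0// mulr_ge0 ?sqr_ge0// qf_ge0.
have h3 : 0 <= lam * u ^+ 2 / 2 by rewrite divr_ge0// mulr_ge0// sqr_ge0.
suff : small_energy <= u * spow p u / (p + 1) by lra.
rewrite /small_energy ler_pM2r ?invr_gt0; last lra.
rewrite mul_spow ler_pM ?(ltW g20) ?(ltW gu) ?sqr_ge0//.
by rewrite -[u ^+ 2]real_normK ?num_real// lerXn2r ?nnegrE ?powR_ge0.
Qed.

(* An open condition on the Cauchy data at [T] that excludes later zeros. *)
Definition no_zero_after T u v : Prop :=
  energy p lam T u v < 0 \/
  [/\ 0 <= lam, energy p lam T u v < small_energy, 0 < mder N T u v &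
    (gap N lam)^-1 <= qf 1 T].

(** At a zero of w the energy is purely kinetic, hence nonnegative, so negative energy excludes
    zeros. In the other case the energy stays small, which keeps w in the range required by
    [mder_pos_forward]. *)
Lemma no_zero_afterP alpha w z T : radial_sol N 1 (nonlin p lam) alpha w z ->
  0 < T -> no_zero_after T (w T) (z T) -> forall y, T <= y -> w y != 0.
Proof.
move=> sol T0 [E0|[l0 E0 m0 gT]] y Ty.
  have := energy_le N2 p1 sol (ltW T0) Ty.
  apply: contraTneq => wy; rewrite -ltNge; apply: lt_le_trans E0 _.
  rewrite /energy /nonlin_prim wy expr0n /= mulr0 !mul0r !addr0.
  by rewrite divr_ge0// mulr_ge0 ?sqr_ge0// qf_ge0//; lra.
apply: (mder_pos_forward N2 sol T0 gap0 gT _ (lexx T) m0 Ty) => x Tx.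
apply: (@small_energyP x (w x) (z x)) => //; first lra.
by apply: le_lt_trans (energy_le N2 p1 sol (ltW T0) Tx) E0.
Qed.

(** If the energy never becomes negative, then w tends to 0. For lam < 0 decay is then necessarily
    fast, by [mder_not_pos]. For lam >= 0 either [mder] is eventually nonpositive, which gives fast
    decay, or it is positive at some late point. *)
Lemma fast_decay_or_no_zero alpha w z M :
  radial_sol N 1 (nonlin p lam) alpha w z -> (forall s, 0 <= s -> `|w s| <= M) ->
  fast_decay N w z \/ exists2 T, 0 < T & no_zero_after T (w T) (z T).
Proof. have p1_ := p1.
move=> sol wM.
have [E0|] := pselect (forall y, 0 <= y -> 0 <= energy p lam y (w y) (z y)); last first.
  move=> /existsNP[y /not_implyP[y0 /negP]]; rewrite -ltNge => Ey.
  right; exists (y + 1); first flra.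
  left; apply: le_lt_trans Ey; apply: (energy_le N2 p1 sol y0); flra.
have pp : 0 < p - 1 by flra.
have small c : 0 < c -> exists2 T, 0 < T & forall y, T <= y -> `|w y| `^ (p - 1) <= c.
  move=> c0; have d0 : 0 < c `^ (p - 1)^-1 by rewrite powR_gt0.
  have [T T0 HT] := energy_vanishes N2 p1 sol wM E0 d0.
  exists T => // y /HT[_ h]; have -> : c = (c `^ (p - 1)^-1) `^ (p - 1).
    by rewrite -powRrM mulVf ?gt_eqF// powRr1// ltW.
  by apply: ge0_ler_powR; rewrite ?nnegrE ?powR_ge0 ?(ltW pp).
have [T1 T10 H1] := small _ (divr_gt0 gap0 (ltr0n R 2)).
have [T2 T20 H2] := energy_vanishes N2 p1 sol wM E0 (divr_gt0 small_energy_gt0 (ltr0n R 2)).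
have se0 := small_energy_gt0.
have qge T : 0 <= T -> T <= qf 1 T by move=> T0; rewrite /qf; fnra.
have [l0|l0] := leP 0 lam.
  pose T := T1 + T2 + (gap N lam)^-1.
  have gi : 0 < (gap N lam)^-1 by rewrite invr_gt0.
  have [H|] := pselect (forall y, T <= y -> mder N y (w y) (z y) <= 0).
    left; apply: (@fast_decay_of_mder _ _ N2 _ _ _ _ _ sol T) => //.
    - by rewrite /T; flra.
    - by apply: le_trans (qge T _); rewrite /T; flra.
    - by move=> y Ty; apply: H1; rewrite /T in Ty; flra.
  move=> /existsNP[y /not_implyP[Ty /negP]]; rewrite -ltNge => my.
  right; exists y; first by rewrite /T in Ty; flra.
  right; split => //.
    by have [] := H2 y _; [rewrite /T in Ty; flra|flra].
  by apply: le_trans (qge y _); rewrite /T in Ty; flra.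
have [T3 T30 H3] := small (- lam / 2) ltac:(by rewrite divr_gt0// oppr_gt0).
pose T := T1 + T3 + (gap N lam)^-1 + (- lam)^-1.
have gi : 0 < (gap N lam)^-1 by rewrite invr_gt0.
have li : 0 < (- lam)^-1 by rewrite invr_gt0 oppr_gt0.
left; apply: (@fast_decay_of_mder _ _ N2 _ _ _ _ _ sol T) => //.
- by rewrite /T; flra.
- by apply: le_trans (qge T _); rewrite /T; flra.
- by move=> y Ty; apply: H1; rewrite /T in Ty; flra.
move=> y Ty; have Ty' : T1 + T3 + (gap N lam)^-1 + (- lam)^-1 <= y by [].
apply: (mder_not_pos N2 p1 sol wM) => //.
- by flra.
- by apply: le_trans (qge y _); flra.
- by move=> x yx; apply: H3; flra.
Qed.

End dichotomy.

(** * Shooting *)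

Section sign_changes.
Context {R : realType}.
Implicit Types (u v w z : R -> R) (s t x y m B T : R).

(** Alternating signs at k + 1 points instead of k zeros: this survives small perturbations without
    any simplicity of zeros. *)
Definition sign_changes k u := exists y : nat -> R,
  (forall i, (i <= k)%N -> 0 <= y i) /\
  (forall i, (i < k)%N -> y i < y i.+1 /\ u (y i) * u (y i.+1) < 0).

(** Quantitative form: with the margin m, any function within m of u on [0, T] alternates at the
    same points. *)
Definition strong_sign_changes k m T u := exists y : nat -> R,
  (forall i, (i <= k)%N -> 0 <= y i <= T /\ m <= `|u (y i)|) /\
  (forall i, (i < k)%N -> y i < y i.+1 /\ u (y i) * u (y i.+1) < 0).

Lemma continuous_bounded u T : 0 <= T -> continuous u ->
  exists2 B, 0 < B & forall s, 0 <= s <= T -> `|u s| <= B.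
Proof.
move=> T0 cu.
have [|c cT H] := @evt_max _ (fun s => `|u s|) 0 T T0.
  by move=> x _; apply: (@continuous_comp _ _ _ u (fun x => `|x|));
    [exact: cu|exact: norm_continuous].
by exists (`|u c| + 1) => [|s /H h]; [rewrite ltr_wpDl|lra].
Qed.

Lemma interior_max_derive u z (a b c : R) : a < c < b ->
  (forall t, a <= t <= b -> u t <= u c) -> has_derive c 1 u (z c) ->
  (forall t, has_derive t 1 u (z t)) -> z c = 0.
Proof.
move=> /andP[ac cb] H [_ zE] du.
have cab : c \in `]a, b[ by rewrite in_itv /= ac cb.
have [] := @derive1_at_max _ u a b c (ltW (lt_trans ac cb)) _ cab _.
- by move=> t _; case: (du t).
- by move=> t; rewrite in_itv /= => /andP[ta tb]; apply: H; rewrite !ltW.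
by rewrite zE.
Qed.

Lemma no_zero_same_sign u x y : continuous u -> x <= y ->
  (forall t, x <= t -> u t != 0) -> 0 < u x * u y.
Proof.
move=> cu xy u0; rewrite ltNge; apply/negP => h.
have [c /andP[xc _] uc] := @ivt0 _ u x y xy (fun t _ => cu t) h.
by have := u0 c xc; rewrite uc eqxx.
Qed.

(** Beyond T the sign is constant, so only the last point can lie there, and it may be moved to
    T. *)
Lemma sign_changes_before k u T : continuous u -> 0 <= T ->
  (forall t, T <= t -> u t != 0) -> sign_changes k u ->
  exists y : nat -> R, (forall i, (i <= k)%N -> 0 <= y i <= T) /\
  (forall i, (i < k)%N -> y i < y i.+1 /\ u (y i) * u (y i.+1) < 0).
Proof.
move=> cu T0 uT [y [y0 yS]].
have yT i : (i < k)%N -> y i < T.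
  move=> ik; have [yy uy] := yS i ik.
  rewrite ltNge; apply/negP => Ty.
  have := @no_zero_same_sign u (y i) (y i.+1) cu (ltW yy) _.
  by move=> h; have := h (fun t ht => uT t (le_trans Ty ht)); lra.
exists (fun i => Num.min (y i) T); split.
  by move=> i ik; rewrite le_min y0// T0 ge_min lexx orbT.
move=> i ik; have [yy uy] := yS i ik; have yiT := yT i ik.
rewrite (min_l (ltW yiT)).
have [le|lt] := leP (y i.+1) T; first by rewrite yy uy.
split => //.
have := @no_zero_same_sign u T (y i.+1) cu (ltW lt) uT; nra.
Qed.

(* Between two consecutive zeros the extremum is a critical point, where the
   lower bound on the phase is a lower bound on [u]. *)
Lemma strong_sign_changes_of k u z m T : 0 < T -> 0 < m ->
  (forall t, has_derive t 1 u (z t)) ->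
  (forall t, T <= t -> u t != 0) -> m <= `|u T| ->
  (forall t, 0 <= t <= T -> m ^+ 2 <= qf 1 t * z t ^+ 2 + u t ^+ 2) ->
  sign_changes k u -> strong_sign_changes k m T u.
Proof.
move=> T0 m0 du uT mT ph S.
have cu : continuous u by move=> t; exact: is_derive_continuous (du t).
case: k S => [_|k S].
  by exists (fun=> T); split => // i _; rewrite mT (ltW T0) lexx.
have [y [yT yS]] := sign_changes_before cu (ltW T0) uT S.
have uy0 i : (i <= k.+1)%N -> u (y i) != 0.
  rewrite leq_eqVlt => /orP[/eqP ->|ik].
    by have [_] := yS k (ltnSn k); apply: contraTneq => ->; rewrite mulr0 ltxx.
  by have [_] := yS i ik; apply: contraTneq => ->; rewrite mul0r ltxx.
move: (k.+1) yT yS uy0 => {S}k yT yS uy0.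
have /choice[xi Hxi] i : exists c, (i < k)%N -> y i < c < y i.+1 /\ u c = 0.
  have [ik|_] := boolP (i < k)%N; last by exists 0.
  have [yy uy] := yS i ik.
  have [c /andP[c1 c2] uc] := @ivt0 _ u _ _ (ltW yy) (fun t _ => cu t) (ltW uy).
  exists c => _; split => //; rewrite !lt_neqAle c1 c2 !andbT.
  by apply/andP; split; apply: contraTneq uy => E; [rewrite E uc mul0r ltxx|rewrite -E uc mulr0 ltxx].
(* [lo i, hi i] lies between consecutive zeros [xi], with 0 and T at the two extremes; the new i-th
   point is where |u|, with the sign of [u (y i)], is maximal on it. *)
pose lo i := if i is j.+1 then xi j else 0.
pose hi i := if (i < k)%N then xi i else T.
have loy i : (i <= k)%N -> 0 <= lo i <= y i.
  case: i => [|j] ik /=; first by rewrite lexx; have /andP[] := yT 0%N ik.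
  have [/andP[h1 h2] _] := Hxi j ik; have /andP[h3 _] := yT j (ltnW ik); lra.
have yhi i : (i <= k)%N -> y i <= hi i <= T.
  move=> ik; rewrite /hi; case: ifPn => ik'.
    have [/andP[h1 h2] _] := Hxi i ik'; have /andP[_ h3] := yT i.+1 ik'; lra.
  by rewrite lexx andbT; have /andP[] := yT i ik.
have /choice[c Hc] i : exists c, (i <= k)%N ->
   [/\ lo i <= c <= hi i, m <= `|u c| & 0 < u (y i) * u c].
  have [ik|_] := boolP (i <= k)%N; last by exists 0.
  have /andP[lo0 ly] := loy i ik; have /andP[yh hT] := yhi i ik.
  pose sg := u (y i).
  have sg0 : sg != 0 by exact: uy0.
  have [c cI H] := @evt_max _ (fun t => sg * u t) (lo i) (hi i) (le_trans ly yh)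
    (fun t _ => cvgM (@cvg_cst _ _ _ _ _) (cu t)).
  have pos : 0 < sg * u c.
    have p0 : 0 < sg * u (y i).
      by rewrite -/sg -expr2 lt_neqAle eq_sym sqrf_eq0 sg0 sqr_ge0.
    by apply: lt_le_trans p0 (H (y i) _); rewrite ly yh.
  exists c => _; split => //.
  have uc0 : u c != 0 by apply: contraTneq pos => ->; rewrite mulr0 ltxx.
  have sq : m ^+ 2 <= u c ^+ 2 -> m <= `|u c|.
    by rewrite -[u c ^+ 2]real_normK ?num_real// ler_pXn2r ?nnegrE ?(ltW m0).
  move/andP: (cI) => [lc ch].
  have cIT : 0 <= c <= T by rewrite (le_trans lo0 lc) (le_trans ch hT).
  (* At 0 the weight [qf] vanishes, and at T the bound is assumed. Otherwise c is interior, since u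
     vanishes at the zeros [xi], and there z c = 0. *)
  have [c0|c0] := eqVneq c 0.
    by apply: sq; have := ph c cIT; rewrite c0 /qf !mul0r add0r.
  have [cT|cT] := eqVneq c T; first by rewrite cT.
  have lc' : lo i < c.
    rewrite lt_neqAle lc andbT; move: ik lc H cI; rewrite /lo; case: (i) => [|j] ik _ _ _.
      by rewrite eq_sym.
    by apply: contraNneq uc0 => <-; have [_ ->] := Hxi j ik.
  have ch' : c < hi i.
    rewrite lt_neqAle ch andbT /hi; case: ifPn => ik'; last exact: cT.
    by apply: contraNneq uc0 => ->; have [_ ->] := Hxi i ik'.
  have d (c' : R) : has_derive c' 1 (fun t => sg * u t) (sg * z c').
    apply: is_deriveE.
      by apply: is_deriveME; [exact: is_derive_cstE|exact: du].
    by rewrite /=; ring.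
  have := @interior_max_derive (fun t => sg * u t) (fun t => sg * z t) (lo i) (hi i) c.
  rewrite lc' ch' => /(_ isT H (d c) d) /eqP; rewrite mulf_eq0 (negbTE sg0) /= => /eqP zc.
  by apply: sq; have := ph c cIT; rewrite zc expr0n /= mulr0 add0r.
exists c; split.
  move=> i ik; have [/andP[c1 c2] c3 _] := Hc i ik.
  have /andP[l1 l2] := loy i ik; have /andP[h1 h2] := yhi i ik.
  by split => //; lra.
move=> i ik; have [/andP[_ c2] c3 s1] := Hc i (ltnW ik).
have [/andP[c4 _] _ s2] := Hc i.+1 ik.
have [_ uy] := yS i ik; have [_ uxi] := Hxi i ik.
split.
  move: c2 c4; rewrite /hi ik /lo => c2 c4.
  rewrite lt_neqAle (le_trans c2 c4) andbT; apply: contraTneq c3 => E.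
  have -> : c i = xi i by apply/eqP; rewrite eq_le c2 E c4.
  by rewrite uxi normr0 -ltNge.
have a1 : 0 < (u (y i) * u (c i)) * (u (y i.+1) * u (c i.+1)) by rewrite mulr_gt0.
have E : (u (y i) * u (c i)) * (u (y i.+1) * u (c i.+1)) =
  (u (y i) * u (y i.+1)) * (u (c i) * u (c i.+1)) by ring.
by move: a1; rewrite E nmulr_rgt0.
Qed.

Lemma strong_sign_changes_close k m T u v : 0 < m ->
  (forall t, 0 <= t <= T -> `|u t - v t| < m) ->
  strong_sign_changes k m T u -> sign_changes k v.
Proof.
move=> m0 uv [y [yT yS]]; exists y; split.
  by move=> i /yT[/andP[]].
have same i : (i <= k)%N -> 0 < u (y i) * v (y i).
  move=> ik; have [yi mi] := yT i ik; have := uv _ yi.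
  by move: mi; case: (ger0P (u (y i))) => ui mi; rewrite ltr_norml => /andP[]; nra.
move=> i ik; have [yy uy] := yS i ik; split => //.
have s1 := same i (ltnW ik); have s2 := same i.+1 ik.
have a1 := mulr_gt0 s1 s2.
have E : u (y i) * v (y i) * (u (y i.+1) * v (y i.+1)) =
  (u (y i) * u (y i.+1)) * (v (y i) * v (y i.+1)) by ring.
by move: a1; rewrite E nmulr_rgt0.
Qed.

(** Each sign change is a variation of at least 2 m at slope at most B, hence takes a length of at
    least 2 m / B. *)
Lemma strong_sign_changes_bound k m T B u z : 0 < m -> 0 <= T -> 0 < B ->
  (forall t, has_derive t 1 u (z t)) -> (forall t, 0 <= t <= T -> `|z t| <= B) ->
  strong_sign_changes k m T u -> k%:R * (2 * m / B) <= T.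
Proof.
move=> m0 T0 B0 du zB [y [yT yS]].
suff H i : (i <= k)%N -> i%:R * (2 * m / B) <= y i.
  by apply: le_trans (H k (leqnn k)) _; have [/andP[]] := yT k (leqnn k).
elim: i => [|i IH] ik; first by rewrite mul0r; have [/andP[]] := yT 0%N ik.
have [/andP[y0 y1] my] := yT i (ltnW ik); have [/andP[y2 y3] my'] := yT i.+1 ik.
have [yy uy] := yS i ik.
have h : `|u (y i.+1) - u (y i)| <= B * y i.+1 - B * y i.
  have := @derive_normr_le _ u z (fun t => B * t) (fun=> B) _ _ (ltW yy); apply.
  - by move=> x _; exact: is_derive_continuous (du x).
  - by move=> x _; apply: cvgM; [exact: cvg_cst|exact: cvg_id].
  - by move=> x _; exact: du.
  - move=> x _; apply: is_deriveE.
      by apply: is_deriveME; [exact: is_derive_cstE|exact: is_derive_idE].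
    by rewrite /=; ring.
  - by move=> x /andP[x1 x2]; apply: zB; flra.
have h2 : 2 * m <= `|u (y i.+1) - u (y i)|.
  move: my my' uy; case: (ger0P (u (y i))); case: (ger0P (u (y i.+1)));
    case: (ger0P (u (y i.+1) - u (y i))) => *; fnra.
have h3 : 2 * m / B <= y i.+1 - y i by rewrite ler_pdivrMr//; flra.
have := IH (ltnW ik); rewrite -natr1 mulrDl mul1r; flra.
Qed.

(** Connectedness of [a, b]: the supremum of the points where P fails belongs to them and can be
    neither b nor smaller. *)
Lemma locally_constant_prop (P : R -> Prop) (a b : R) : a <= b ->
  (forall x, a <= x <= b -> exists2 d : R, 0 < d &
     forall y, a <= y <= b -> `|y - x| < d -> (P y <-> P x)) -> P b -> P a.
Proof.
move=> ab loc Pb; apply: contrapT => Pa.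
pose S := [set x | a <= x <= b /\ ~ P x].
have hS : has_sup S.
  by split; [exists a; split; [rewrite lexx|]|exists b => x [/andP[]]].
pose s := sup S.
have sa : a <= s by apply: ub_le_sup; [case: hS|split; [rewrite lexx|]].
have sb : s <= b by apply: ge_sup; [exists a; split; [rewrite lexx|]|move=> x [/andP[]]].
have sab : a <= s <= b by rewrite sa sb.
have [d d0 H] := loc s sab.
have [x [xab Px] xs] := sup_adherent d0 hS.
have xs' : x <= s by apply: ub_le_sup; [case: hS|].
have Ps : ~ P s.
  move=> Ps; apply: Px; apply/(H x xab) => //.
  by rewrite ler0_norm ?subr_le0// -/s in xs *; lra.
have [E|sb'] := eqVneq s b; first by apply: Ps; rewrite E.
pose y := Num.min b (s + d / 2).
have sy : s < y by rewrite lt_min lt_neqAle sb' sb ltrDl divr_gt0.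
have yb : y <= b by rewrite ge_min lexx.
have yd : y <= s + d / 2 by rewrite ge_min lexx orbT.
have yab : a <= y <= b by rewrite yb (le_trans sa (ltW sy)).
have yS : S y.
  split => // Py; apply: Ps; apply/(H y yab) => //.
  by rewrite gtr0_norm ?subr_gt0//; lra.
have : y <= s by apply: ub_le_sup; [case: hS|].
by rewrite leNgt sy.
Qed.

End sign_changes.

(** * The rescaled family and its Euclidean limit *)

Section shooting.
Context {R : realType} (N : nat) (N2 : (2 <= N)%N) (p lam : R) (p1 : 1 < p).
Hypothesis pN : (2 < N)%N -> p < (N%:R + 2) / (N%:R - 2).
Hypothesis gap0 : 0 < gap N lam.
Implicit Types (w z : R -> R) (e s t u v x y alpha K B L M T C eta : R).

Lemma has_derive_nonlin (mu u : R) :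
  has_derive u 1 (nonlin p mu) (mu + p * `|u| `^ (p - 1)).
Proof.
apply: is_deriveE.
  apply: is_deriveDE; last exact: has_derive_spow.
  by apply: is_deriveME; [exact: is_derive_cstE|exact: is_derive_idE].
by rewrite /=; ring.
Qed.

Lemma continuous_nonlin (mu : R) : continuous (nonlin p mu).
Proof. by move=> u; exact: is_derive_continuous (has_derive_nonlin mu u). Qed.

Lemma nonlin_lipschitz (mu M : R) : 0 <= M -> exists2 L, 0 < L &
  forall u v, `|u| <= M -> `|v| <= M -> `|nonlin p mu u - nonlin p mu v| <= L * `|u - v|.
Proof.
have p1_ := p1; move=> M0; exists (1 + `|mu| + p * M `^ (p - 1)).
  have : 0 <= p * M `^ (p - 1) by rewrite mulr_ge0 ?powR_ge0//; lra.
  by have := normr_ge0 mu; lra.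
apply: (lipschitz_of_derive (has_derive_nonlin mu)).
move=> u uM; apply: le_trans (ler_normD _ _) _.
have h : `|u| `^ (p - 1) <= M `^ (p - 1).
  by rewrite -[in leRHS](ger0_norm M0); apply: ler_powR_norm; [lra|rewrite (ger0_norm M0)].
have h2 : p * `|u| `^ (p - 1) <= p * M `^ (p - 1) by rewrite ler_pM2l//; lra.
have h3 : 0 <= p * `|u| `^ (p - 1) by rewrite mulr_ge0 ?powR_ge0//; lra.
by rewrite (ger0_norm h3); lra.
Qed.

Lemma nonlin0 (mu : R) : nonlin p mu 0 = 0.
Proof. by rewrite /nonlin /spow !mulr0 addr0. Qed.

(** With initial value 1 the interval [-2, 2] is an energy trap: as [spow p 2] >= 2, the potential
    at 2 and -2 exceeds that at 1 by at least 3/2 (e lam + 2 / (p+1)). *)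
Lemma scaled_sol_exists e : 0 <= e -> e * `|lam| < 2 / (p + 1) ->
  exists wz : (R -> R) * (R -> R),
    radial_sol N e (nonlin p (e * lam)) 1 wz.1 wz.2 /\
    forall s, 0 <= s -> `|wz.1 s| <= 2.
Proof.
have p1_ := p1; move=> e0 el.
have [L L0 HL] := @nonlin_lipschitz (e * lam) 2 (ler0n R 2).
have sp2 : 2 <= spow p 2 :> R.
  rewrite /spow ger0_norm// ler_peMl// -[X in X <= _](powRr0 2).
  by apply: ler_powR; lra.
have elb : - (2 / (p + 1)) < e * lam.
  have : `|e * lam| < 2 / (p + 1) by rewrite normrM (ger0_norm e0).
  by rewrite ltr_norml => /andP[].
have sp1 : spow p 1 = 1 :> R by rewrite /spow normr1 powR1 mulr1.
have q1 : 4 / (p + 1) <= 2 * spow p 2 / (p + 1).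
  by rewrite ler_pM2r ?invr_gt0; lra.
have G12 : nonlin_prim p (e * lam) 1 < nonlin_prim p (e * lam) 2.
  rewrite /nonlin_prim sp1 expr1n.
  have -> : 1 * 1 / (p + 1) = (2 / (p + 1)) / 2 by field; lra.
  have q2 : 4 / (p + 1) = 2 * (2 / (p + 1)) by ring.
  have q0 : 0 < 2 / (p + 1) by rewrite divr_gt0//; lra.
  by lra.
have G1N : nonlin_prim p (e * lam) 1 < nonlin_prim p (e * lam) (- 2).
  by rewrite /nonlin_prim spowN sqrrN mulrNN.
have [||w [z [sol wM]]] := @radial_sol_bounded _ N N2 e (nonlin p (e * lam))
  (nonlin_prim p (e * lam)) 1 2 L e0 L0 _ _ HL G12 G1N.
- by rewrite normr1 ltr1n.
- exact: has_derive_nonlin_prim.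
by exists (w, z).
Qed.

(** The choice of e makes spow p (alpha x) = (alpha / e) spow p x, so the power and the operator
    scale alike and only the linear term shrinks, to e lam. *)
Lemma rescale_sol e alpha w z : 0 < alpha -> e = alpha `^ (1 - p) ->
  radial_sol N e (nonlin p (e * lam)) 1 w z ->
  radial_sol N 1 (nonlin p lam) alpha (fun y => alpha * w (y / e))
    (fun y => alpha / e * z (y / e)).
Proof.
move=> al0 eE [w0 dw cz z0 dz].
have e0 : 0 < e by rewrite eE powR_gt0.
have N0 : N%:R != 0 :> R by rewrite pnatr_eq0; case: N N2.
have se x : spow p (alpha * x) = alpha / e * spow p x.
  rewrite /spow normrM (gtr0_norm al0) powRM ?(ltW al0)//.
  have -> : alpha `^ (p - 1) = e^-1.
    by rewrite eE -powRN; congr (_ `^ _); ring.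
  by ring.
have dl (y : R) : has_derive y 1 (fun y => y / e) e^-1.
  apply: is_deriveE.
    by apply: is_deriveME; [exact: is_derive_idE|exact: is_derive_cstE].
  by rewrite /=; ring.
split.
- by rewrite mul0r w0 mulr1.
- move=> y; apply: is_deriveE.
    apply: is_deriveME; first exact: is_derive_cstE.
    by apply: (@is_derive_compE _ _ w (fun y => y / e)); [exact: dw|exact: dl].
  by rewrite /=; ring.
- move=> y; apply: cvgM; first exact: cvg_cst.
  apply: (@continuous_comp _ _ _ (fun y => y / e) z); last exact: cz.
  exact: is_derive_continuous (dl y).
- rewrite mul0r z0 /nonlin -{2 3}[alpha]mulr1 se; field.
  by rewrite N0 gt_eqF.
move=> y y0; apply: is_deriveE.
  apply: is_deriveME; first exact: is_derive_cstE.
  apply: (@is_derive_compE _ _ z (fun y => y / e)); last exact: dl.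
  by apply: dz; rewrite divr_gt0.
rewrite /nonlin se /qf /=; field.
by rewrite !gt_eqF//; lra.
Qed.

Definition eps_max : R := 1 / (p + 1) / (`|lam| + 1).

Lemma eps_max_gt0 : 0 < eps_max.
Proof.
have p1_ := p1; rewrite /eps_max; apply: divr_gt0; last by rewrite ltr_wpDl.
by apply: divr_gt0; lra.
Qed.

Lemma eps_maxP e : 0 <= e <= eps_max -> e * `|lam| < 2 / (p + 1).
Proof.
have p1_ := p1; have p0 : 0 < (p + 1)^-1 by rewrite invr_gt0; lra.
move=> /andP[e0 em].
have : eps_max * (`|lam| + 1) = (p + 1)^-1.
  by rewrite /eps_max divfK ?mul1r// gt_eqF// ltr_wpDl.
have : e * (`|lam| + 1) <= eps_max * (`|lam| + 1) by rewrite ler_wpM2r// addr_ge0.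
by lra.
Qed.

Lemma sol_family : exists W Z : R -> R -> R, forall e, 0 <= e <= eps_max ->
  radial_sol N e (nonlin p (e * lam)) 1 (W e) (Z e) /\
  forall s, 0 <= s -> `|W e s| <= 2.
Proof.
have /choice[F HF] e : exists wz : (R -> R) * (R -> R), 0 <= e <= eps_max ->
    radial_sol N e (nonlin p (e * lam)) 1 wz.1 wz.2 /\
    forall s, 0 <= s -> `|wz.1 s| <= 2.
  have [eI|_] := boolP (0 <= e <= eps_max); last by exists (fun=> 0, fun=> 0).
  have [wz H] := scaled_sol_exists (proj1 (andP eI)) (eps_maxP eI).
  by exists wz.
by exists (fun e => (F e).1), (fun e => (F e).2).
Qed.

Lemma finite_common_radius (Q : nat -> R -> Prop) :
  (forall i, exists2 d : R, 0 < d & forall e, 0 <= e <= d -> Q i e) ->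
  forall k, exists2 d : R, 0 < d & forall i, (i < k)%N -> forall e, 0 <= e <= d -> Q i e.
Proof.
move=> H; elim=> [|k [d1 d10 H1]]; first by exists 1.
have [d2 d20 H2] := H k; exists (Num.min d1 d2); first by rewrite lt_min d10.
move=> i; rewrite ltnS leq_eqVlt => /orP[/eqP ->|ik] e; rewrite le_min => /and3P[e0 e1 e2].
  by apply: H2; rewrite e0.
by apply: H1 => //; rewrite e0.
Qed.

Section family.
Variables (W Z : R -> R -> R).
Hypothesis WZ : forall e, 0 <= e <= eps_max ->
  radial_sol N e (nonlin p (e * lam)) 1 (W e) (Z e) /\
  forall s, 0 <= s -> `|W e s| <= 2.

Let em0 : 0 <= (0 : R) <= eps_max.
Proof. by rewrite lexx ltW// eps_max_gt0. Qed.

Lemma family_dist0 T : 0 <= T -> exists2 K, 0 < K &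
  forall e s, 0 <= e <= eps_max -> 0 <= s <= T ->
    qf e s * (Z e s - Z 0 s) ^+ 2 + (W e s - W 0 s) ^+ 2 <= K * e ^+ 2.
Proof.
move=> T0; have [sol0 W0M] := WZ em0.
have [_ _ cZ0 _ _] := sol0; have cW0 := radial_sol_continuous sol0.
have [B1 B10 HB1] := continuous_bounded T0 cZ0.
have cn : continuous (fun s => nonlin p (0 * lam) (W 0 s)).
  by apply: continuous_comp_all => //; exact: continuous_nonlin.
have [B2 B20 HB2] := continuous_bounded T0 cn.
have [L L0 HL] := @nonlin_lipschitz 0 2 (ler0n R 2).
pose L1 := L + eps_max * `|lam|.
have em := eps_max_gt0.
have L10 : 0 <= L1.
  by apply: addr_ge0; [exact: ltW|apply: mulr_ge0 => //; exact: ltW].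
pose B := B1 + B2.
pose C := T * (B * (N%:R * (0 * T + 1) + 1)) + N%:R * T * B.
pose K := expR ((L1 + 1) ^+ 2 * T) * (2 * `|lam| + C) ^+ 2 + 1.
exists K; first by rewrite ltr_wpDl// mulr_ge0 ?expR_ge0 ?sqr_ge0.
move=> e s eI sT; have [sole WeM] := WZ eI; have /andP[e0 ele] := eI.
have B0 : 0 <= B by rewrite /B; flra.
have gL u v : `|u| <= 2 -> `|v| <= 2 ->
    `|nonlin p (e * lam) u - nonlin p (e * lam) v| <= L1 * `|u - v|.
  move=> u2 v2; have := HL u v u2 v2.
  have -> : nonlin p (e * lam) u - nonlin p (e * lam) v =
    (nonlin p 0 u - nonlin p 0 v) + e * lam * (u - v) by rewrite /nonlin; ring.
  move=> h; apply: le_trans (ler_normD _ _) _; rewrite /L1 mulrDl lerD//.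
  by rewrite !normrM (ger0_norm e0) ler_wpM2r// ler_wpM2r.
have gd u : `|u| <= 2 -> `|nonlin p (e * lam) u - nonlin p (0 * lam) u| <= e * `|lam| * 2.
  move=> u2; have -> : nonlin p (e * lam) u - nonlin p (0 * lam) u = e * lam * u.
    by rewrite /nonlin; ring.
  by rewrite !normrM (ger0_norm e0) ler_wpM2l// mulr_ge0.
have zB t : 0 <= t <= T -> `|Z 0 t| <= B /\ `|nonlin p (0 * lam) (W 0 t)| <= B.
  by move=> tT; have := HB1 t tT; have := HB2 t tT; rewrite /B; flra.
have d0 : 0 <= e * `|lam| * 2 by rewrite !mulr_ge0.
have := @radial_sol_dist _ N N2 e 0 _ _ 1 1 _ _ _ _ T L1 2 B (e * `|lam| * 2) e0
  (lexx 0) L10 T0 B0 d0 sole sol0 _ _ gL gd zB s sT.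
rewrite -/C subrr expr0n /= add0r subr0 (ger0_norm e0) => h.
apply: le_trans (h _ _) _.
- by move=> t /andP[t0 _]; exact: WeM.
- by move=> t /andP[t0 _]; exact: W0M.
have -> : e * `|lam| * 2 + e * C = (2 * `|lam| + C) * e by ring.
rewrite exprMn mulrA; apply: ler_wpM2r; first exact: sqr_ge0.
by rewrite /K lerDl.
Qed.

Lemma family_cvg0 s (d : R) : 0 <= s -> 0 < d -> exists2 e1, 0 < e1 &
  forall e, 0 <= e <= e1 -> e <= eps_max -> `|W e s - W 0 s| < d.
Proof.
move=> s0 d0; have [K K0 HK] := family_dist0 s0.
exists (d / (Num.sqrt K + 1)); first by rewrite divr_gt0// ltr_wpDl// sqrtr_ge0.
move=> e /andP[e0 e1] em.
have sI : 0 <= s <= s by rewrite s0 lexx.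
have eI : 0 <= e <= eps_max by rewrite e0.
have h1 := HK e s eI sI.
have h2 : 0 <= qf e s * (Z e s - Z 0 s) ^+ 2.
  by rewrite mulr_ge0 ?sqr_ge0// qf_ge0.
have sK : 0 < Num.sqrt K by rewrite sqrtr_gt0.
have h3 : `|W e s - W 0 s| <= Num.sqrt K * e.
  rewrite -(@ler_pXn2r _ 2) ?nnegrE ?mulr_ge0 ?sqrtr_ge0//.
  by rewrite real_normK ?num_real// exprMn sqr_sqrtr ?(ltW K0)//; lra.
move: e1; rewrite ler_pdivlMr; last lra.
move=> e1; have [e00|e00] := eqVneq e 0.
  by rewrite e00 subrr normr0.
have : 0 < e by rewrite lt_neqAle eq_sym e00.
by lra.
Qed.

(** [emden_fowler_neg] is iterated, on the solution or on its opposite according to the current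
    sign. *)
Lemma limit_sign_changes k : sign_changes k (W 0).
Proof.
have [sol0 _] := WZ em0; rewrite mul0r in sol0.
have p1_ := p1.
have /choice[f Hf] T : exists y, 0 <= T -> W 0 T != 0 -> T < y /\ W 0 T * W 0 y < 0.
  have [T0|_] := boolP (0 <= T); last by exists 0.
  have [W0|W0|W0] := ltgtP (W 0 T) 0; last by exists 0.
    have nW : 0 < - W 0 T by rewrite oppr_gt0.
    have n1 : - 1 != 0 :> R by rewrite oppr_eq0 oner_eq0.
    have [y Ty wy] := emden_fowler_neg N2 p1 pN n1 (radial_sol_opp sol0) T0 nW.
    by exists y => _ _; split => //; nra.
  have [y Ty wy] := emden_fowler_neg N2 p1 pN (oner_neq0 R) sol0 T0 W0.
  by exists y => _ _; split => //; nra.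
pose y i := iter i f 0.
have H i : 0 <= y i /\ W 0 (y i) != 0.
  elim: i => [|i [y0 wy]]; first by rewrite /y /=; case: sol0 => ->; rewrite oner_neq0.
  have [h1 h2] := Hf _ y0 wy; split; first by rewrite /y /= -/(y i); lra.
  by apply: contraTneq h2 => E; rewrite [W 0 (f _)]E mulr0 ltxx.
exists y; split => i _; first by have [] := H i.
by have [h1 h2] := H i; exact: Hf.
Qed.

Lemma near_limit_sign_changes k : exists2 e1, 0 < e1 &
  forall e, 0 <= e <= e1 -> e <= eps_max -> sign_changes k (W e).
Proof.
have [y [y0 yS]] := limit_sign_changes k.
have [d d0 Hd] : exists2 d : R, 0 < d & forall i, (i < k)%N -> forall e, 0 <= e <= d ->
    e <= eps_max -> W e (y i) * W e (y i.+1) < 0.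
  have := @finite_common_radius (fun i e => (i < k)%N -> e <= eps_max ->
    W e (y i) * W e (y i.+1) < 0).
  move=> H; have {H} [i|d d0 Hd] := H _ k; last by exists d => // i ik e eI em; exact: Hd.
  have [ik|ik] := boolP (i < k)%N; last by exists 1.
  have [_ wy] := yS i ik.
  have w1 : W 0 (y i) != 0 by apply: contraTneq wy => ->; rewrite mul0r ltxx.
  have w2 : W 0 (y i.+1) != 0 by apply: contraTneq wy => ->; rewrite mulr0 ltxx.
  have [e1 e10 H1] := @family_cvg0 (y i) `|W 0 (y i)| (y0 i (ltnW ik)) ltac:(by rewrite normr_gt0).
  have [e2 e20 H2] := @family_cvg0 (y i.+1) `|W 0 (y i.+1)| (y0 _ ik) ltac:(by rewrite normr_gt0).
  exists (Num.min e1 e2); first by rewrite lt_min e10.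
  move=> e; rewrite le_min => /and3P[e0 ee1 ee2] _ em.
  have same (a b : R) : `|a - b| < `|b| -> 0 < b * a.
    by case: (ger0P b) => ?; rewrite ltr_norml => /andP[]; nra.
  have s1 := same _ _ (H1 e _ em); have s2 := same _ _ (H2 e _ em).
  have a1 := mulr_gt0 (s1 ltac:(by rewrite e0)) (s2 ltac:(by rewrite e0)).
  have E : W 0 (y i) * W e (y i) * (W 0 (y i.+1) * W e (y i.+1)) =
    (W 0 (y i) * W 0 (y i.+1)) * (W e (y i) * W e (y i.+1)) by ring.
  by move: a1; rewrite E nmulr_rgt0.
exists d => // e eI em; exists y; split => // i ik.
by have [yy _] := yS i ik; split => //; exact: Hd.
Qed.

(** The limit has slope -1 / N at 0, hence at least 1 / (2 N) in size on some [0, s2]. The phase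
    controls [Z e] only where [qf] is bounded below, whence the window starts at s1 > 0. After
    rescaling, this window carries the divergence of the norm. *)
Lemma near_limit_gradient : exists c s1 s2 e1, [/\ 0 < c, 0 < s1, s1 < s2, 0 < e1 &
  forall e s, 0 <= e <= e1 -> e <= eps_max -> s1 <= s <= s2 -> c <= `|Z e s|].
Proof.
have [sol0 _] := WZ em0.
have N1 : 2 <= N%:R :> R by rewrite ler_nat.
have [_ _ cZ Z0 _] := sol0.
have Z00 : Z 0 0 = - N%:R^-1.
  by rewrite Z0 /nonlin !mul0r add0r /spow normr1 powR1 mulr1 mulNr mul1r.
pose b : R := N%:R^-1; have b0 : 0 < b by rewrite invr_gt0; lra.
have /cvgrPdist_lt /(_ _ (divr_gt0 b0 (ltr0n R 2))) /nbhs_ballP[r /= r0 Hr] := cZ 0.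
pose s2 := r / 2; have s20 : 0 < s2 by rewrite divr_gt0.
have Zs s : 0 <= s <= s2 -> b / 2 <= `|Z 0 s|.
  move=> /andP[s0 ss]; have /Hr : ball 0 r s.
    by rewrite /ball /= sub0r normrN ger0_norm// (le_lt_trans ss)// /s2 ltr_pdivrMr//; flra.
  rewrite /= Z00 -/b => h.
  have := ler_normB (Z 0 s) (Z 0 s + b).
  have -> : Z 0 s - (Z 0 s + b) = - b by ring.
  rewrite normrN (gtr0_norm b0).
  have -> : `|Z 0 s + b| = `|- b - Z 0 s| by rewrite -normrN opprD addrC.
  by flra.
pose s1 := s2 / 2.
have [K K0 HK] := family_dist0 (ltW s20).
pose e1 := b / 4 * Num.sqrt (2 * s1 / K).
have s10 : 0 < s1 by rewrite divr_gt0.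
have e10 : 0 < e1 by rewrite mulr_gt0 ?divr_gt0// sqrtr_gt0 divr_gt0// mulr_gt0.
exists (b / 4), s1, s2, e1; split => //.
- by rewrite divr_gt0.
- by rewrite /s1 ltr_pdivrMr//; flra.
move=> e s /andP[e0 ee1] em /andP[ss1 ss2].
have s0 : 0 < s by flra.
have h := HK e s ltac:(by rewrite e0) ltac:(by rewrite (ltW s0)).
have q1 : 2 * s1 <= qf e s by rewrite /qf; fnra.
have h1 : 2 * s1 * (Z e s - Z 0 s) ^+ 2 <= K * e ^+ 2.
  apply: le_trans h; have := sqr_ge0 (W e s - W 0 s).
  by have := ler_wpM2r (sqr_ge0 (Z e s - Z 0 s)) q1; flra.
have h2 : (Z e s - Z 0 s) ^+ 2 <= (b / 4) ^+ 2.
  have h3 : e ^+ 2 <= (b / 4) ^+ 2 * (2 * s1 / K).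
    have sK : 0 <= 2 * s1 / K by apply: divr_ge0; [apply: mulr_ge0 => //|]; exact: ltW.
    rewrite -(sqr_sqrtr sK) -exprMn -/e1.
    by rewrite lerXn2r ?nnegrE ?(ltW e10).
  have h4 : K * e ^+ 2 <= (b / 4) ^+ 2 * (2 * s1).
    apply: le_trans (ler_wpM2l (ltW K0) h3) _.
    by apply: eq_ler; field; rewrite gt_eqF.
  have := le_trans h1 h4; rewrite mulrC ler_pM2r// mulr_gt0//.
have h5 : `|Z e s - Z 0 s| <= b / 4.
  by rewrite -(@ler_pXn2r _ 2) ?nnegrE ?divr_ge0 ?(ltW b0)// real_normK ?num_real.
have := Zs s ltac:(by rewrite (ltW s0)).
have := ler_normB (Z e s) (Z e s - Z 0 s).
have -> : Z e s - (Z e s - Z 0 s) = Z 0 s by ring.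
by flra.
Qed.

End family.
End shooting.

(** * Fast decaying solutions with large initial value *)

Section fast_solutions.
Context {R : realType} (N : nat) (N2 : (2 <= N)%N) (p lam : R) (p1 : 1 < p).
Hypothesis gap0 : 0 < gap N lam.
Implicit Types (w z : R -> R) (e s t u v x y alpha K B L M T C eta : R).

Section continuity_in_data.
Variables (U Z : R -> R -> R) (A : R).
Hypothesis A0 : 0 < A.
Hypothesis UZ : forall alpha, A <= alpha ->
  radial_sol N 1 (nonlin p lam) alpha (U alpha) (Z alpha) /\
  forall s, 0 <= s -> `|U alpha s| <= 2 * alpha.

Lemma data_dist a T : A <= a -> 0 <= T -> exists2 K, 0 < K &
  forall b s, A <= b -> b <= 2 * a -> 0 <= s <= T ->
    qf 1 s * (Z b s - Z a s) ^+ 2 + (U b s - U a s) ^+ 2 <= K * (b - a) ^+ 2.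
Proof.
have A0_ := A0; move=> Aa T0; have [sola UaM] := UZ Aa.
have [_ _ cZa _ _] := sola; have cUa := radial_sol_continuous sola.
have [B1 B10 HB1] := continuous_bounded T0 cZa.
have cn : continuous (fun s => nonlin p lam (U a s)).
  by apply: continuous_comp_all => //; exact: continuous_nonlin.
have [B2 B20 HB2] := continuous_bounded T0 cn.
have M0 : 0 <= 4 * a by flra.
have [L L0 HL] := nonlin_lipschitz p1 lam M0.
pose B := B1 + B2; have B0 : 0 <= B by rewrite /B; flra.
exists (expR ((L + 1) ^+ 2 * T)); first exact: expR_gt0.
move=> b s Ab ba sT; have [solb UbM] := UZ Ab.
have zB t : 0 <= t <= T -> `|Z a t| <= B /\ `|nonlin p lam (U a t)| <= B.
  by move=> tT; have := HB1 t tT; have := HB2 t tT; rewrite /B; flra.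
have gd u : `|u| <= 4 * a -> `|nonlin p lam u - nonlin p lam u| <= 0.
  by rewrite subrr normr0.
have := @radial_sol_dist _ N N2 1 1 _ _ b a _ _ _ _ T L (4 * a) B 0 ler01
  ler01 (ltW L0) T0 B0 (lexx 0) solb sola _ _ HL gd zB s sT.
rewrite subrr normr0 mul0r addr0 expr0n /= addr0; apply.
- by move=> t /andP[t0 _]; apply: le_trans (UbM t t0) _; flra.
- by move=> t /andP[t0 _]; apply: le_trans (UaM t t0) _; flra.
Qed.

Lemma data_cvg a T (d : R) : A <= a -> 0 <= T -> 0 < d -> exists2 r, 0 < r &
  forall b s, A <= b -> `|b - a| < r -> 0 <= s <= T ->
    qf 1 s * (Z b s - Z a s) ^+ 2 + (U b s - U a s) ^+ 2 < d ^+ 2.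
Proof.
have A0_ := A0; move=> Aa T0 d0; have [K K0 HK] := data_dist Aa T0.
have a0 : 0 < a by lra.
have sK : 0 < Num.sqrt K by rewrite sqrtr_gt0.
exists (Num.min a (d / Num.sqrt K)); first by rewrite lt_min a0 divr_gt0.
move=> b s Ab; rewrite lt_min => /andP[ba bd] sT.
have b2 : b <= 2 * a by move: ba; rewrite ltr_norml => /andP[]; lra.
apply: le_lt_trans (HK b s Ab b2 sT) _.
rewrite -(sqr_sqrtr (ltW K0)) -[(b - a) ^+ 2]real_normK ?num_real// -exprMn.
rewrite ltrXn2r ?nnegrE ?mulr_ge0 ?(ltW sK) ?(ltW d0)//.
by rewrite mulrC -ltr_pdivlMr.
Qed.

Lemma data_cvg_value a T (d : R) : A <= a -> 0 <= T -> 0 < d -> exists2 r, 0 < r &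
  forall b s, A <= b -> `|b - a| < r -> 0 <= s <= T -> `|U b s - U a s| < d.
Proof.
move=> Aa T0 d0; have [r r0 H] := data_cvg Aa T0 d0; exists r => // b s Ab br sT.
have := H b s Ab br sT; have /andP[s0 _] := sT.
have : 0 <= qf 1 s * (Z b s - Z a s) ^+ 2 by rewrite mulr_ge0 ?sqr_ge0 ?qf_ge0.
move=> h1 h2; rewrite -(@ltr_pXn2r _ 2) ?nnegrE ?(ltW d0)//.
by rewrite real_normK ?num_real//; lra.
Qed.

Lemma data_cvg_slope a T (d : R) : A <= a -> 0 < T -> 0 < d -> exists2 r, 0 < r &
  forall b, A <= b -> `|b - a| < r -> `|Z b T - Z a T| < d.
Proof.
move=> Aa T0 d0.
have q0 := qf_gt0 ler01 T0; have sq : 0 < Num.sqrt (qf 1 T) by rewrite sqrtr_gt0.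
have [r r0 H] := data_cvg Aa (ltW T0) (mulr_gt0 d0 sq); exists r => // b Ab br.
have := H b T Ab br; rewrite (ltW T0) lexx => /(_ isT).
rewrite exprMn sqr_sqrtr ?(ltW q0)// => h.
have h2 := sqr_ge0 (U b T - U a T).
rewrite -(@ltr_pXn2r _ 2) ?nnegrE ?(ltW d0)// real_normK ?num_real//.
by rewrite -(ltr_pM2l q0); lra.
Qed.

(* The condition excluding zeros after [T] only involves continuous functions
   of the Cauchy data at [T]. *)
Lemma no_zero_after_open a T : A <= a -> 0 < T ->
  no_zero_after N p lam T (U a T) (Z a T) -> exists2 r, 0 < r &
  forall b, A <= b -> `|b - a| < r -> no_zero_after N p lam T (U b T) (Z b T).
Proof.
move=> Aa T0 H.
have cE : continuous (fun uz : R * R => energy p lam T uz.1 uz.2).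
  move=> uz; apply: cvgD.
    apply: cvgM; last exact: cvg_cst.
    apply: cvgM; first exact: cvg_cst.
    by apply: (@continuous_comp _ _ _ snd (fun x : R => x ^+ 2));
      [exact: cvg_snd|exact: exprn_continuous].
  apply: (@continuous_comp _ _ _ fst (nonlin_prim p lam)); first exact: cvg_fst.
  exact: is_derive_continuous (has_derive_nonlin_prim lam p1 _).
have cM : continuous (fun uz : R * R => mder N T uz.1 uz.2).
  move=> uz; apply: cvgM; first exact: cvg_fst.
  apply: cvgD; first by apply: cvgM; [exact: cvg_cst|exact: cvg_snd].
  by apply: cvgM; [exact: cvg_cst|exact: cvg_fst].
have : \forall uz \near (U a T, Z a T), no_zero_after N p lam T uz.1 uz.2.
  case: H => [E0|[l0 Es m0 gT]].
    have h1 := cvgr_lt _ (cE (U a T, Z a T)) _ E0.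
    by near=> uz; left; near: uz; exact: h1.
  have h1 := cvgr_lt _ (cE (U a T, Z a T)) _ Es.
  have h2 := cvgr_gt _ (cM (U a T, Z a T)) _ m0.
  by near=> uz; right; split => //; [near: uz; exact: h1|near: uz; exact: h2].
move=> /nbhs_ballP[d /= d0 Hd].
have TT : 0 <= T <= T by rewrite (ltW T0) lexx.
have [r1 r10 H1] := data_cvg_value Aa (ltW T0) d0.
have [r2 r20 H2] := data_cvg_slope Aa T0 d0.
exists (Num.min r1 r2); first by rewrite lt_min r10.
move=> b Ab; rewrite lt_min => /andP[b1 b2].
apply: (Hd (U b T, Z b T)); split; rewrite /ball /= distrC; [exact: H1|exact: H2].
Unshelve. all: by end_near.
Qed.

Lemma sign_changes_transfer k a : A <= a -> sign_changes k (U a) ->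
  exists2 r, 0 < r & forall b, A <= b -> `|b - a| < r -> sign_changes k (U b).
Proof.
move=> Aa [y [y0 yS]].
have [d d0 Hd] : exists2 d : R, 0 < d & forall i, (i < k)%N -> forall e, 0 <= e <= d ->
    forall b, A <= b -> `|b - a| < e -> U b (y i) * U b (y i.+1) < 0.
  have := @finite_common_radius R (fun i e => (i < k)%N -> forall b, A <= b ->
    `|b - a| < e -> U b (y i) * U b (y i.+1) < 0).
  move=> H; have {H} [i|d d0 Hd] := H _ k; last by exists d => // i ik e eI b; exact: Hd.
  have [ik|ik] := boolP (i < k)%N; last by exists 1.
  have [_ wy] := yS i ik.
  have w1 : 0 < `|U a (y i)|.
    by rewrite normr_gt0; apply: contraTneq wy => ->; rewrite mul0r ltxx.
  have w2 : 0 < `|U a (y i.+1)|.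
    by rewrite normr_gt0; apply: contraTneq wy => ->; rewrite mulr0 ltxx.
  have [e1 e10 H1] := data_cvg_value Aa (y0 i (ltnW ik)) w1.
  have [e2 e20 H2] := data_cvg_value Aa (y0 _ ik) w2.
  exists (Num.min e1 e2); first by rewrite lt_min e10.
  move=> e; rewrite le_min => /and3P[e0 ee1 ee2] _ b Ab be.
  have same (x1 x2 : R) : `|x1 - x2| < `|x2| -> 0 < x2 * x1.
    by case: (ger0P x2) => ?; rewrite ltr_norml => /andP[]; nra.
  have s1 : 0 < U a (y i) * U b (y i).
    apply: same; apply: H1 => //; first exact: lt_le_trans be ee1.
    by rewrite lexx y0// ltnW.
  have s2 : 0 < U a (y i.+1) * U b (y i.+1).
    apply: same; apply: H2 => //; first exact: lt_le_trans be ee2.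
    by rewrite lexx y0.
  have a1 := mulr_gt0 s1 s2.
  have E : U a (y i) * U b (y i) * (U a (y i.+1) * U b (y i.+1)) =
    (U a (y i) * U a (y i.+1)) * (U b (y i) * U b (y i.+1)) by ring.
  by move: a1; rewrite E nmulr_rgt0.
exists d => // b Ab bd; exists y; split => // i ik.
have [yy _] := yS i ik; split => //.
by apply: (Hd i ik d _ b Ab bd); rewrite lexx ltW.
Qed.

Lemma phase_lower_bound a T : A <= a -> 0 < T -> exists2 m, 0 < m &
  forall t, 0 <= t <= T -> m <= qf 1 t * Z a t ^+ 2 + U a t ^+ 2.
Proof.
have A0_ := A0; move=> Aa T0; have [sola UaM] := UZ Aa.
have [_ _ cZ _ _] := sola; have cU := radial_sol_continuous sola.
have a0 : a != 0 by rewrite gt_eqF//; lra.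
have M0 : 0 <= 2 * a by lra.
have [L L0 HL] := nonlin_lipschitz p1 lam M0.
have cP := @continuous_phase _ 1 _ _ cU cZ.
have [|c cI H] := @evt_max _ (fun t => - (qf 1 t * Z a t ^+ 2 + U a t ^+ 2)) 0 T (ltW T0).
  by move=> x _; apply: continuousN; exact: cP.
exists (qf 1 c * Z a c ^+ 2 + U a c ^+ 2).
  apply: (phase_gt0 N2 ler01 a0 (ltW L0) (nonlin0 p lam) sola UaM HL).
  by have /andP[] := cI.
by move=> t tI; have := H t tI; rewrite lerN2.
Qed.

(** Persistence from a to b is clear. For the converse, nearby solutions have no zero after the same
    T and a phase bounded below uniformly in b, so their sign changes are strong with one margin m
    and pass to [U a]. *)
Lemma sign_changes_locally_constant k a T : A <= a -> 0 < T ->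
  no_zero_after N p lam T (U a T) (Z a T) -> exists2 r, 0 < r &
  forall b, A <= b -> `|b - a| < r -> sign_changes k (U b) <-> sign_changes k (U a).
Proof.
move=> Aa T0 nz; have [m0 m00 Hm0] := phase_lower_bound Aa T0.
have [sola UaM] := UZ Aa.
have UaT : 0 < `|U a T|.
  by rewrite normr_gt0; apply: (no_zero_afterP N2 p1 gap0 sola T0 nz); exact: lexx.
(* The halves leave room for passing from a to b: |U b T| >= m, and the phase of b is at least m0 /
   2 - m^2 >= m^2. *)
pose m := Num.min (`|U a T| / 2) (Num.sqrt m0 / 2).
have sm : 0 < Num.sqrt m0 by rewrite sqrtr_gt0.
have m_gt0 : 0 < m by rewrite lt_min !divr_gt0.
have m1 : m <= `|U a T| / 2 by rewrite ge_min lexx.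
have m2 : m <= Num.sqrt m0 / 2 by rewrite ge_min lexx orbT.
have m2' : m ^+ 2 <= m0 / 4.
  have -> : m0 / 4 = (Num.sqrt m0 / 2) ^+ 2.
    by rewrite exprMn sqr_sqrtr ?(ltW m00)//; field.
  by rewrite lerXn2r ?nnegrE ?divr_ge0 ?(ltW sm) ?(ltW m_gt0).
have [r1 r10 H1] := no_zero_after_open Aa T0 nz.
have [r2 r20 H2] := data_cvg Aa (ltW T0) m_gt0.
have [r3 r30 H3] := data_cvg_value Aa (ltW T0) m_gt0.
suff [r4 r40 H4] : exists2 r, 0 < r & forall b, A <= b -> `|b - a| < r ->
    sign_changes k (U b) -> sign_changes k (U a).
  have [Sa|Sa] := pselect (sign_changes k (U a)).
    have [r5 r50 H5] := sign_changes_transfer Aa Sa.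
    by exists r5 => // b Ab br; split => // _; exact: H5.
  by exists r4 => // b Ab br; split => // Sb; exact: (H4 b).
exists (Num.min r1 (Num.min r2 r3)); first by rewrite !lt_min r10 r20.
move=> b Ab; rewrite !lt_min => /and3P[b1 b2 b3] Sb.
have [solb _] := UZ Ab; have [_ dU _ _ _] := solb.
apply: (@strong_sign_changes_close _ k m T (U b)) => //.
  by move=> t tT; exact: H3.
apply: (@strong_sign_changes_of _ k (U b) (Z b)) => //.
- exact: (no_zero_afterP N2 p1 gap0 solb T0 (H1 b Ab b1)).
- have := H3 b T Ab b3; rewrite (ltW T0) lexx => /(_ isT) h.
  have := ler_normB (U b T) (U b T - U a T); rewrite opprB addrC subrK.
  by flra.
move=> t tT; have /andP[t0 _] := tT.
have h1 := H2 b t Ab b2 tT; have h2 := Hm0 t tT.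
have q0 := qf_ge0 ler01 t0.
have h3 : qf 1 t * Z a t ^+ 2 <= qf 1 t * (2 * Z b t ^+ 2 + 2 * (Z b t - Z a t) ^+ 2).
  apply: ler_wpM2l => //; have := sqr_ge0 (2 * Z b t - Z a t); flra.
have h4 : U a t ^+ 2 <= 2 * U b t ^+ 2 + 2 * (U b t - U a t) ^+ 2.
  have := sqr_ge0 (2 * U b t - U a t); flra.
by flra.
Qed.

(** Otherwise no solution has zeros beyond some T of its own, the number of sign changes is locally
    constant, and [U A] inherits k of them for every k. Its nonzero phase and bounded slope on
    [0, T] allow only finitely many. *)
Lemma exists_fast_decay :
  (forall k, exists B, forall b, A <= b -> B <= b -> sign_changes k (U b)) ->
  exists2 a, A <= a & fast_decay N (U a) (Z a).
Proof.
move=> many; apply: contrapT => nofast.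
have A0_ := A0.
have nz a : A <= a -> exists2 T, 0 < T & no_zero_after N p lam T (U a T) (Z a T).
  move=> Aa; have [sola UaM] := UZ Aa.
  have [fd|//] := fast_decay_or_no_zero N2 p1 gap0 sola UaM.
  by exfalso; apply: nofast; exists a.
have all k : sign_changes k (U A).
  have [B HB] := many k.
  pose b := A + `|B|; have Ab : A <= b by rewrite lerDl.
  apply: (@locally_constant_prop _ (fun a => sign_changes k (U a)) A b Ab).
    move=> x /andP[Ax xb]; have [T T0 nT] := nz x Ax.
    have [r r0 H] := sign_changes_locally_constant k Ax T0 nT.
    by exists r => // y /andP[Ay _]; exact: H.
  by apply: HB => //; rewrite /b; have := ler_norm B; lra.
have [T T0 nT] := nz A (lexx A).
have [m0 m00 Hm0] := phase_lower_bound (lexx A) T0.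
have [solA UAM] := UZ (lexx A); have [_ dU cZ _ _] := solA.
have [B B0 HB] := continuous_bounded (ltW T0) cZ.
have UaT : 0 < `|U A T|.
  by rewrite normr_gt0; apply: (no_zero_afterP N2 p1 gap0 solA T0 nT); exact: lexx.
pose m := Num.min `|U A T| (Num.sqrt m0).
have sm : 0 < Num.sqrt m0 by rewrite sqrtr_gt0.
have m_gt0 : 0 < m by rewrite lt_min UaT.
have c0 : 0 < 2 * m / B by rewrite divr_gt0// mulr_gt0.
(* One more than T divided by the minimal length 2 m / B of a sign change. *)
pose k := (Num.truncn (T / (2 * m / B))).+1.
have := @strong_sign_changes_bound _ k m T B (U A) (Z A) m_gt0 (ltW T0) B0 dU HB.
move=> h; have {}h : k%:R * (2 * m / B) <= T.
  apply: h; apply: (@strong_sign_changes_of _ k (U A) (Z A)) => //.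
  - exact: (no_zero_afterP N2 p1 gap0 solA T0 nT).
  - by rewrite ge_min lexx.
  - move=> t tT; apply: le_trans (Hm0 t tT).
    rewrite -(sqr_sqrtr (ltW m00)) lerXn2r ?nnegrE ?(ltW sm) ?(ltW m_gt0)//.
    by rewrite ge_min lexx orbT.
move: h; rewrite -ler_pdivlMr// => h.
have : T / (2 * m / B) < k%:R by rewrite truncnS_gt.
by lra.
Qed.

End continuity_in_data.

Hypothesis pN : (2 < N)%N -> p < (N%:R + 2) / (N%:R - 2).

(** The window and the slope are those of [near_limit_gradient] after y = e s and w = alpha W, with
    e = alpha^(1-p); c, s1 and s2 do not depend on alpha. *)
Lemma fast_solutions : exists c s1 s2 : R, [/\ 0 < c, 0 < s1, s1 < s2 &
  forall A, exists alpha w z M, [/\ A <= alpha, 0 < alpha,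
    radial_sol N 1 (nonlin p lam) alpha w z /\ (forall s, 0 <= s -> `|w s| <= M),
    fast_decay N w z &
    forall y, alpha `^ (1 - p) * s1 <= y <= alpha `^ (1 - p) * s2 ->
      c * alpha / alpha `^ (1 - p) <= `|z y|]].
Proof.
have p1_ := p1; have [W [Zf WZ]] := sol_family N2 lam p1.
have [c [s1 [s2 [e1 [c0 s10 s12 e10 Hg]]]]] := near_limit_gradient N2 p1 WZ.
exists c, s1, s2; split => // A.
pose eps (a : R) := a `^ (1 - p).
have em := eps_max_gt0 lam p1.
(* 1 - p is negative, so the scale is at most d as soon as a is at least the power 1 / (1 - p) of
   d. *)
have small d : 0 < d -> exists2 B, 0 < B & forall a, B <= a -> 0 < eps a <= d.
  move=> d0; pose X := d `^ (1 - p)^-1; have X0 : 0 < X by exact: powR_gt0.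
  have dE : d = X `^ (1 - p).
    by rewrite -powRrM mulVf ?powRr1 ?(ltW d0)//; apply/eqP; flra.
  exists X => // a Xa; have a0 : 0 < a by flra.
  rewrite powR_gt0//= dE /eps; have -> : 1 - p = - (p - 1) by ring.
  rewrite !powRN lef_pV2 ?posrE ?powR_gt0//.
  by apply: ge0_ler_powR; rewrite ?nnegrE ?(ltW X0) ?(ltW a0)//; flra.
have [B1 B10 HB1] := small _ em.
have [B2 B20 HB2] := small _ e10.
pose A1 := `|A| + B1 + B2.
have A10 : 0 < A1 by rewrite /A1; have := normr_ge0 A; flra.
have AA1 : A <= A1 by rewrite /A1; have := ler_norm A; flra.
have A1B1 : B1 <= A1 by rewrite /A1; have := normr_ge0 A; flra.
have A1B2 : B2 <= A1 by rewrite /A1; have := normr_ge0 A; flra.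
pose U a y := a * W (eps a) (y / eps a).
pose Z a y := a / eps a * Zf (eps a) (y / eps a).
have epsI a : A1 <= a -> 0 <= eps a <= eps_max p lam.
  by move=> Aa; have /andP[h1 h2] := HB1 a (le_trans A1B1 Aa); rewrite h2 ltW.
have UZ a : A1 <= a -> radial_sol N 1 (nonlin p lam) a (U a) (Z a) /\
    forall s, 0 <= s -> `|U a s| <= 2 * a.
  move=> Aa; have [sole WM] := WZ _ (epsI a Aa).
  have a0 : 0 < a by flra.
  have /andP[e0 _] := HB1 a (le_trans A1B1 Aa).
  split; first exact: rescale_sol.
  move=> s s0; rewrite normrM (gtr0_norm a0) mulrC ler_pM2r//; apply: WM.
  by rewrite divr_ge0// ltW.
have [a Aa fd] : exists2 a, A1 <= a & fast_decay N (U a) (Z a).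
  apply: (exists_fast_decay A10 UZ) => k.
  have [e2 e20 H2] := near_limit_sign_changes N2 p1 pN WZ k.
  have [B3 B30 HB3] := small _ e20.
  exists B3 => b Ab B3b.
  have /andP[e0 ee2] := HB3 b B3b; have /andP[_ em'] := epsI b Ab.
  have [y [y0 yS]] := H2 (eps b) ltac:(by rewrite (ltW e0)) em'.
  have b0 : 0 < b by flra.
  exists (fun i => eps b * y i); split.
    by move=> i ik; rewrite mulr_ge0 ?y0// ltW.
  move=> i ik; have [yy wy] := yS i ik; split; first by rewrite ltr_pM2l.
  have E x : eps b * x / eps b = x by rewrite mulrAC divff ?gt_eqF ?mul1r.
  rewrite /U !E.
  have -> : b * W (eps b) (y i) * (b * W (eps b) (y i.+1)) =
    b ^+ 2 * (W (eps b) (y i) * W (eps b) (y i.+1)) by ring.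
  by rewrite pmulr_rlt0// exprn_gt0.
have [sola UaM] := UZ a Aa.
have a0 : 0 < a by flra.
exists a, (U a), (Z a), (2 * a); split => //; first by flra.
move=> y /andP[y1 y2].
have /andP[e0 _] := HB1 a (le_trans A1B1 Aa).
have /andP[_ ee1] := HB2 a (le_trans A1B2 Aa).
have /andP[_ em'] := epsI a Aa.
rewrite /Z normrM ger0_norm; last by rewrite divr_ge0 ?ltW.
have -> : c * a / a `^ (1 - p) = a / eps a * c by rewrite -/(eps a); ring.
rewrite ler_pM2l ?divr_gt0//; apply: Hg => //; first by rewrite (ltW e0).
by rewrite ler_pdivlMr// ler_pdivrMr// !(mulrC _ (eps a)) y1 y2.
Qed.

End fast_solutions.

(** * Integration over R^n *)

Section borel_row.
Context {R : realType}.

Lemma continuous_to_row (T : topologicalType) n (f : T -> 'rV[R]_n) :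
  (forall i, continuous (fun t => f t 0 i)) -> continuous f.
Proof.
move=> H t; apply/cvg_ballP => e e0.
have : \forall s \near t, forall j : 'I_n, ball (f t 0 j) e (f s 0 j).
  apply: filter_forall => j.
  by have /cvg_ballP /(_ e e0) := H j t.
by apply: filterS => s h; split => // i j; rewrite (ord1 i).
Qed.

Lemma continuous_row_cons n (T : topologicalType) (f : T -> R) (g : T -> 'rV[R]_n) :
  continuous f -> continuous g -> continuous (fun t => row_cons (f t, g t)).
Proof.
move=> cf cg; apply: continuous_to_row => i; case: (unliftP ord0 i) => [j ->|->].
  under eq_fun do rewrite row_consES /=.
  move=> t; apply: (@continuous_comp _ _ _ g (fun v : 'rV[R]_n => v 0 j)).
    exact: cg.
  exact: coord_continuous.
by under eq_fun do rewrite row_consE0 /=.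
Qed.

Definition obox n (a b : 'I_n -> R) : set 'rV[R]_n :=
  [set x | forall i, `]a i, b i[%classic (x 0 i)].
Definition cbox n (a b : 'I_n -> R) : set 'rV[R]_n :=
  [set x | forall i, `[a i, b i]%classic (x 0 i)].

Lemma measurable_obox n (a b : 'I_n -> R) : measurable (obox a b).
Proof. by apply: (@measurable_box _ _ (fun i => `]a i, b i[%classic)) => i; exact: measurable_itv. Qed.

Lemma measurable_cbox n (a b : 'I_n -> R) : measurable (cbox a b).
Proof. by apply: (@measurable_box _ _ (fun i => `[a i, b i]%classic)) => i; exact: measurable_itv. Qed.

Lemma obox_sub_cbox n (a b : 'I_n -> R) : obox a b `<=` cbox a b.
Proof.
move=> x H i; have := H i; rewrite /= !in_itv /= => /andP[h1 h2].
by rewrite !ltW.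
Qed.

(** Boxes with rational centre and half-side 1 / (m + 1), kept only if the closed box lies in U: the
    bump functions supported in the closed box are then test functions on U. *)
Lemma open_box_cover n (U : set 'rV[R]_n) : open U ->
  exists B : nat -> set 'rV[R]_n, U = \bigcup_k B k /\
    forall k, B k = set0 \/ exists a b, B k = obox a b /\ cbox a b `<=` U.
Proof.
move=> oU.
pose lo (qm : 'rV[rat]_n * nat) i : R := ratr (qm.1 0 i) - qm.2.+1%:R^-1.
pose hi (qm : 'rV[rat]_n * nat) i : R := ratr (qm.1 0 i) + qm.2.+1%:R^-1.
pose F k := if unpickle k is Some qm then
  (if `[< cbox (lo qm) (hi qm) `<=` U >] then obox (lo qm) (hi qm) else set0) else set0.
exists F; split; last first.
  move=> k; rewrite /F; case: unpickle => [qm|]; last by left.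
  by case: asboolP => [sub|_]; [right; exists (lo qm), (hi qm)|left].
apply/seteqP; split; last first.
  move=> x [k _]; rewrite /F; case: unpickle => // qm; case: asboolP => // sub.
  by move=> /obox_sub_cbox; exact: sub.
move=> x Ux; have /nbhs_ballP[e /= e0 eU] : nbhs x U by exact: open_nbhs_nbhs.
have [m m0 me] : exists2 m : nat, 0 < m.+1%:R^-1 :> R & m.+1%:R^-1 < e / 2 :> R.
  exists (Num.truncn (2 / e)); first by rewrite invr_gt0.
  have := truncnS_gt (2 / e) => h.
  rewrite -[e / 2]invrK ltf_pV2 ?posrE ?invr_gt0 ?divr_gt0//.
  by rewrite invf_div.
have /choice[q Hq] i : exists q : rat, ratr q \in `](x 0 i - m.+1%:R^-1), (x 0 i + m.+1%:R^-1)[.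
  by apply: rat_in_itvoo; rewrite ltrD2l gtrN.
exists (pickle (\row_i q i, m)) => //; rewrite /F pickleK.
have xB : obox (lo (\row_i q i, m)) (hi (\row_i q i, m)) x.
  move=> i; rewrite /= in_itv /lo /hi /= mxE; have := Hq i; rewrite in_itv /= => /andP[h1 h2].
  by rewrite ltrBlDr h2 -ltrBlDr h1.
case: asboolP => // -[]; move=> z zB; apply: eU; split => // i j.
rewrite (ord1 i) /ball /= ltr_norml; have := xB j; have := zB j.
rewrite /= !in_itv /lo /hi /= !mxE; move: m0 me; move: (m.+1%:R^-1) => dl m0 me.
by move=> /andP[h1 h2] /andP[h3 h4]; apply/andP; split; lra.
Qed.

Lemma open_measurable_row n (U : set 'rV[R]_n) : open U -> measurable U.
Proof.
move=> /open_box_cover[B [-> HB]]; apply: bigcupT_measurable => k.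
by have [->|[a [b [-> _]]]] := HB k; [exact: measurable0|exact: measurable_obox].
Qed.

Lemma open_coord_itv n (i : 'I_n) (c d : R) : open [set x : 'rV[R]_n | `]c, d[%classic (x 0 i)].
Proof.
rewrite (_ : [set _ | _] = (fun x : 'rV[R]_n => x 0 i) @^-1` `]c, d[%classic) //.
by apply: open_comp; [move=> x _; exact: coord_continuous|exact: interval_open].
Qed.

Definition oboxes n : set (set 'rV[R]_n) := [set B | exists a b, B = obox a b].

Lemma oboxI n (a b c d : 'I_n -> R) : obox a b `&` obox c d =
  obox (fun i => Num.max (a i) (c i)) (fun i => Num.min (b i) (d i)).
Proof.
apply/seteqP; split => [x [h1 h2] i|x h].
  have := h1 i; have := h2 i; rewrite /= !in_itv /= gt_max lt_min.
  by move=> /andP[-> ->] /andP[-> ->].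
by split=> i; have := h i; rewrite /= !in_itv /= gt_max lt_min;
  move=> /andP[/andP[h1 h2] /andP[h3 h4]]; rewrite ?h1 ?h2 ?h3 ?h4.
Qed.

(** Open boxes are closed under intersection, so this presentation of the product sigma-algebra
    allows Dynkin induction. *)
Lemma oboxes_measurableE n : @measurable _ 'rV[R]_n = <<s @oboxes n >>.
Proof.
apply/seteqP; split; last first.
  apply: smallest_sub; first exact: sigma_algebra_measurable.
  by move=> _ [a [b ->]]; exact: measurable_obox.
apply: smallest_sub; first exact: smallest_sigma_algebra.
move=> A; rewrite -bigcup_seq => -[i _ [Y mY <-]]; rewrite setTI.
have : @measurable_fun _ _ (g_sigma_algebraType (@oboxes n)) R setT
    (fun x : 'rV[R]_n => x 0 i).
  apply: (measurability _ (RGenOpens.measurableE R)).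
  move=> _ [_ [c [d ->]] <-]; rewrite setTI.
  have [B [BE HB]] := open_box_cover (@open_coord_itv n i c d).
  rewrite (_ : _ @^-1` _ = \bigcup_k B k) //; apply: bigcupT_measurable => k.
  have [->|[a [b [-> _]]]] := HB k; first exact: measurable0.
  by apply: sub_sigma_algebra; exists a, b.
by move=> /(_ measurableT Y mY); rewrite setTI.
Qed.

Lemma open_continuous_measurable_row n (D : set 'rV[R]_n) (f : 'rV[R]_n -> R) :
  open D -> (forall x, D x -> {for x, continuous f}) -> measurable_fun D f.
Proof.
move=> oD cf; apply: (measurability _ (RGenOpens.measurableE R)).
move=> _ [_ [a [b ->]] <-]; apply: open_measurable_row.
rewrite openE => x [Dx /= fx]; rewrite /interior; apply: filterI.
  exact: open_nbhs_nbhs.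
by apply: (cf x Dx); apply: open_nbhs_nbhs; split => //; exact: interval_open.
Qed.

Lemma continuous_measurable_row n (f : 'rV[R]_n -> R) :
  continuous f -> measurable_fun setT f.
Proof.
move=> cf; apply: open_continuous_measurable_row; first exact: openT.
by move=> x _; exact: cf.
Qed.

Definition cube n (c : R) : set 'rV[R]_n := [set x | forall i, `[- c, c]%classic (x 0 i)].

Lemma measurable_cube n c : measurable (@cube n c).
Proof. apply: (@measurable_box _ _ (fun=> `[- c, c]%classic)) => i; exact: measurable_itv. Qed.

Lemma cube_finite n c : (lebesgue_row n (@cube n c) < +oo)%E.
Proof.
rewrite (lebesgue_row_box (A := fun=> `[- c, c]%classic)); last by move=> i; exact: measurable_itv.
have : (0 <= \prod_(i < n) lebesgue_measure `[(- c)%R, c]%classic < +oo)%E.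
  elim/big_ind : _ => //=.
  - by rewrite ltry lee01.
  - move=> x y /andP[x0 xoo] /andP[y0 yoo]; rewrite mule_ge0//=.
    by rewrite lte_mul_pinfty// ge0_fin_numE.
  move=> i _; rewrite measure_ge0 /=.
  by rewrite lebesgue_measure_itv /=; case: ifP => _; rewrite -?EFinB ltry.
by case/andP.
Qed.

End borel_row.

(** * Partial derivatives of compactly supported functions integrate to zero *)

Section int_partial.
Context {R : realType}.

Lemma compact_cube n (c : R) : compact (@cube R n c).
Proof. by apply: (@rV_compact _ n (fun=> `[- c, c]%classic)) => i; exact: segment_compact. Qed.

Lemma bounded_supp n (c : R) (F : 'rV[R]_n -> R) : continuous F ->
  (forall x, ~ cube c x -> F x = 0) -> exists M, forall x, `|F x| <= M.
Proof.
move=> cF sF.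
have := continuous_compact (continuous_subspaceT cF) (@compact_cube n c).
move=> /compact_bounded /pinfty_ex_gt0[M M0 HM]; exists M => x.
have [xc|/sF->] := pselect (cube c x); last by rewrite normr0 ltW.
by apply: HM; exists x.
Qed.

Lemma integrable_supp n (c M : R) (f : 'rV[R]_n -> R) : measurable_fun setT f ->
  (forall x, ~ cube c x -> f x = 0) -> (forall x, `|f x| <= M) ->
  (lebesgue_row n).-integrable setT (EFin \o f).
Proof.
move=> mf sf bf.
have -> : EFin \o f = (EFin \o f) \_ (@cube R n c).
  apply/funext => x; rewrite patchE; case: ifPn => // /negP xc /=.
  by rewrite sf // => h; apply: xc; rewrite inE.
apply: (integrable_mkcond (EFin \o f) (@measurable_cube R n c)).1.
apply: measurable_bounded_integrable.
- exact: measurable_cube.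
- exact: cube_finite.
- exact: measurable_funS mf.
by exists M; split => [|y My x _]; [exact: num_real|exact: le_trans (bf x) (ltW My)].
Qed.

Lemma measurable_from_row n (f : 'rV[R]_n.+1 -> R) : measurable_fun setT f ->
  measurable_fun setT (fun p : measurableTypeR R * 'rV[R]_n => f (row_cons p)).
Proof. by move=> mf; apply: measurableT_comp => //; exact: measurable_row_cons. Qed.

Lemma row_cons_supp n (c : R) (p : measurableTypeR R * 'rV[R]_n) :
  cube c (row_cons p) <-> - c <= p.1 <= c /\ cube c p.2.
Proof.
split => [H|[h1 h2] i].
  split; first by have := H ord0; rewrite row_consE0 /= in_itv.
  by move=> i; have := H (lift ord0 i); rewrite row_consES.
case: (unliftP ord0 i) => [j ->|->].
  by rewrite row_consES; exact: h2.
by rewrite row_consE0 /= in_itv.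
Qed.

Lemma integrable_supp_prod n (c M : R) (f : 'rV[R]_n.+1 -> R) :
  measurable_fun setT f ->
  (forall x, ~ cube c x -> f x = 0) -> (forall x, `|f x| <= M) ->
  (lebesgue_measure \x lebesgue_row n)%E.-integrable setT
    (fun p => (f (row_cons p))%:E).
Proof.
move=> mf sf bf; have := integrable_supp mf sf bf.
pose D := `[- c, c]%classic `*` @cube R n c.
have mD : measurable D by apply: measurableX; [exact: measurable_itv|exact: measurable_cube].
move=> _.
have -> : (fun p => (f (row_cons p))%:E) = (EFin \o (fun p => f (row_cons p))) \_ D.
  apply/funext => p; rewrite patchE; case: ifPn => // /negP pD /=.
  rewrite sf // => /row_cons_supp[h1 h2]; apply: pD; rewrite inE.
  by split => //=; rewrite in_itv.
apply: (integrable_mkcond (EFin \o (fun p => f (row_cons p))) mD).1.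
apply: measurable_bounded_integrable => //.
- rewrite [X in (X < _)%E]product_measure1E //; first last.
    exact: measurable_cube.
  rewrite lte_mul_pinfty //; last exact: cube_finite.
  by rewrite ge0_fin_numE //= lebesgue_measure_itv /=; case: ifP => _; rewrite -?EFinB ltry.
- exact: measurable_funS (measurable_from_row mf).
by exists M; split => [|y My x _]; [exact: num_real|exact: le_trans (bf _) (ltW My)].
Qed.

Lemma integral_row_step n (c M : R) (f : 'rV[R]_n.+1 -> R) :
  measurable_fun setT f ->
  (forall x, ~ cube c x -> f x = 0) -> (forall x, `|f x| <= M) ->
  (\int[lebesgue_row n.+1]_x (f x)%:E =
   \int[lebesgue_measure \x lebesgue_row n]_p (f (row_cons p))%:E)%E.
Proof.
move=> mf sf bf.
have mE : measurable_fun setT (fun x : 'rV[R]_n.+1 => (f x)%:E) by exact/measurable_EFinP.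
have := @integral_pushforward _ _ _ _ R (@row_cons R n) (@measurable_row_cons R n)
  (lebesgue_measure \x lebesgue_row n)%E setT (EFin \o f) mE.
move=> H; apply: H; [exact: integrable_supp_prod sf bf|exact: measurableT].
Qed.

Lemma row_cons_line0 n (t h : R) (v : 'rV[R]_n) :
  row_cons (t, v) + h *: delta_mx 0 ord0 = row_cons (t + h, v).
Proof.
apply/rowP => i; rewrite [LHS]mxE [X in _ + X]mxE [X in _ * X]mxE eqxx /=; case: (unliftP ord0 i) => [j ->|->].
  by rewrite !row_consES /= mulr0 addr0.
by rewrite !row_consE0 eqxx mulr1.
Qed.

Lemma row_cons_lineS n (t h : R) (v : 'rV[R]_n) (i : 'I_n) :
  row_cons (t, v) + h *: delta_mx 0 (lift ord0 i) = row_cons (t, v + h *: delta_mx 0 i).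
Proof.
apply/rowP => j; rewrite [LHS]mxE [X in _ + X]mxE [X in _ * X]mxE eqxx /=; case: (unliftP ord0 j) => [k ->|->].
  by rewrite !row_consES /= !mxE eqxx /= (inj_eq (@lift_inj _ ord0)).
by rewrite !row_consE0 (_ : (ord0 == lift ord0 i) = false) ?mulr0 ?addr0.
Qed.

Lemma has_derive_row_cons0 n (F : 'rV[R]_n.+1 -> R) (t a : R) (v : 'rV[R]_n) :
  has_derive (row_cons (t, v)) (delta_mx 0 ord0) F a ->
  has_derive t 1 (fun s : R => F (row_cons (s, v))) a.
Proof.
move=> /is_derive_line H; apply: line_is_derive.
rewrite (_ : (fun _ => _) = fun s => F (row_cons (t, v) + s *: delta_mx 0 ord0)) //.
by apply/funext => s; rewrite row_cons_line0 -[s *: 1]/(s * 1) mulr1.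
Qed.

Lemma has_derive_row_consS n (F : 'rV[R]_n.+1 -> R) (t a : R) (v : 'rV[R]_n) i :
  has_derive (row_cons (t, v)) (delta_mx 0 (lift ord0 i)) F a ->
  has_derive v (delta_mx 0 i) (fun w => F (row_cons (t, w))) a.
Proof.
move=> /is_derive_line H; apply: line_is_derive.
rewrite (_ : (fun _ => _) = fun s => F (row_cons (t, v) + s *: delta_mx 0 (lift ord0 i))) //.
by apply/funext => s; rewrite row_cons_lineS.
Qed.

Lemma integral_derive_eq0 (F dF : R -> R) (c : R) : continuous dF ->
  (forall t : R, has_derive t 1 F (dF t)) -> (forall t, ~ (- c <= t <= c) -> F t = 0) ->
  (forall t, ~ (- c <= t <= c) -> dF t = 0) ->
  (\int[lebesgue_measure]_t (dF t)%:E = 0)%E.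
Proof.
(* d lies strictly beyond c, so [F] vanishes at both ends, and is positive whatever the sign of
   c. *)
move=> cdF HF sF sdF; pose d : R := `|c| + 1.
have cd : c < d by rewrite /d; have := ler_norm c; lra.
have d0 : 0 < d by rewrite /d; have := normr_ge0 c; lra.
have cF t : {for t, continuous F} := is_derive_continuous (HF t).
have <- : (\int[lebesgue_measure]_(t in `[(- d)%R, d]%classic) (dF t)%:E)%E =
    (\int[lebesgue_measure]_t (dF t)%:E)%E.
  rewrite integral_mkcond; apply: eq_integral => t _; rewrite patchE; case: ifPn => //.
  rewrite mem_setE in_itv /= => /negP td; rewrite sdF // => tc; apply: td.
  by lra.
rewrite (@continuous_FTC2 _ dF F).
- by rewrite !sF ?sube0 // => h; lra.
- by lra.
- exact: continuous_subspaceT.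
- split.
  + by move=> t _; case: (HF t).
  + by apply: cvg_at_right_filter; exact: cF.
  + by apply: cvg_at_left_filter; exact: cF.
by move=> t _; rewrite derive1E; case: (HF t).
Qed.

(** Fubini, with the induction hypothesis applied to slices unless i is the first coordinate; in
    that case the inner integral is one-dimensional. Differentiability is used in the direction i
    alone, which suits fluxes that are continuous but not C^1. *)
Lemma int_partial_eq0 n (i : 'I_n) (F dF : 'rV[R]_n -> R) (c : R) :
  continuous dF -> (forall x, has_derive x (delta_mx 0 i) F (dF x)) ->
  (forall x, ~ cube c x -> F x = 0) -> (forall x, ~ cube c x -> dF x = 0) ->
  (\int[lebesgue_row n]_x (dF x)%:E = 0)%E.
Proof.
elim: n i F dF => [[]//|n IHn] i F dF cdF HF sF sdF.
have [M bM] := bounded_supp cdF sdF.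
have mdF := continuous_measurable_row cdF.
rewrite (integral_row_step mdF sdF bM).
have intf := integrable_supp_prod mdF sdF bM.
have [j ij|i0] := unliftP ord0 i.
  rewrite -(integral12_prod_meas1 intf) /fubini_F /=.
  apply: integral0_eq => t _.
  apply: (IHn j (fun v => F (row_cons (t, v)))).
  - move=> v; apply: (@continuous_comp _ _ _ (fun v => row_cons (t, v)) dF); last exact: cdF.
    by apply: continuous_row_cons => ?; [exact: cst_continuous|exact: cvg_id].
  - by move=> v; apply: has_derive_row_consS; rewrite -ij; exact: HF.
  - by move=> v vc; apply: sF => /row_cons_supp[].
  - by move=> v vc; apply: sdF => /row_cons_supp[].
rewrite -(integral21_prod_meas1 intf) /fubini_G /=.
apply: integral0_eq => v _.
apply: (@integral_derive_eq0 (fun t => F (row_cons (t, v))) _ c).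
- move=> t; apply: (@continuous_comp _ _ _ (fun t => row_cons (t, v)) dF); last exact: cdF.
  by apply: continuous_row_cons => ?; [exact: cvg_id|exact: cst_continuous].
- by move=> t; apply: has_derive_row_cons0; rewrite -i0; exact: HF.
- by move=> t tc; apply: sF => /row_cons_supp[].
- by move=> t tc; apply: sdF => /row_cons_supp[].
Qed.

End int_partial.

Section continuity_at.
Context {R : realType} {T : topologicalType}.
Implicit Types (f g : T -> R) (x : T).

Lemma cst_at (c : R) x : {for x, continuous (fun _ : T => c)}.
Proof. exact: cst_continuous. Qed.

Lemma addr_at f g x : {for x, continuous f} -> {for x, continuous g} ->
  {for x, continuous (fun t => f t + g t)}.
Proof. by move=> cf cg; exact: cvgD. Qed.

Lemma oppr_at f x : {for x, continuous f} -> {for x, continuous (fun t => - f t)}.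
Proof. by move=> cf; exact: cvgN. Qed.

Lemma mulr_at f g x : {for x, continuous f} -> {for x, continuous g} ->
  {for x, continuous (fun t => f t * g t)}.
Proof. by move=> cf cg; exact: cvgM. Qed.

Lemma exprn_at f n x : {for x, continuous f} ->
  {for x, continuous (fun t => f t ^+ n)}.
Proof.
move=> cf; elim: n => [|n IHn]; first exact: cst_at.
rewrite (_ : (fun _ => _) = fun t => f t * f t ^+ n); first exact: mulr_at.
by apply/funext => t; rewrite exprS.
Qed.

Lemma invr_at f x : f x != 0 -> {for x, continuous f} ->
  {for x, continuous (fun t => (f t)^-1)}.
Proof. by move=> fx cf; exact: cvgV. Qed.

Lemma sumr_at (I : Type) (r : seq I) (F : I -> T -> R) x :
  (forall i, {for x, continuous (F i)}) ->
  {for x, continuous (fun t => \sum_(i <- r) F i t)}.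
Proof.
move=> cF; elim: r => [|i r IHr].
  rewrite (_ : (fun _ => _) = fun=> 0); first exact: cst_at.
  by apply/funext => t; rewrite big_nil.
rewrite (_ : (fun _ => _) = fun t => F i t + \sum_(j <- r) F j t).
  exact: addr_at.
by apply/funext => t; rewrite big_cons.
Qed.

Lemma prodr_at (I : Type) (r : seq I) (F : I -> T -> R) x :
  (forall i, {for x, continuous (F i)}) ->
  {for x, continuous (fun t => \prod_(i <- r) F i t)}.
Proof.
move=> cF; elim: r => [|i r IHr].
  rewrite (_ : (fun _ => _) = fun=> 1); first exact: cst_at.
  by apply/funext => t; rewrite big_nil.
rewrite (_ : (fun _ => _) = fun t => F i t * \prod_(j <- r) F j t).
  exact: mulr_at.
by apply/funext => t; rewrite big_cons.
Qed.

Lemma comp_at f (h : R -> R) x : {for x, continuous f} ->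
  {for f x, continuous h} -> {for x, continuous (fun t => h (f t))}.
Proof. by move=> cf ch; exact: (@continuous_comp _ _ _ f h). Qed.

End continuity_at.

(** * The ball and its conformal factor *)

Section ball.
Context {R : realType} {N : nat}.
Implicit Types (x : 'rV[R]_N) (phi g s S dS : 'rV[R]_N -> R).

Lemma dotr_ge0 x : 0 <= dotr x x.
Proof. by apply: sumr_ge0 => i _; exact: sqr_ge0. Qed.

Lemma sqr_coord_le_dotr x i : x 0 i ^+ 2 <= dotr x x.
Proof.
rewrite /dotr (bigD1 i) //= -expr2 lerDl; apply: sumr_ge0 => j _; exact: sqr_ge0.
Qed.

Lemma continuous_dotr : continuous (fun x => dotr x x).
Proof.
by move=> x; apply: sumr_at => i; apply: mulr_at; exact: coord_continuous.
Qed.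

Lemma open_hball : open (@hball R N).
Proof.
rewrite (_ : hball = (fun x => dotr x x) @^-1` [set t : R | t < 1]) //.
by apply: open_comp; [move=> x _; exact: continuous_dotr|exact: open_lt].
Qed.

Lemma measurable_hball : measurable (@hball R N).
Proof. exact: open_measurable_row open_hball. Qed.

Lemma hball_cube x : hball x -> cube 1 x.
Proof.
move=> xB i; rewrite /= in_itv /=; have := sqr_coord_le_dotr x i; have : dotr x x < 1 := xB.
by move: (x 0 i) (dotr x x) => a d *; nra.
Qed.

Lemma dotr_line x i (t : R) :
  dotr (x + t *: delta_mx 0 i) (x + t *: delta_mx 0 i) =
  dotr x x + 2 * (t * x 0 i) + t ^+ 2.
Proof.
rewrite /dotr (bigD1 i) //= [X in _ = X + _ + _](bigD1 i) //=.
rewrite !mxE !eqxx /=.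
rewrite (eq_bigr (fun j => x 0 j * x 0 j)); first by ring.
by move=> j /negbTE ji; rewrite !mxE eqxx ji /= mulr0 addr0.
Qed.

Lemma has_derive_dotr x i :
  has_derive x (delta_mx 0 i) (fun x => dotr x x) (2 * x 0 i).
Proof.
apply: line_is_derive.
rewrite (_ : (fun _ => _) = (fun t => (dotr x x + 2 * (t * x 0 i)) + t ^+ 2)); last first.
  by apply/funext => t; rewrite dotr_line.
apply: is_deriveE.
  apply: is_deriveDE; last exact: (is_deriveXE 2 (is_derive_idE _)).
  apply: is_deriveDE; first exact: is_derive_cstE.
  apply: is_deriveME; first exact: is_derive_cstE.
  apply: is_deriveME; first exact: is_derive_idE.
  exact: is_derive_cstE.
by rewrite /=; ring.
Qed.

Lemma has_derive_coord x i j :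
  has_derive x (delta_mx 0 i) (fun x => x 0 j) (j == i)%:R.
Proof.
apply: line_is_derive.
rewrite (_ : (fun _ => _) = (fun t => x 0 j + t * (j == i)%:R)); last first.
  by apply/funext => t; rewrite !mxE eqxx.
apply: is_deriveE.
  apply: is_deriveDE; first exact: is_derive_cstE.
  apply: is_deriveME; first exact: is_derive_idE.
  exact: is_derive_cstE.
by rewrite /=; ring.
Qed.

Lemma conf_ge2 x : hball x -> 2 <= conf x.
Proof.
rewrite /hball /conf /= => h; have := dotr_ge0 x; move: h; move: (dotr x x) => d d1 d0.
by rewrite ler_pdivlMr; nra.
Qed.

Lemma conf_gt0 x : hball x -> 0 < conf x.
Proof. by move/conf_ge2; lra. Qed.

(** Both sides are the radial variable y; consequently [qf 1 y] = conf^2 |x|^2. *)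
Lemma conf_dotr x : hball x -> conf x * dotr x x = conf x - 2.
Proof.
rewrite /hball /conf /= => h.
have : 1 - dotr x x != 0 by rewrite gt_eqF // subr_gt0.
by move=> ?; field.
Qed.

Lemma has_derive_conf x i : hball x ->
  has_derive x (delta_mx 0 i) (@conf R N) (conf x ^+ 2 * x 0 i).
Proof.
move=> xB; have d0 : 1 - dotr x x != 0 by rewrite gt_eqF // subr_gt0.
apply: is_deriveE.
  apply: is_deriveME; first exact: is_derive_cstE.
  apply: is_deriveVE => //.
  apply: is_deriveDE; first exact: is_derive_cstE.
  apply: is_deriveNE; exact: has_derive_dotr.
by rewrite /conf /=; field.
Qed.

Lemma continuous_conf x : hball x -> {for x, continuous (@conf R N)}.
Proof.
move=> xB; apply: mulr_at; first exact: cst_at.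
apply: invr_at; first by rewrite gt_eqF // subr_gt0.
by apply: addr_at; [exact: cst_at|apply: oppr_at; exact: continuous_dotr].
Qed.

Lemma compact_in_hball (K : set 'rV[R]_N) : compact K -> K `<=` hball ->
  exists r, [/\ 0 <= r, r < 1 & forall x, K x -> dotr x x <= r].
Proof.
move=> cK KB; have [K0|K0] := pselect (K !=set0); last first.
  by exists 0; split => // x Kx; case: K0; exists x.
have [c Kc Hc] := compact_EVT_max K0 cK (continuous_subspaceT continuous_dotr).
exists (dotr c c); split; first exact: dotr_ge0.
  by apply: KB; rewrite inE in Kc.
by move=> x Kx; apply: Hc; rewrite inE.
Qed.

End ball.

(** Compact support in the ball, expressed by |x|^2 <= r < 1, so that a product with a function
    continuous only inside the ball is visibly continuous everywhere. *)
Definition ball_cc {R : realType} {N : nat} (g : 'rV[R]_N -> R) :=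
  continuous g /\ exists2 r, r < 1 & forall x, r < dotr x x -> g x = 0.

(** * Integration by parts on the ball *)

Section ball_cc.
Context {R : realType} {N : nat}.
Implicit Types (x : 'rV[R]_N) (phi g s S dS : 'rV[R]_N -> R).
Local Notation mu := (@lebesgue_row R N).

Lemma ball_cc_out g x : ball_cc g -> ~ hball x -> g x = 0.
Proof.
move=> [_ [r r1 H]] /negP; rewrite -leNgt => xB.
by apply: H; exact: lt_le_trans xB.
Qed.

Lemma open_dotr_gt (r : R) : open [set x : 'rV[R]_N | r < dotr x x].
Proof.
rewrite (_ : [set _ | _] = (fun x => dotr x x) @^-1` [set t : R | r < t]) //.
by apply: open_comp; [move=> x _; exact: continuous_dotr|exact: open_gt].
Qed.

Lemma near_ball_cc_eq0 g r x : (forall x, r < dotr x x -> g x = 0) ->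
  r < dotr x x -> \forall t \near x, 0 = g t.
Proof.
move=> H rx; have : \forall t \near x, r < dotr t t.
  by apply: open_nbhs_nbhs; split => //; exact: open_dotr_gt.
by apply: filterS => t /H.
Qed.

Lemma ball_ccM s g : (forall x, hball x -> {for x, continuous s}) -> ball_cc g ->
  ball_cc (fun x => s x * g x).
Proof.
move=> cs [cg [r r1 H]]; split; last by exists r => // x /H ->; rewrite mulr0.
move=> x; have [xB|xB] := pselect (hball x); first by apply: mulr_at; [exact: cs|exact: cg].
have rx : r < dotr x x by move/negP: xB; rewrite -leNgt; exact: lt_le_trans.
apply: (@near_continuous_at _ _ (fun=> 0)); last exact: cst_at.
by apply: filterS (near_ball_cc_eq0 H rx) => t <-; rewrite mulr0.
Qed.

Lemma ball_ccD f g : ball_cc f -> ball_cc g -> ball_cc (fun x => f x + g x).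
Proof.
move=> [cf [r r1 Hf]] [cg [r' r1' Hg]]; split.
  by move=> x; apply: addr_at; [exact: cf|exact: cg].
exists (Num.max r r'); first by rewrite gt_max r1.
by move=> x; rewrite gt_max => /andP[/Hf -> /Hg ->]; rewrite addr0.
Qed.

Lemma ball_cc_cube g x : ball_cc g -> ~ cube 1 x -> g x = 0.
Proof. by move=> cg xc; apply: (ball_cc_out cg) => /hball_cube. Qed.

Lemma ball_cc_bounded g : ball_cc g -> exists M, forall x, `|g x| <= M.
Proof. by move=> cg; apply: (@bounded_supp _ _ 1); [exact: cg.1|move=> x; exact: ball_cc_cube]. Qed.

Lemma ball_cc_integrableT g : ball_cc g -> mu.-integrable setT (EFin \o g).
Proof.
move=> cg; have [M bM] := ball_cc_bounded cg.
apply: (integrable_supp (continuous_measurable_row cg.1) _ bM).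
by move=> x; exact: ball_cc_cube.
Qed.

Lemma ball_cc_integrable g : ball_cc g -> mu.-integrable hball (EFin \o g).
Proof.
move=> cg; apply: (integrableS _ _ _ (ball_cc_integrableT cg)) => //.
exact: measurable_hball.
Qed.

Lemma ball_cc_integral g : ball_cc g ->
  (\int[mu]_(x in hball) (g x)%:E = \int[mu]_x (g x)%:E)%E.
Proof.
move=> cg; rewrite integral_mkcond; apply: eq_integral => x _.
rewrite patchE; case: ifPn => //; rewrite notin_setE => xB.
by rewrite (ball_cc_out cg xB).
Qed.

Lemma ball_ccRD f g : ball_cc f -> ball_cc g ->
  \int[mu]_(x in hball) (f x + g x) =
  \int[mu]_(x in hball) f x + \int[mu]_(x in hball) g x.
Proof.
move=> cf cg; apply: RintegralD.
- exact: measurable_hball.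
- exact: ball_cc_integrable.
- exact: ball_cc_integrable.
Qed.


Lemma smooth_has_derive phi (l : seq 'I_N) i x : smooth phi ->
  has_derive x (delta_mx 0 i) (iter_partial l phi) (partial i (iter_partial l phi) x).
Proof. by move=> sphi; apply: DeriveDef => //; exact: (sphi l).2. Qed.

Lemma test_function_cc phi : test_function hball phi -> ball_cc phi.
Proof.
move=> [sphi cK KB]; split; first exact: (sphi [::]).1.
have [r [r0 r1 H]] := compact_in_hball cK KB.
exists r => // x rx; apply/eqP; apply: contraTT rx => phix; rewrite -leNgt.
by apply: H; exact: subset_closure.
Qed.

Lemma partial_cc phi i : test_function hball phi -> ball_cc (partial i phi).
Proof.
move=> tphi; have [sphi _ _] := tphi; split; first exact: (sphi [:: i]).1.
have [_ [r r1 H]] := test_function_cc tphi.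
exists r => // x rx.
have h := near_is_derive (near_ball_cc_eq0 H rx) (is_derive_cstE 0 x (delta_mx 0 i)).
by case: h.
Qed.

(** S phi has a derivative in direction i everywhere: by the product rule inside the ball, and
    outside because phi vanishes nearby. Nothing is asked of S outside. *)
Lemma weak_ibp i S dS phi :
  (forall x, hball x -> {for x, continuous S}) ->
  (forall x, hball x -> {for x, continuous dS}) ->
  (forall x, hball x -> has_derive x (delta_mx 0 i) S (dS x)) ->
  test_function hball phi ->
  \int[mu]_(x in hball) (S x * partial i phi x) =
  - \int[mu]_(x in hball) (dS x * phi x).
Proof.
move=> cS cdS HS tphi; apply/eqP; rewrite -addr_eq0 -ball_ccRD; first last.
- by apply: ball_ccM => //; exact: test_function_cc.
- by apply: ball_ccM => //; exact: partial_cc.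
have cphi := test_function_cc tphi.
have cd : ball_cc (fun x => S x * partial i phi x + dS x * phi x).
  by apply: ball_ccD; apply: ball_ccM => //; exact: partial_cc.
rewrite /Rintegral ball_cc_integral //.
rewrite (@int_partial_eq0 _ _ i (fun x => S x * phi x) _ 1) //.
- exact: cd.1.
- move=> x; have [xB|xB] := pselect (hball x).
    have [sphi _ _] := tphi.
    apply: is_deriveE.
      apply: is_deriveME; first exact: HS.
      exact: (@smooth_has_derive phi [::]).
    by rewrite /= [phi x * _]mulrC.
  have [_ [r r1 H]] := cphi.
  have rx : r < dotr x x by move/negP: xB; rewrite -leNgt; exact: lt_le_trans.
  rewrite (ball_cc_out cphi xB) (ball_cc_out (partial_cc i tphi) xB) !mulr0 addr0.
  apply: near_is_derive (is_derive_cstE 0 x (delta_mx 0 i)).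
  by apply: filterS (near_ball_cc_eq0 H rx) => t <-; rewrite mulr0.
- by move=> x xc; rewrite (ball_cc_cube cphi xc) mulr0.
by move=> x xc; exact: (ball_cc_cube cd xc).
Qed.

Lemma compact_hball_measure (K : set 'rV[R]_N) : compact K -> K `<=` hball ->
  measurable K /\ (mu K < +oo)%E.
Proof.
move=> cK KB; have mK : measurable K.
  have : closed K by apply: compact_closed => //; exact: norm_hausdorff.
  by move=> /closed_openC /open_measurable_row /measurableC; rewrite setCK.
split=> //; apply: le_lt_trans (@cube_finite R N 1).
apply: le_measure; rewrite ?inE //; first exact: measurable_cube.
by move=> x /KB /hball_cube.
Qed.

Lemma locally_integrable_continuous s :
  (forall x, hball x -> {for x, continuous s}) -> locally_integrable_row hball s.
Proof.
move=> cs; have ms : measurable_fun hball s.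
  by apply: open_continuous_measurable_row => //; exact: open_hball.
split=> // K cK KB; have [mK Koo] := compact_hball_measure cK KB.
apply: measurable_bounded_integrable => //.
  by apply: measurable_funS ms => //; exact: measurable_hball.
have cw : {within K, continuous s}.
  by apply: continuous_in_subspaceT => x; rewrite inE => /KB; exact: cs.
have /compact_bounded[M [Mr HM]] := continuous_compact cw cK.
exists M; split => // y My x Kx; apply: HM => //; by exists x.
Qed.

Lemma weak_gradient_continuous u (g : 'rV[R]_N -> 'rV[R]_N) :
  (forall x, hball x -> {for x, continuous u}) ->
  (forall i x, hball x -> {for x, continuous (fun x => g x 0 i)}) ->
  (forall i x, hball x -> has_derive x (delta_mx 0 i) u (g x 0 i)) ->
  is_weak_gradient hball u g.
Proof.
move=> cu cg ug i; split; try exact: locally_integrable_continuous.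
  by apply: locally_integrable_continuous => x; exact: cg.
by move=> phi tphi; apply: weak_ibp => // x; [exact: cg|exact: ug].
Qed.

End ball_cc.

(** * Uniqueness of weak gradients *)

Section flat.
Context {R : realType}.
Implicit Types (x t : R) (f : R -> R).

(** The functions x^(-n) exp (-1/x) for x > 0, extended by 0; the index makes the derivatives of exp
    (-1/x) combinations of members of the family. *)
Definition flat n x : R := if 0 < x then x^-1 ^+ n * expR (- x^-1) else 0.

Lemma flat_le0 n x : x <= 0 -> flat n x = 0.
Proof. by rewrite /flat ltNge => ->. Qed.

Lemma flat_ge0 n x : 0 <= flat n x.
Proof.
rewrite /flat; case: ifP => // x0; rewrite mulr_ge0 ?expR_ge0// exprn_ge0// invr_ge0.
exact: ltW.
Qed.

Lemma flat0_le1 x : flat 0 x <= 1.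
Proof.
rewrite /flat; case: ifP => // x0; rewrite expr0 mul1r -expR0 ler_expR oppr_le0 invr_ge0.
exact: ltW.
Qed.

(** With v = 1 / x, exp v = exp (v / (n+2))^(n+2) >= (v / (n+2))^(n+2), which gives the constant. A
    quadratic bound is all that differentiability at 0 requires. *)
Lemma flat_sqr_bound n : exists2 C, 0 <= C & forall x, `|flat n x| <= C * x ^+ 2.
Proof.
exists (n.+2%:R ^+ n.+2); first by rewrite exprn_ge0.
move=> x; rewrite ger0_norm ?flat_ge0 // /flat; case: ifP => x0; last first.
  by rewrite mulr_ge0 ?sqr_ge0 ?exprn_ge0.
have v0 : 0 < x^-1 by rewrite invr_gt0.
have : (x^-1 / n.+2%:R) ^+ n.+2 <= expR x^-1.
  have -> : expR x^-1 = expR (x^-1 / n.+2%:R) ^+ n.+2.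
    by rewrite -expRM_natl; congr expR; rewrite mulrC divfK // pnatr_eq0.
  rewrite lerXn2r ?nnegrE ?expR_ge0 ?divr_ge0 ?(ltW v0)//.
  by apply: le_trans (expR_ge1Dx _); rewrite lerDr.
rewrite expRN ler_pdivrMr ?expR_gt0 // => h.
apply: le_trans (ler_wpM2l _ h); last by rewrite mulr_ge0 ?sqr_ge0 ?exprn_ge0.
rewrite expr_div_n !exprVn [leRHS](_ : _ = (x ^+ n)^-1) //.
have a0 : n.+2%:R ^+ n.+2 != 0 :> R by rewrite expf_neq0.
have b0 : x ^+ n != 0 by rewrite expf_neq0 // gt_eqF.
rewrite -(addn2 n) !exprD in a0 *; field.
rewrite b0 (gt_eqF x0) andbT /=; move: a0; rewrite mulf_eq0 negb_or => /andP[-> _].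
by rewrite andbT -natrD pnatr_eq0 addn2.
Qed.

Lemma has_derive_sqr_bound f C : (forall t, `|f t| <= C * t ^+ 2) ->
  has_derive (0 : R) 1 f 0.
Proof.
move=> H; have C0 : 0 <= C by have := le_trans (normr_ge0 _) (H 1); rewrite expr1n mulr1.
have f0 : f 0 = 0 by apply/eqP; rewrite -normr_le0; have := H 0; rewrite expr0n mulr0.
have L : h^-1 *: ((f \o shift (0 : R)) (h *: (1 : R)) - f 0) @[h --> 0^'] --> (0 : R).
  apply/cvgr0Pnorm_lt => e e0.
  exists (e / (C + 1)) => /=; first by rewrite divr_gt0 //; lra.
  move=> h /=; rewrite sub0r normrN => hC h0.
  rewrite f0 subr0 /= addr0 -[h *: 1]/(h * 1) mulr1 -[_ *: _]/(_ * _) normrM normfV.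
  have h1 : 0 < `|h| by rewrite normr_gt0.
  rewrite ltr_pdivrMl //; apply: le_lt_trans (H h) _.
  rewrite -(real_normK (num_real h)) expr2 mulrA [`|h| * e]mulrC ltr_pM2r //.
  move: hC; rewrite ltr_pdivlMr; last by lra.
  by move: h1; move: (`|h|) => a a0; nra.
by apply: DeriveDef; [apply/cvg_ex; exists 0|apply: cvg_lim].
Qed.

Lemma has_derive_flat n x :
  has_derive x 1 (flat n) (flat n.+2 x - n%:R * flat n.+1 x).
Proof.
have [x0|x0|x0] := ltgtP 0 x.
- apply: (@near_is_derive _ _ (fun t => t^-1 ^+ n * expR (- t^-1))).
    near=> t; rewrite /flat ifT //; near: t.
    by apply: open_nbhs_nbhs; split; [exact: open_gt|].
  have xn : x != 0 by rewrite gt_eqF.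
  have D : has_derive x 1 (fun t : R => t^-1) (- x ^- 2).
    apply: is_deriveE.
      by apply: is_deriveVE; [exact: xn|exact: is_derive_idE].
    by rewrite mulr1.
  apply: is_deriveE.
    apply: is_deriveME; first exact: (is_deriveXE n D).
    apply: (is_derive_compE (f := expR)); first exact: is_derive_expR.
    exact: is_deriveNE D.
  rewrite /flat x0 /= -exprVn; move: (expR _) => E; move: (x^-1) => v.
  by case: n => [|n]; rewrite ?exprS /=; ring.
- rewrite !flat_le0 ?(ltW x0) // mulr0 subr0.
  apply: (@near_is_derive _ _ (fun=> 0)); last exact: is_derive_cstE.
  near=> t; rewrite flat_le0 // ltW //; near: t.
  by apply: open_nbhs_nbhs; split; [exact: open_lt|].
rewrite -x0 !flat_le0 // mulr0 subr0; have [C _ H] := flat_sqr_bound n.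
exact: has_derive_sqr_bound H.
Unshelve. all: by end_near. Qed.

(* Closed under differentiation, so its members are smooth. *)
Inductive flat_class : (R -> R) -> Prop :=
| flat_class_flat n : flat_class (flat n)
| flat_class_cst c : flat_class (fun=> c)
| flat_class_add f g : flat_class f -> flat_class g -> flat_class (fun t => f t + g t)
| flat_class_mul f g : flat_class f -> flat_class g -> flat_class (fun t => f t * g t)
| flat_class_affine a b f : flat_class f -> flat_class (fun t => f (a * t + b)).

Lemma flat_class_derive f : flat_class f ->
  exists2 f', flat_class f' & forall x, has_derive x 1 f (f' x).
Proof.
elim=> [n|c|{}f g _ [f' Ff' Hf] _ [g' Fg' Hg]|{}f g Ff [f' Ff' Hf] Fg [g' Fg' Hg]
       |a b {}f _ [f' Ff' Hf]].
- exists (fun t => flat n.+2 t + (- n%:R) * flat n.+1 t).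
    apply: flat_class_add; first exact: flat_class_flat.
    by apply: (flat_class_mul (flat_class_cst _)); exact: flat_class_flat.
  move=> x; apply: is_deriveE; first exact: has_derive_flat.
  by rewrite mulNr.
- by exists (fun=> 0); [exact: flat_class_cst|move=> x; exact: is_derive_cstE].
- exists (fun t => f' t + g' t); first exact: flat_class_add.
  by move=> x; exact: is_deriveDE.
- exists (fun t => f t * g' t + g t * f' t).
    by apply: flat_class_add; exact: flat_class_mul.
  by move=> x; exact: is_deriveME.
exists (fun t => f' (a * t + b) * a).
  by apply: (flat_class_mul (flat_class_affine _ _ Ff') (flat_class_cst a)).
move=> x; apply: is_deriveE.
  apply: (is_derive_compE (F := fun t => a * t + b)); first exact: Hf.
  apply: is_deriveDE; last exact: is_derive_cstE.
  apply: is_deriveME; [exact: is_derive_cstE|exact: is_derive_idE].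
by rewrite /=; ring.
Qed.

Lemma flat_cvg (s : R) : flat 0 (k%:R * s) @[k --> \oo] --> ((0 < s)%R%:R : R).
Proof.
have [s0|s0] := ltP 0 s; last first.
  rewrite (_ : (fun _ => _) = fun=> 0); first exact: cvg_cst.
  by apply/funext => k; rewrite flat_le0 // mulr_ge0_le0.
have -> : (true%:R : R) = expR (- 0) by rewrite oppr0 expR0.
have L : expR (- (k.+1%:R^-1 * s^-1)) @[k --> \oo] --> expR (- (0 * s^-1)).
  apply: (@cvg_comp _ _ _ (fun k => - (k.+1%:R^-1 * s^-1)) expR); last exact: continuous_expR.
  apply: cvgN; apply: cvgM; last exact: cvg_cst.
  exact: cvg_harmonic.
rewrite mul0r in L; rewrite -(cvg_shiftS (fun k => flat 0 (k%:R * s))) /=.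
rewrite (_ : (fun _ => _) = fun k => expR (- (k.+1%:R^-1 * s^-1))) //.
apply/funext => k; rewrite /flat ifT ?mulr_gt0 // expr0 mul1r invfM //.
Qed.

End flat.

(** * Smooth bump functions on boxes *)

Section tensor.
Context {R : realType} {N : nat}.
Implicit Types (x : 'rV[R]_N) (h : 'I_N -> R -> R).

Definition tensor h x : R := \prod_i h i (x 0 i).

Lemma continuous_tensor h : (forall i, continuous (h i)) -> continuous (tensor h).
Proof.
move=> ch x; apply: prodr_at => i; apply: (comp_at (f := fun t : 'rV[R]_N => t 0 i)).
  exact: coord_continuous.
exact: ch.
Qed.

Lemma has_derive_tensor h j (h' : R -> R) : (forall t : R, has_derive t 1 (h j) (h' t)) ->
  forall x, has_derive x (delta_mx 0 j) (tensor h)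
    (tensor (fun i => if i == j then h' else h i) x).
Proof.
move=> Hj x; pose C := \prod_(i | i != j) h i (x 0 i).
apply: line_is_derive.
rewrite (_ : (fun _ => _) = fun t => h j (x 0 j + t) * C); last first.
  apply/funext => t; rewrite /tensor (bigD1 j) //= !mxE !eqxx mulr1; congr (_ * _).
  by apply: eq_bigr => i /negbTE ij; rewrite !mxE ij andbF mulr0 addr0.
rewrite /tensor (bigD1 j) //= eqxx.
rewrite (eq_bigr (fun i => h i (x 0 i))) -/C; last by move=> i /negbTE ->.
apply: is_deriveE.
  apply: is_deriveME; last exact: is_derive_cstE.
  apply: (is_derive_compE (F := fun t => x 0 j + t)); first exact: Hj.
  apply: is_deriveDE; [exact: is_derive_cstE|exact: is_derive_idE].
by rewrite /= !addr0; ring.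
Qed.

Lemma smooth_tensor h : (forall i, flat_class (h i)) -> smooth (tensor h).
Proof.
move=> Fh s.
have [h' Fh' ->] : exists2 h', (forall i, flat_class (h' i)) &
    iter_partial s (tensor h) = tensor h'.
  elim: s => [|j s [h' Fh' E]]; first by exists h.
  have [k Fk Hk] := flat_class_derive (Fh' j).
  exists (fun i => if i == j then k else h' i); first by move=> i; case: ifP.
  rewrite /= E; apply/funext => x; rewrite /partial.
  by case: (has_derive_tensor Hk x).
split=> [|i x].
  by apply: continuous_tensor => i t; have [k _ Hk] := flat_class_derive (Fh' i);
     exact: is_derive_continuous (Hk t).
by have [k _ Hk] := flat_class_derive (Fh' i); case: (has_derive_tensor Hk x).
Qed.

Lemma compact_cbox (a b : 'I_N -> R) : compact (cbox a b).
Proof. by apply: (@rV_compact _ N (fun i => `[a i, b i]%classic)) => i; exact: segment_compact. Qed.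

(** [flat 0], dilated by k in the signed distances to the 2 N faces, approximates the indicator of
    the open box from inside. *)
Definition box_bump (a b : 'I_N -> R) (k : nat) : 'rV[R]_N -> R :=
  tensor (fun i t => flat 0 (k%:R * (t - a i)) * flat 0 (k%:R * (b i - t))).

Lemma bump_class (a b : 'I_N -> R) (k : nat) (i : 'I_N) :
  flat_class (fun t => flat 0 (k%:R * (t - a i)) * flat 0 (k%:R * (b i - t))).
Proof.
apply: flat_class_mul.
  rewrite (_ : (fun _ => _) = fun t : R => flat 0 (k%:R * t + - (k%:R * a i))).
    by apply: flat_class_affine; exact: flat_class_flat.
  by apply/funext => t; rewrite mulrBr.
rewrite (_ : (fun _ => _) = fun t : R => flat 0 (- k%:R * t + k%:R * b i)).
  by apply: flat_class_affine; exact: flat_class_flat.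
by apply/funext => t; congr flat; ring.
Qed.

Lemma bump_ge0 a b k x : 0 <= box_bump a b k x.
Proof. by apply: prodr_ge0 => i _; rewrite mulr_ge0 ?flat_ge0. Qed.

Lemma bump_le1 a b k x : box_bump a b k x <= 1.
Proof.
rewrite /box_bump /tensor; apply: prodr_ile1 => i _.
by rewrite mulr_ge0 ?flat_ge0 //= mulr_ile1 ?flat_ge0 ?flat0_le1.
Qed.

Lemma bump_eq0 a b k x : ~ obox a b x -> box_bump a b k x = 0.
Proof.
move=> /existsNP[i] /negP xi; rewrite /box_bump /tensor (bigD1 i) //=.
move: xi; rewrite in_itv /= negb_and -!leNgt => /orP[xi|xi].
  by rewrite flat_le0 ?mul0r // mulr_ge0_le0 // subr_le0.
by rewrite [X in _ * X * _]flat_le0 ?mulr0 ?mul0r // mulr_ge0_le0 // subr_le0.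
Qed.

Lemma bump_cvg a b x : box_bump a b k x @[k --> \oo] --> (\1_(obox a b) x : R).
Proof.
rewrite (_ : \1_(obox a b) x = \prod_i ((a i < x 0 i)%R%:R * (x 0 i < b i)%R%:R)); last first.
  rewrite indicE; have [xab|xab] := boolP (x \in obox a b).
    rewrite big1 // => i _; move: xab; rewrite inE => /(_ i); rewrite /= in_itv /=.
    by move=> /andP[-> ->]; rewrite mulr1.
  move: xab; rewrite notin_setE => /existsNP[i] /negP; rewrite /= in_itv /=.
  by move=> /negbTE xi; rewrite (bigD1 i) //= -natrM mulnb xi mul0r.
rewrite /box_bump /tensor.
elim: (index_enum _) => [|i r IHr].
  rewrite big_nil (_ : (fun _ => _) = fun=> 1); first exact: cvg_cst.
  by apply/funext => t; rewrite big_nil.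
rewrite big_cons.
rewrite (_ : (fun _ => _) = fun k => flat 0 (k%:R * (x 0 i - a i)) * flat 0 (k%:R * (b i - x 0 i)) *
   \prod_(j <- r) (flat 0 (k%:R * (x 0 j - a j)) * flat 0 (k%:R * (b j - x 0 j)))); last first.
  by apply/funext => t; rewrite big_cons.
apply: cvgM => //; apply: cvgM; rewrite -subr_gt0; exact: flat_cvg.
Qed.

Lemma bump_test (D : set 'rV[R]_N) a b k : cbox a b `<=` D -> test_function D (box_bump a b k).
Proof.
move=> abD.
have sub : closure [set x | box_bump a b k x != 0] `<=` cbox a b.
  rewrite closureE; apply: smallest_sub.
    by apply: compact_closed; [exact: norm_hausdorff|exact: compact_cbox].
  move=> x /= /eqP xk i; apply: contrapT => xi; apply: xk; apply: bump_eq0 => xo.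
  apply: xi; have := xo i; rewrite /= !in_itv /= => /andP[h1 h2].
  by rewrite !ltW.
split; first by apply: smooth_tensor => i; exact: bump_class.
  apply: (subclosed_compact _ (@compact_cbox a b) sub); exact: closed_closure.
exact: subset_trans sub abD.
Qed.

End tensor.

(** * The fundamental lemma of the calculus of variations *)

Section fundamental_lemma.
Context {R : realType} {N : nat}.
Implicit Types (f : 'rV[R]_N -> R).
Local Notation mu := (@lebesgue_row R N).

Lemma integral_supp_sub (D Q : set 'rV[R]_N) f : Q `<=` D ->
  (forall x, ~ Q x -> f x = 0) ->
  (\int[mu]_(x in D) (f x)%:E = \int[mu]_(x in Q) (f x)%:E)%E.
Proof.
move=> QD sf; rewrite [LHS]integral_mkcond [RHS]integral_mkcond.
apply: eq_integral => x _; rewrite !patchE.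
have [xQ|xQ] := boolP (x \in Q).
  by rewrite ifT // inE; apply: QD; rewrite inE in xQ.
by rewrite notin_setE in xQ; rewrite (sf x xQ) if_same.
Qed.

Lemma cbox_measurable_bounded (D : set 'rV[R]_N) f (a b : 'I_N -> R) k :
  locally_integrable_row D f -> cbox a b `<=` D ->
  mu.-integrable (cbox a b) (fun x => (f x * box_bump a b k x)%:E).
Proof.
move=> [_ lf] abD.
have If := lf _ (@compact_cbox R N a b) abD.
have -> : (fun x => (f x * box_bump a b k x)%:E) = ((EFin \o box_bump a b k) \* (EFin \o f))%E.
  by apply/funext => x /=; rewrite -EFinM mulrC.
apply: integrableMr => //.
- exact: measurable_cbox.
- apply: measurable_funS (@subsetT _ _) _ => //; apply: continuous_measurable_row.
  by have [s _ _] := @bump_test R N _ a b k (@subset_refl _ (cbox a b)); exact: (s [::]).1.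
exists 1; split => // y y1 x _ /=; rewrite ger0_norm ?bump_ge0 //.
exact: le_trans (bump_le1 _ _ _ _) (ltW y1).
Qed.

Lemma integral_obox_eq0 (D : set 'rV[R]_N) f (a b : 'I_N -> R) :
  locally_integrable_row D f -> cbox a b `<=` D ->
  (forall phi, test_function D phi -> (\int[mu]_(x in D) (f x * phi x)%:E = 0)%E) ->
  (\int[mu]_(x in obox a b) (f x)%:E = 0)%E.
Proof.
move=> lf abD H; have [mf lf'] := lf.
have If := lf' _ (@compact_cbox R N a b) abD.
have mQ := @measurable_cbox R N a b.
have mo := @measurable_obox R N a b.
have [] := @dominated_convergence _ _ _ mu (cbox a b) mQ
  (fun k x => (f x * box_bump a b k x)%:E) (fun x => (f x * \1_(obox a b) x)%:E)
  (fun x => `|(f x)%:E|%E).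
- by move=> k; apply: measurable_int; exact: (cbox_measurable_bounded k lf abD).
- apply/measurable_EFinP; apply: measurable_funM; last exact: measurable_indic.
  by apply/measurable_EFinP; exact: (measurable_int _ If).
- apply: aeW => x _; apply: cvg_EFin; first by near=> k.
  by apply: cvgM; [exact: cvg_cst|exact: bump_cvg].
- exact: integrable_abse.
- apply: aeW => x k _; rewrite abse_EFin lee_fin normrM ler_piMr //.
  by rewrite ger0_norm ?bump_ge0 // bump_le1.
move=> _ _.
rewrite (_ : (fun _ => _) = fun=> 0%E); last first.
  apply/funext => k; rewrite -(@integral_supp_sub D) //; first exact: H (bump_test _ abD).
  move=> x xQ; rewrite bump_eq0 ?mulr0 // => xo; apply: xQ; exact: obox_sub_cbox.
have <- : (\int[mu]_(x in cbox a b) (f x * \1_(obox a b) x)%:E =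
    \int[mu]_(x in obox a b) (f x)%:E)%E.
  rewrite (@integral_supp_sub (cbox a b) (obox a b)).
  - by apply: eq_integral => x xo; rewrite indicE xo mulr1.
  - exact: obox_sub_cbox.
  - by move=> x xo; rewrite indicE memNset // mulr0.
by move=> /cvg_lim <- //; exact: lim_cst.
Unshelve. all: by end_near. Qed.

(** Dominated convergence along the bumps makes the integral of f vanish on every open box inside;
    Dynkin's lemma extends this to all measurable subsets of the box. *)
Lemma ae_eq0_obox (D : set 'rV[R]_N) f (a b : 'I_N -> R) :
  locally_integrable_row D f -> cbox a b `<=` D ->
  (forall phi, test_function D phi -> (\int[mu]_(x in D) (f x * phi x)%:E = 0)%E) ->
  ae_eq mu (obox a b) (EFin \o f) (cst 0%E).
Proof.
move=> lf abD H; have [mf lf'] := lf.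
have If := lf' _ (@compact_cbox R N a b) abD.
have mQ := @measurable_cbox R N a b.
have mo := @measurable_obox R N a b.
have Io : mu.-integrable (obox a b) (EFin \o f).
  by apply: integrableS If => //; exact: obox_sub_cbox.
have mfo : measurable_fun (obox a b) f by apply/measurable_EFinP; exact: (measurable_int _ Io).
have box0 c d : (\int[mu]_(x in obox c d `&` obox a b) (f x)%:E = 0)%E.
  rewrite oboxI; apply: integral_obox_eq0 lf _ H; apply: subset_trans abD.
  move=> x h i; have := h i; rewrite /= !in_itv /= ge_max le_min.
  by move=> /andP[/andP[_ ->] /andP[_ ->]].
suff HH S : measurable S -> (\int[mu]_(x in S `&` obox a b) (f x)%:E = 0)%E.
  apply: integral_ae_eq => //.
  by move=> E Eo mE; rewrite integral0 -(setIidl Eo); exact: HH.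
rewrite oboxes_measurableE; move: S.
apply: (@dynkin_induction _ _ (@oboxes R N)
  (fun S => (\int[mu]_(x in S `&` obox a b) (f x)%:E = 0)%E)).
- exact: oboxes_measurableE.
- by move=> _ _ [c [d ->]] [c' [d' ->]]; rewrite oboxI; eexists; eexists.
- by rewrite setTI -(setIid (obox a b)); exact: box0.
- by move=> _ [c [d ->]]; exact: box0.
- move=> S mS S0; have := box0 a b; rewrite setIid.
  rewrite -{1}(setUIDK (obox a b) S) integral_setU; first last.
  - by apply/disj_setPS => x [[_ xS] [_ /(_ xS)]].
  - by rewrite setUIDK; exact/measurable_EFinP.
  - exact: measurableD.
  - exact: measurableI.
  by rewrite [obox a b `&` S]setIC S0 add0e setIC -setDE.
move=> F mF tF F0; rewrite setI_bigcupl integral_bigcup.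
- by apply: eseries0 => k _ _; exact: F0.
- exact: trivIset_setIr.
- by move=> k; apply: measurableI.
- rewrite -setI_bigcupl; apply: integrableS Io => //.
  by apply: measurableI => //; exact: bigcupT_measurable.
Qed.

Lemma ae_eq0_open (D : set 'rV[R]_N) f : open D -> locally_integrable_row D f ->
  (forall phi, test_function D phi -> (\int[mu]_(x in D) (f x * phi x)%:E = 0)%E) ->
  {ae mu, forall x, D x -> f x = 0}.
Proof.
move=> oD lf H; have [B [DE HB]] := open_box_cover oD.
have : {ae mu, forall x, forall k, B k x -> f x = 0}.
  apply: ae_foralln => k; have [->|[a [b [-> sub]]]] := HB k; first exact: aeW.
  have := ae_eq0_obox lf sub H; apply: filterS => x h xo.
  by have := h xo => -[].
by apply: filterS => x h; rewrite DE => -[k _]; exact: h.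
Qed.

End fundamental_lemma.

(** * Integrability over the ball *)

Section conf_integrability.
Context {R : realType}.
Variables (N : nat) (th : R).
Hypotheses (th0 : 0 < th) (th1 : th <= 1).
Local Notation mu := (@lebesgue_row R N).

Definition posp (t : R) : R := Num.max t 0.
(* A C^1 regularization of [t_+ ^ th]: integrating the divergence of
   [cutoff e (1 - |x|^2) x] bounds the integral of [cutoff' e (1 - |x|^2) |x|^2]
   uniformly in [e]. *)
Definition cutoff (e t : R) := posp t ^+ 2 * ((posp t + e) `^ th / (posp t + e) ^+ 2).
Definition cutoff' (e t : R) :=
  posp t * ((posp t + e) `^ th * (th * posp t + 2 * e) / (posp t + e) ^+ 3).

Lemma posp_ge0 t : 0 <= posp t.
Proof. by rewrite /posp le_max lexx orbT. Qed.

Lemma posp_pos t : 0 <= t -> posp t = t.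
Proof. by move=> t0; apply/max_idPl. Qed.

Lemma posp_neg t : t <= 0 -> posp t = 0.
Proof. by move=> t0; apply/max_idPr. Qed.

Lemma continuous_posp : continuous posp.
Proof.
have -> : posp = (fun t : R => (t + `|t| : R) * 2^-1).
  apply/funext => t; have [t0|t0] := leP 0 t.
    by rewrite posp_pos // ger0_norm //; field.
  by rewrite posp_neg ?ltr0_norm ?subrr ?mul0r // ltW.
move=> t; apply: (@mulr_at R R (fun t : R => t + `|t|) (fun=> 2^-1)); last exact: cst_at.
by apply: (@addr_at R R); [exact: cvg_id|exact: norm_continuous].
Qed.

Lemma powR_pos_at (T : topologicalType) (f : T -> R) (b : R) (t : T) :
  0 < f t -> {for t, continuous f} -> {for t, continuous (fun t => f t `^ b)}.
Proof.
move=> f0 cf; apply: (comp_at (f := f) (h := fun x => x `^ b)) => //.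
apply: is_derive_continuous; exact: is_derive1_powR.
Qed.

Lemma continuous_cutoff' e : 0 < e -> continuous (cutoff' e).
Proof.
move=> e0 t; have m0 := posp_ge0 t; have me : 0 < posp t + e by lra.
have cm : {for t, continuous posp} := @continuous_posp t.
have cme : {for t, continuous (fun t => posp t + e)} by apply: addr_at => //; exact: cst_at.
apply: mulr_at => //; apply: mulr_at; first apply: mulr_at.
- exact: powR_pos_at.
- by apply: addr_at; [apply: mulr_at => //; exact: cst_at|exact: cst_at].
by apply: invr_at; [rewrite expf_neq0 ?gt_eqF|exact: exprn_at].
Qed.

Lemma cutoff_ge0 e t : 0 < e -> 0 <= cutoff e t.
Proof.
move=> e0; have m0 := posp_ge0 t; rewrite /cutoff.
by rewrite mulr_ge0 ?exprn_ge0 // divr_ge0 ?powR_ge0 // exprn_ge0 // addr_ge0 // ltW.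
Qed.

Lemma cutoff_le2 e t : 0 < e -> e <= 1 -> t <= 1 -> cutoff e t <= 2.
Proof.
move=> e0 e1 t1; have m0 := posp_ge0 t.
have m1 : posp t <= 1 by rewrite /posp ge_max t1 ler01.
rewrite /cutoff; move: (posp t) m0 m1 => m m0 m1; have me : 0 < m + e by lra.
have A2 : (m + e) `^ th <= 2.
  apply: (@le_trans _ _ (2 `^ th)).
    by have th0_ := th0; rewrite ge0_ler_powR ?nnegrE //; lra.
  have th1_ := th1; rewrite -[leRHS](powRr1 (ler0n _ _)); by apply: ler_powR => //; lra.
have A0 := powR_ge0 (m + e) th.
rewrite mulrA ler_pdivrMr ?exprn_gt0 //.
have : m ^+ 2 <= (m + e) ^+ 2 by rewrite lerXn2r ?nnegrE //; lra.
have : 0 <= m ^+ 2 by exact: sqr_ge0.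
by move: ((m + e) `^ th) A2 A0 (m ^+ 2) ((m + e) ^+ 2) => A *; nra.
Qed.

Lemma cutoff'_ge0 e t : 0 < e -> 0 <= cutoff' e t.
Proof.
move=> e0; have m0 := posp_ge0 t; have th0_ := th0; rewrite /cutoff'.
by rewrite mulr_ge0 // divr_ge0 ?exprn_ge0 ?mulr_ge0 ?powR_ge0 //; nra.
Qed.

Lemma cutoff'_ge e t : 0 < e -> e <= t -> th * (t `^ th) / (4 * t) <= cutoff' e t.
Proof.
move=> e0 et; have th0_ := th0; rewrite /cutoff' posp_pos; last by lra.
have t0 : 0 < t by lra.
have te : 0 < t + e by lra.
have AB : t `^ th <= (t + e) `^ th by rewrite ge0_ler_powR ?nnegrE //; lra.
have B0 := powR_ge0 t th.
rewrite mulrA ler_pdivlMr ?exprn_gt0 // mulrAC ler_pdivrMr; last by lra.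
move: (t `^ th) ((t + e) `^ th) AB B0 => B A AB B0.
have h1 : (t + e) ^+ 2 <= 4 * t ^+ 2 by nra.
have h2 : th * (t + e) <= th * t + 2 * e by have th1_ := th1; nra.
have h3 : (th * B) * (t + e) ^+ 3 <= (th * A) * (t + e) * (4 * t ^+ 2).
  have h5 : B * (t + e) ^+ 2 <= A * (4 * t ^+ 2) by apply: ler_pM; rewrite ?sqr_ge0.
  have := ler_wpM2l (_ : 0 <= th * (t + e)) h5; rewrite [(_ ^+ 3)]exprS.
  have -> : th * B * ((t + e) * (t + e) ^+ 2) = th * (t + e) * (B * (t + e) ^+ 2) by ring.
  have -> : th * A * (t + e) * (4 * t ^+ 2) = th * (t + e) * (A * (4 * t ^+ 2)) by ring.
  by apply; nra.
have h4 : A * t * (4 * t) * (th * (t + e)) <= A * t * (4 * t) * (th * t + 2 * e).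
  by apply: ler_wpM2l h2; rewrite !mulr_ge0 //; lra.
move: h3 h4; rewrite !expr2 !exprS expr0; move=> h3 h4.
have -> : t * (A * (th * t + 2 * e)) * (4 * t) = A * t * (4 * t) * (th * t + 2 * e) by ring.
apply: le_trans h3 _; apply: le_trans h4.
by rewrite le_eqVlt; apply/orP; left; apply/eqP; ring.
Qed.

Lemma has_derive_cutoff e (t : R) : 0 < e -> has_derive t 1 (cutoff e) (cutoff' e t).
Proof.
move=> e0; have [t0|t0|t0] := ltgtP 0 t.
- apply: (@near_is_derive _ _ (fun t : R => t ^+ 2 * ((t + e) `^ th * (t + e) ^- 2))).
    near=> s; rewrite /cutoff posp_pos //; apply: ltW; near: s.
    by apply: open_nbhs_nbhs; split; [exact: open_gt|].
  have te : 0 < t + e by lra.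
  have D1 : has_derive t 1 (fun t : R => t + e) 1.
    apply: is_deriveE; first apply: is_deriveDE; [exact: is_derive_idE|exact: is_derive_cstE|].
    by rewrite addr0.
  have te2 : (t + e) ^+ 2 != 0 by rewrite expf_neq0 ?gt_eqF.
  apply: is_deriveE.
    apply: is_deriveME; first exact: (is_deriveXE 2 (is_derive_idE _)).
    apply: is_deriveME; last first.
      apply: is_deriveVE; [exact: te2|exact: (is_deriveXE 2 D1)].
    apply: (is_derive_compE (f := fun x => x `^ th)) D1.
    exact: is_derive1_powR.
  rewrite /cutoff' posp_pos ?ltW //=.
  have -> : (t + e) `^ th = (t + e) `^ (th - 1) * (t + e).
    rewrite -{3}(powRr1 (ltW te)) -powRD; first by rewrite subrK.
    by rewrite (gt_eqF te) implybT.
  by field; rewrite gt_eqF.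
- apply: (@near_is_derive _ _ (fun=> 0)).
    near=> s; rewrite /cutoff posp_neg ?expr0n ?mul0r //; apply: ltW; near: s.
    by apply: open_nbhs_nbhs; split; [exact: open_lt|].
  by rewrite /cutoff' posp_neg ?mul0r ?(ltW t0) //; exact: is_derive_cstE.
rewrite -t0 /cutoff' posp_neg // mul0r.
apply: (@has_derive_sqr_bound _ _ (e ^- 2 + e^-1)) => s.
rewrite ger0_norm ?cutoff_ge0 // /cutoff.
have m0 := posp_ge0 s; have me : 0 < posp s + e by lra.
have ms : posp s ^+ 2 <= s ^+ 2.
  by have [s0|/ltW s0] := leP 0 s; [rewrite posp_pos|rewrite posp_neg // expr0n sqr_ge0].
rewrite mulrC; apply: ler_pM => //; first by rewrite divr_ge0 ?powR_ge0 // exprn_ge0 // ltW.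
  exact: sqr_ge0.
move: (posp s) m0 me {ms} => m m0 me.
have A2 : (m + e) `^ th <= 1 + (m + e).
  have th0_ := th0; have th1_ := th1.
  have [h|/ltW h] := leP (m + e) 1.
    apply: (@le_trans _ _ (1 `^ th)); last by rewrite powR1; lra.
    by rewrite ge0_ler_powR ?nnegrE //; lra.
  apply: (@le_trans _ _ ((m + e) `^ 1)); first by apply: ler_powR => //; lra.
  by rewrite powRr1; lra.
apply: (@le_trans _ _ ((1 + (m + e)) / (m + e) ^+ 2)).
  by rewrite ler_pM2r ?invr_gt0 ?exprn_gt0.
have -> : (1 + (m + e)) / (m + e) ^+ 2 = (m + e) ^- 2 + (m + e)^-1.
  by field; rewrite gt_eqF.
apply: lerD; rewrite lef_pV2 ?posrE ?exprn_gt0 //; last by lra.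
by rewrite lerXn2r ?nnegrE //; lra.
Unshelve. all: by end_near. Qed.

Let tau (x : 'rV[R]_N) : R := 1 - dotr x x.

Let continuous_tau x : {for x, continuous tau}.
Proof. by apply: addr_at; [exact: cst_at|apply: oppr_at; exact: continuous_dotr]. Qed.

Let has_derive_tau x i : has_derive x (delta_mx 0 i) tau (- (2 * x 0 i)).
Proof.
apply: is_deriveE; first apply: is_deriveDE; first exact: is_derive_cstE.
  by apply: is_deriveNE; exact: has_derive_dotr.
by rewrite add0r.
Qed.

Let tau_out x : ~ cube 1 x -> tau x <= 0.
Proof.
by move=> xc; rewrite leNgt; apply/negP; rewrite subr_gt0 => /hball_cube.
Qed.

Let tau_le1 x : tau x <= 1.
Proof. by rewrite /tau lerBlDr lerDl dotr_ge0. Qed.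

Let ccutoff e : 0 < e -> continuous (fun x => cutoff e (tau x)).
Proof.
move=> e0 x; apply: (comp_at (f := tau)) => //.
exact: is_derive_continuous (has_derive_cutoff _ e0).
Qed.

Let ccutoff' e i : 0 < e ->
  continuous (fun x : 'rV[R]_N => 2 * x 0 i ^+ 2 * cutoff' e (tau x)).
Proof.
move=> e0 x; apply: (@mulr_at R _ (fun x : 'rV[R]_N => 2 * x 0 i ^+ 2)).
  by apply: mulr_at; [exact: cst_at|apply: exprn_at; exact: coord_continuous].
by apply: (comp_at (f := tau)) => //; exact: continuous_cutoff'.
Qed.

Let cutoff_out e x : ~ cube 1 x -> cutoff e (tau x) = 0.
Proof. by move=> /tau_out h; rewrite /cutoff posp_neg // expr0n mul0r. Qed.

Let cutoff'_out e i x : ~ cube 1 x -> 2 * x 0 i ^+ 2 * cutoff' e (tau x) = 0.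
Proof. by move=> /tau_out h; rewrite /cutoff' posp_neg // mul0r mulr0. Qed.

(** The integrand of the difference is the i-th partial derivative of x_i cutoff (1 - |x|^2). The
    right-hand side is bounded uniformly in e, although the left-hand one approaches a singular
    integral. *)
Lemma integral_cutoff' e i : 0 < e ->
  (\int[mu]_x (2 * x 0 i ^+ 2 * cutoff' e (1 - dotr x x))%:E =
   \int[mu]_x (cutoff e (1 - dotr x x))%:E)%E.
Proof.
move=> e0; rewrite -/tau.
have [M bM] := bounded_supp (ccutoff e0) (@cutoff_out e).
have [M' bM'] := bounded_supp (@ccutoff' _ i e0) (@cutoff'_out e i).
have I1 := integrable_supp (continuous_measurable_row (ccutoff e0)) (@cutoff_out e) bM.
have I2 := integrable_supp (continuous_measurable_row (@ccutoff' _ i e0)) (@cutoff'_out e i) bM'.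
have : (\int[mu]_x ((cutoff e (tau x))%:E - (2 * x 0 i ^+ 2 * cutoff' e (tau x))%:E) = 0)%E.
  under eq_integral do rewrite -EFinB.
  apply: (@int_partial_eq0 _ _ i (fun x => x 0 i * cutoff e (tau x)) _ 1).
  - move=> x; apply: (@addr_at R _ (fun x => cutoff e (tau x))
      (fun x => - (2 * x 0 i ^+ 2 * cutoff' e (tau x)))); first exact: ccutoff.
    by apply: oppr_at; exact: ccutoff'.
  - move=> x; apply: is_deriveE.
      apply: is_deriveME; first exact: has_derive_coord.
      apply: (is_derive_compE (F := tau)); first exact: has_derive_cutoff.
      exact: has_derive_tau.
    by rewrite eqxx /=; ring.
  - by move=> x xc; rewrite cutoff_out // mulr0.
  - by move=> x xc; rewrite cutoff_out // cutoff'_out // subr0.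
rewrite integralB_EFin //.
have fin1 := integrable_fin_num measurableT I1.
have fin2 := integrable_fin_num measurableT I2.
by move=> h; rewrite -[RHS](subeK _ fin2) // h add0e.
Qed.

(** With t = 1 - |x|^2 the left-hand side is at most 2 t^(th-1). For t >= 1/2 this is at most 4. For
    t <= 1/2 one has 2 |x|^2 >= 1, so the sum is at least cutoff' >= th t^(th-1) / 4, and 8 / th is
    the resulting ratio. *)
Lemma conf_powR_le e (x : 'rV[R]_N) : 0 < e -> e <= 1 - dotr x x ->
  conf x `^ (1 - th) <= 4 + 8 / th * \sum_i (2 * x 0 i ^+ 2 * cutoff' e (1 - dotr x x)).
Proof.
have th0_ := th0; have th1_ := th1.
move=> e0 et; rewrite -mulr_suml -mulr_sumr.
have -> : \sum_i x 0 i ^+ 2 = dotr x x by apply: eq_bigr => i _; rewrite expr2.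
have b0 := cutoff'_ge0 (1 - dotr x x) e0; have b1 := cutoff'_ge e0 et.
have := tau_le1 x; rewrite /tau => t1.
have -> : dotr x x = 1 - (1 - dotr x x) by ring.
rewrite /conf; move: (1 - dotr x x) et b0 b1 t1 => t et.
rewrite [1 - (1 - t)](_ : _ = t); last by ring.
move: (cutoff' e t) => b b0 b1 t1; have t0 : 0 < t by lra.
have c0 : 0 < 2 / t by rewrite divr_gt0.
have h : (2 / t) `^ (1 - th) <= 2 / t * t `^ th.
  have E1 : 2 / t = (2 / t) `^ (1 - th) * (2 / t) `^ th.
    by rewrite -powRD ?subrK ?powRr1 ?(ltW c0) // (gt_eqF c0) implybT.
  rewrite {2}E1 -mulrA -powRM ?(ltW c0) ?(ltW t0) // divfK ?gt_eqF //.
  rewrite ler_peMr ?powR_ge0 //.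
  by rewrite -[leLHS](powRr0 2); apply: ler_powR => //; lra.
apply: le_trans h _.
have A0 := powR_ge0 t th.
have A1 : t `^ th <= 1.
  apply: (@le_trans _ _ (1 `^ th)); last by rewrite powR1.
  by rewrite ge0_ler_powR ?nnegrE //; lra.
have [t2|/ltW t2] := leP (2^-1) t.
  have : 2 / t * t `^ th <= 4 by rewrite mulrAC ler_pdivrMr //; lra.
  move=> /le_trans; apply; rewrite lerDl mulr_ge0 ?divr_ge0 ?mulr_ge0 //; lra.
have h1 : 2 / t * t `^ th <= 8 / th * b.
  have := ler_wpM2l (_ : 0 <= 8 / th) b1 => /(_ ltac:(by rewrite divr_ge0 ?ltW)).
  move=> h; apply: le_trans h; rewrite le_eqVlt; apply/orP; left; apply/eqP.
  by field; rewrite !gt_eqF.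
have h2 : 8 / th * b <= 8 / th * (2 * (1 - t) * b).
  apply: ler_wpM2l; first by rewrite divr_ge0 ?ltW.
  by rewrite ler_peMl //; lra.
by apply: le_trans h1 _; apply: le_trans h2 _; rewrite lerDr.
Qed.

Let E n : set 'rV[R]_N := [set x | n.+1%:R^-1 <= 1 - dotr x x].

(** On the set 1 - |x|^2 >= 1 / (n+1) the pointwise bound applies with e = 1 / (n+1). The singular
    terms are exchanged for integrals of [cutoff] <= 2 over the cube, so the bound [B] is
    independent of n, and monotone convergence reaches the ball. *)
Lemma integrable_conf_powR :
  mu.-integrable hball (fun x => (conf x `^ (1 - th))%:E).
Proof.
have mh := @measurable_hball R N; have mc := @measurable_cube R N 1.
have mconf : measurable_fun hball (fun x : 'rV[R]_N => conf x `^ (1 - th)).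
  apply: open_continuous_measurable_row; first exact: open_hball.
  by move=> x xB; apply: powR_pos_at; [exact: conf_gt0|exact: continuous_conf].
have mE n : measurable (E n).
  rewrite -[E n]setCK; apply: measurableC; apply: open_measurable_row.
  rewrite (_ : ~` E n = tau @^-1` [set t : R | t < n.+1%:R^-1]).
    by apply: open_comp; [move=> x _; exact: continuous_tau|exact: open_lt].
  by apply/seteqP; split => x; rewrite /E /tau /= ltNge; [move/negP|move=> ?; apply/negP].
have EB n : E n `<=` hball.
  move=> x; rewrite /E /hball /= => h; rewrite -subr_gt0; apply: lt_le_trans h.
  by rewrite invr_gt0.
have UE : \bigcup_n E n = hball.
  apply/seteqP; split => [x [n _ /EB]//|x]; rewrite /hball /= -subr_gt0 => h.
  exists (Num.truncn (1 - dotr x x)^-1) => //; rewrite /E /=.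
  have := truncnS_gt (1 - dotr x x)^-1 => h1.
  by rewrite -[leRHS]invrK lef_pV2 ?posrE ?invr_gt0 // ltW.
apply/integrableP; split; first exact/measurable_EFinP.
under eq_integral do rewrite gee0_abs ?lee_fin ?powR_ge0 //.
pose B := (4%:E * mu (@cube R N 1) + (8 / th)%:E * \sum_(i < N) (2%:E * mu (@cube R N 1)))%E.
have finc : mu (@cube R N 1) \is a fin_num.
  by rewrite ge0_fin_numE ?measure_ge0 //; exact: cube_finite.
suff H n : (\int[mu]_(x in E n) (conf x `^ (1 - th))%:E <= B)%E.
  have L : (\int[mu]_(x in E n) (conf x `^ (1 - th))%:E @[n --> \oo] -->
      \int[mu]_(x in \bigcup_n E n) (conf x `^ (1 - th))%:E)%E.
    apply: ge0_nondecreasing_set_cvg_integral => //.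
    - move=> m n mn; apply/subsetPset => x; rewrite /E /=; apply: le_trans.
      by rewrite lef_pV2 ?posrE // ler_nat ltnS.
    - by move=> n; apply/measurable_EFinP; exact: measurable_funS mconf.
    - by move=> n x _; rewrite lee_fin powR_ge0.
  rewrite -UE -(cvg_lim _ L) //; apply: (@le_lt_trans _ _ B).
    by apply: lime_le; [apply/cvg_ex; eexists; exact: L|exact: nearW].
  have SF : (\sum_(i < N) (2%:E * mu (@cube R N 1)))%E \is a fin_num.
    by apply/sum_fin_numP => i _ _; exact: fin_numM.
  by rewrite ltey_eq /B fin_numD !fin_numM.
pose e : R := n.+1%:R^-1.
have e0 : 0 < e by rewrite invr_gt0.
have e1 : e <= 1 by rewrite invf_le1 // ler1n.
pose F i (x : 'rV[R]_N) : R := 2 * x 0 i ^+ 2 * cutoff' e (1 - dotr x x).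
have F0 i x : 0 <= F i x.
  by apply: mulr_ge0; [apply: mulr_ge0 => //; exact: sqr_ge0|exact: cutoff'_ge0].
have mF i : measurable_fun setT (fun x => (F i x)%:E).
  apply/measurable_EFinP; apply: continuous_measurable_row; exact: (@ccutoff' e i e0).
pose K (c : R) (x : 'rV[R]_N) : R := c * \1_(@cube R N 1) x.
have mK c : measurable_fun setT (fun x => (K c x)%:E).
  by apply/measurable_EFinP; apply: measurable_funM => //; exact: measurable_indic.
have K0 c x : 0 <= c -> (0 <= (K c x)%:E)%E by move=> c0; rewrite lee_fin mulr_ge0.
have intK c : 0 <= c -> (\int[mu]_x (K c x)%:E = c%:E * mu (@cube R N 1))%E.
  move=> c0; under eq_integral do rewrite EFinM.
  rewrite ge0_integralZl //; first by rewrite integral_indic // setIT.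
  by apply/measurable_EFinP; exact: measurable_indic.
have mS : measurable_fun setT (fun x => (8 / th)%:E * \sum_(i < N) (F i x)%:E)%E.
  by apply: emeasurable_funM => //; apply: emeasurable_sum.
have t80 : 0 <= 8 / th by rewrite divr_ge0 // ltW.
have S0 x : (0 <= (8 / th)%:E * \sum_(i < N) (F i x)%:E)%E.
  by rewrite mule_ge0 ?lee_fin // sume_ge0 // => i _; rewrite lee_fin.
apply: (@le_trans _ _ (\int[mu]_(x in E n) ((K 4 x)%:E +
    (8 / th)%:E * \sum_(i < N) (F i x)%:E))%E).
  apply: ge0_le_integral => //.
  - by move=> x _; rewrite lee_fin powR_ge0.
  - by apply/measurable_EFinP; exact: measurable_funS mconf.
  - by apply: emeasurable_funD; [exact: measurable_funS (mK 4)|exact: measurable_funS mS].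
  move=> x Ex; rewrite /K indicE mem_set; last by apply: hball_cube; exact: EB Ex.
  by rewrite mulr1 sumEFin -EFinM -EFinD lee_fin; exact: conf_powR_le.
apply: (@le_trans _ _ (\int[mu]_x ((K 4 x)%:E +
    (8 / th)%:E * \sum_(i < N) (F i x)%:E))%E).
  apply: ge0_subset_integral => //; first exact: emeasurable_funD.
  by move=> x _; rewrite adde_ge0 // K0.
rewrite ge0_integralD //; last by move=> x _; rewrite K0.
rewrite intK // ge0_integralZl //; first last.
- by move=> x _; rewrite sume_ge0 // => i _; rewrite lee_fin.
- exact: emeasurable_sum.
rewrite ge0_integral_sum //; last by move=> i x _; rewrite lee_fin.
apply: leeD2l; apply: lee_wpmul2l; first by rewrite lee_fin.
apply: lee_sum => i _; rewrite integral_cutoff' // -intK //.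
apply: ge0_le_integral => //.
- by move=> x _; rewrite lee_fin cutoff_ge0.
- by apply/measurable_EFinP; apply: continuous_measurable_row; exact: ccutoff.
move=> x _; rewrite lee_fin /K indicE; have [xc|xc] := boolP (x \in _).
  by rewrite mulr1 cutoff_le2 // tau_le1.
by rewrite notin_setE in xc; rewrite mulr0 -[X in cutoff e X]/(tau x) cutoff_out.
Qed.

End conf_integrability.

(** * Weak gradients agree almost everywhere *)

Section weak_gradient_unique.
Context {R : realType} {N : nat}.
Local Notation mu := (@lebesgue_row R N).
Local Notation D := (@hball R N).
Implicit Types (f v u phi : 'rV[R]_N -> R) (g G : 'rV[R]_N -> 'rV[R]_N).

Lemma locally_integrable_test v phi : locally_integrable_row D v ->
  test_function D phi -> mu.-integrable D (fun x => (v x * phi x)%:E).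
Proof.
move=> lv tphi; have [sphi cK KD] := tphi; have cphi := test_function_cc tphi.
set K := closure _ in cK KD; have [mK _] := compact_hball_measure cK KD.
have mD := @measurable_hball R N.
have K0 x : ~ K x -> phi x = 0.
  by move=> xK; apply: contrapT => /eqP h; apply: xK; exact: subset_closure.
have [M bM] := ball_cc_bounded cphi.
have I : mu.-integrable K (fun x => (v x * phi x)%:E).
  have -> : (fun x => (v x * phi x)%:E) = ((EFin \o phi) \* (EFin \o v))%E.
    by apply/funext => x /=; rewrite -EFinM mulrC.
  apply: integrableMr => //; last exact: lv.2.
    by apply: measurable_funS (@subsetT _ _) _ => //; exact: continuous_measurable_row cphi.1.
  by exists M; split => [|y My x _]; [exact: num_real|exact: le_trans (bM x) (ltW My)].
apply: (integrable_mkcond _ mD).2.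
have -> : (fun x => (v x * phi x)%:E) \_ D = (fun x => (v x * phi x)%:E) \_ K.
  apply/funext => x; rewrite !patchE; have [xK|xK] := boolP (x \in K).
    by rewrite ifT // inE; apply: KD; rewrite inE in xK.
  by rewrite notin_setE in xK; rewrite (K0 x xK) mulr0 if_same.
exact: (integrable_mkcond _ mK).1.
Qed.

Lemma locally_integrableB v1 v2 : locally_integrable_row D v1 ->
  locally_integrable_row D v2 -> locally_integrable_row D (fun x => v1 x - v2 x).
Proof.
move=> [m1 l1] [m2 l2]; split; first exact: measurable_funB.
move=> K cK KD; have [mK _] := compact_hball_measure cK KD.
exact: (integrableB mK (l1 K cK KD) (l2 K cK KD)).
Qed.

Lemma weak_partial_unique i u v1 v2 : is_weak_partial D i u v1 ->
  is_weak_partial D i u v2 -> {ae mu, forall x, D x -> v1 x = v2 x}.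
Proof.
move=> [_ l1 h1] [_ l2 h2]; have mD := @measurable_hball R N.
have : {ae mu, forall x, D x -> v1 x - v2 x = 0}.
  apply: ae_eq0_open (@open_hball R N) (locally_integrableB l1 l2) _ => phi tphi.
  have I1 := locally_integrable_test l1 tphi; have I2 := locally_integrable_test l2 tphi.
  under eq_integral do rewrite mulrBl EFinB.
  rewrite integralB_EFin //.
  have E : \int[mu]_(x in D) (v1 x * phi x) = \int[mu]_(x in D) (v2 x * phi x).
    by apply: oppr_inj; rewrite -h1 // -h2.
  have fin1 := integrable_fin_num mD I1; have fin2 := integrable_fin_num mD I2.
  by rewrite -(fineK fin1) -(fineK fin2) -/(Rintegral _ _ _) E -EFinB subrr.
by apply: filterS => x h /h /eqP; rewrite subr_eq0 => /eqP.
Qed.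

Lemma weak_gradient_unique u g G : is_weak_gradient D u g ->
  is_weak_gradient D u G -> {ae mu, forall x, D x -> g x = G x}.
Proof.
move=> hg hG; have : {ae mu, forall x, forall i : 'I_N, D x -> g x 0 i = G x 0 i}.
  by apply: filter_forall => i; exact: weak_partial_unique (hg i) (hG i).
by apply: filterS => x h xD; apply/rowP => i; exact: h.
Qed.

Lemma hgradP u G : is_weak_gradient D u G -> is_weak_gradient D u (hgrad u).
Proof. by move=> hG; apply: (xgetPex (fun=> 0)); exists G. Qed.

(** As [hgrad] is selected by choice, facts about an explicit gradient reach [H1], [H1norm] and
    [weak_solution] only through this equality. *)
Lemma hgrad_ae u G : is_weak_gradient D u G -> {ae mu, forall x, D x -> hgrad u x = G x}.
Proof. by move=> hG; exact: weak_gradient_unique (hgradP hG) hG. Qed.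

Lemma measurable_conf : measurable_fun D (@conf R N).
Proof.
apply: open_continuous_measurable_row; first exact: open_hball.
by move=> x; exact: continuous_conf.
Qed.

Lemma measurable_hgrad_dot g G :
  (forall i, measurable_fun D (fun x => g x 0 i)) ->
  (forall i, measurable_fun D (fun x => G x 0 i)) ->
  measurable_fun D (fun x => hgrad_dot x (g x) (G x)).
Proof.
move=> mg mG; apply: measurable_funM.
  apply: open_continuous_measurable_row; first exact: open_hball.
  move=> x xB; apply: invr_at; first by rewrite expf_neq0 // gt_eqF // conf_gt0.
  by apply: exprn_at; exact: continuous_conf.
by apply: measurable_sum => i; exact: measurable_funM.
Qed.

Lemma measurable_weak_gradient u g i : is_weak_gradient D u g ->
  measurable_fun D (fun x => g x 0 i).
Proof. by move=> /(_ i)[_ [] ]. Qed.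

Lemma ae_hintegrable f1 f2 : measurable_fun D f1 ->
  {ae mu, forall x, D x -> f1 x = f2 x} -> hintegrable f2 -> hintegrable f1.
Proof.
move=> m1 E I; have mD := @measurable_hball R N; apply/integrableP; split.
  apply/measurable_EFinP; apply: measurable_funM => //; apply: measurable_funX.
  exact: measurable_conf.
have [m2 I2] := integrableP _ _ _ I.
rewrite (ae_eq_integral (fun x => `|(f2 x * conf x ^+ N)%:E|%E)) //.
- apply: measurableT_comp => //; apply/measurable_EFinP; apply: measurable_funM => //.
  by apply: measurable_funX; exact: measurable_conf.
- by apply: measurableT_comp.
by apply: filterS E => x h xD /=; rewrite h.
Qed.

Lemma ae_hintegral f1 f2 : measurable_fun D f1 -> measurable_fun D f2 ->
  {ae mu, forall x, D x -> f1 x = f2 x} -> hintegral f1 = hintegral f2.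
Proof.
move=> m1 m2 E; rewrite /hintegral /Rintegral; congr fine.
have mc : measurable_fun D (fun x : 'rV[R]_N => conf x ^+ N).
  by apply: measurable_funX; exact: measurable_conf.
apply: ae_eq_integral.
- exact: measurable_hball.
- by apply/measurable_EFinP; exact: measurable_funM.
- by apply/measurable_EFinP; exact: measurable_funM.
by apply: filterS E => x h xD /=; rewrite h.
Qed.

End weak_gradient_unique.

(** * Radial weak solutions *)

Section bounded_times_vanishing.
Context {R : realType} {T : topologicalType}.

Lemma bounded_mul_vanish_at (m k : T -> R) (t : T) : (forall s, `|m s| <= 1) ->
  {for t, continuous k} -> k t = 0 -> {for t, continuous (fun s => m s * k s)}.
Proof.
move=> m1 ck kt; rewrite /prop_for /continuous_at kt mulr0.
apply/cvgr0Pnorm_lt => e e0; have : k s @[s --> t] --> 0 by rewrite -kt.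
move=> /cvgr0Pnorm_lt /(_ e e0); apply: filterS => s ks.
by rewrite normrM (le_lt_trans _ ks) // ler_piMl.
Qed.

End bounded_times_vanishing.

(** Continuity of k at 0 suffices. It serves for the flux at the origin, where z is only known to be
    continuous. *)
Lemma has_derive_mul_id (R : realType) (k : R -> R) : {for 0, continuous k} ->
  has_derive (0 : R) 1 (fun t => k t * t) (k 0).
Proof.
move=> ck.
have L : h^-1 *: (((fun t => k t * t) \o shift (0 : R)) (h *: (1 : R)) - k 0 * 0)
    @[h --> 0^'] --> k 0.
  have : k h @[h --> 0^'] --> k 0.
    by apply: cvg_trans ck; apply: cvg_app; exact: cvg_within.
  apply: cvg_trans; apply: near_eq_cvg; near=> h.
  have h0 : h != 0 by near: h; exact: nbhs_dnbhs_neq.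
  rewrite /= addr0 mulr0 subr0 -[h *: 1]/(h * 1) mulr1 -[_ *: _]/(_ * _).
  by rewrite mulrC mulfK.
by apply: DeriveDef; [apply/cvg_ex; exists (k 0)|apply: cvg_lim].
Unshelve. all: by end_near. Qed.

Section radial.
Context {R : realType}.
Variables (N : nat) (p lam al : R) (w z : R -> R).
Hypotheses (N2 : (2 <= N)%N) (p1 : 1 < p).
Hypothesis sol : radial_sol N 1 (nonlin p lam) al w z.
Local Notation D := (@hball R N).
Implicit Types (x : 'rV[R]_N).

(** conf x - 2 is y = cosh r - 1, a rational function of x without singularity in the ball. *)
Definition radial_fun (f : R -> R) x := f (conf x - 2).
Definition radial_grad x := (z (conf x - 2) * conf x ^+ 2) *: x.

Let w0 : w 0 = al. Proof. by case: sol. Qed.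
Let dw (s : R) : has_derive s 1 w (z s). Proof. by case: sol. Qed.
Let cz : continuous z. Proof. by case: sol. Qed.
Let z0 : z 0 = - nonlin p lam al / N%:R. Proof. by case: sol. Qed.
Let dz (s : R) : 0 < s ->
  has_derive s 1 z (- (N%:R * (1 * s + 1) * z s + nonlin p lam (w s)) / qf 1 s).
Proof. by case: sol => _ _ _ _; apply. Qed.
Let cw : continuous w. Proof. by move=> s; exact: is_derive_continuous (dw s). Qed.
Let N0 : N%:R != 0 :> R. Proof. by rewrite pnatr_eq0 -lt0n; exact: ltnW. Qed.

Lemma radial_fun_at (f : R -> R) x : continuous f -> D x -> {for x, continuous (radial_fun f)}.
Proof.
move=> cf xD; apply: (comp_at (f := fun x => conf x - 2)); last exact: cf.
by apply: addr_at; [exact: continuous_conf|exact: cst_at].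
Qed.

Lemma has_derive_radial_fun (f : R -> R) (a : R) x i : D x ->
  has_derive (conf x - 2) 1 f a ->
  has_derive x (delta_mx 0 i) (radial_fun f) (a * (conf x ^+ 2 * x 0 i)).
Proof.
move=> xD fa; apply: is_deriveE.
  apply: (is_derive_compE (F := fun x => conf x - 2)); first exact: fa.
  by apply: is_deriveDE; [exact: has_derive_conf|exact: is_derive_cstE].
by rewrite addr0.
Qed.

Lemma radial_grad_at i x : D x -> {for x, continuous (fun x => radial_grad x 0 i)}.
Proof.
move=> xD; rewrite (_ : (fun _ => _) = fun x => radial_fun z x * conf x ^+ 2 * x 0 i).
  apply: mulr_at; last exact: coord_continuous.
  by apply: mulr_at; [exact: radial_fun_at|apply: exprn_at; exact: continuous_conf].
by apply/funext => t; rewrite /radial_grad mxE.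
Qed.

Lemma radial_weak_gradient : is_weak_gradient D (radial_fun w) radial_grad.
Proof.
apply: weak_gradient_continuous.
- by move=> x; exact: radial_fun_at.
- by move=> i x; exact: radial_grad_at.
move=> i x xD; apply: is_deriveE; first exact: has_derive_radial_fun (dw _).
by rewrite /radial_grad mxE mulrA.
Qed.

(** For y > 0 this is - q z'. It is continuous and vanishes at 0 by the initial slope of z, which
    compensates the discontinuity of x_i^2 / |x|^2 at the origin. [flux i] is conf^(N-2) times the
    i-th partial derivative of u. *)
Let K (y : R) : R := N%:R * (y + 1) * z y + nonlin p lam (w y).
Let m i x : R := x 0 i ^+ 2 / dotr x x.
(* At the origin [m i] is [0 / 0 = 0], and [radial_fun K] vanishes there. *)
Let flux i x : R := conf x ^+ N * radial_fun z x * x 0 i.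
Let dflux i x : R := conf x ^+ N *
  (N%:R * conf x * x 0 i ^+ 2 * radial_fun z x + radial_fun z x - m i x * radial_fun K x).

Let cK : continuous K.
Proof.
move=> y; apply: (@addr_at R R (fun y => N%:R * (y + 1) * z y)); last first.
  by apply: (comp_at (f := w)); [exact: cw|exact: continuous_nonlin].
apply: (@mulr_at R R (fun y => N%:R * (y + 1))); last exact: cz.
apply: (@mulr_at R R (fun=> N%:R)); first exact: cst_at.
by apply: (@addr_at R R id); [exact: cvg_id|exact: cst_at].
Qed.

Let m_le1 i x : `|m i x| <= 1.
Proof.
rewrite /m ger0_norm ?divr_ge0 ?sqr_ge0 ?dotr_ge0 //.
have := dotr_ge0 x; rewrite le_eqVlt => /orP[/eqP <-|h]; first by rewrite invr0 mulr0.
by rewrite ler_pdivrMr // mul1r sqr_coord_le_dotr.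
Qed.

Let K0 : K 0 = 0.
Proof. by rewrite /K z0 w0; field. Qed.

Let conf_eq2 x : dotr x x = 0 -> conf x = 2.
Proof. by rewrite /conf => ->; rewrite subr0 divr1. Qed.

Let dflux_at i x : D x -> {for x, continuous (dflux i)}.
Proof.
move=> xD; have cc := continuous_conf xD; have ci := @coord_continuous R 1 N 0 i x.
apply: mulr_at; first exact: exprn_at.
apply: addr_at.
  apply: addr_at; last exact: radial_fun_at.
  apply: mulr_at; last exact: radial_fun_at.
  apply: mulr_at; last exact: exprn_at.
  by apply: mulr_at => //; exact: cst_at.
apply: oppr_at; have [d0|d0] := eqVneq (dotr x x) 0.
  apply: bounded_mul_vanish_at; first exact: m_le1.
    exact: radial_fun_at.
  by rewrite /radial_fun conf_eq2 // subrr.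
apply: mulr_at; last exact: radial_fun_at.
apply: mulr_at; first exact: exprn_at.
by apply: invr_at => //; exact: continuous_dotr.
Qed.

Let dotr_eq0 x : dotr x x = 0 -> x = 0.
Proof.
move=> h; apply/rowP => i; rewrite mxE; apply/eqP; rewrite -sqrf_eq0 eq_le sqr_ge0 andbT.
by rewrite -h sqr_coord_le_dotr.
Qed.

(** Away from the origin this is the chain rule and the equation for z; at the origin [flux i] is
    x_i times a continuous function. *)
Let flux_derive i x : D x -> has_derive x (delta_mx 0 i) (flux i) (dflux i x).
Proof.
move=> xD; have [d0|d0] := eqVneq (dotr x x) 0.
  have x0 := dotr_eq0 d0.
  have -> : dflux i x = conf x ^+ N * radial_fun z x.
    rewrite /dflux /m d0 invr0 mulr0 mul0r subr0 x0 mxE expr0n /=; ring.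
  apply: line_is_derive; rewrite {1}x0.
  pose k (t : R) := conf (x + t *: delta_mx 0 i) ^+ N * radial_fun z (x + t *: delta_mx 0 i).
  rewrite (_ : (fun _ => _) = fun t => k t * t); last first.
    by apply/funext => t; rewrite /k /flux x0 !add0r !mxE !eqxx mulr1.
  have -> : conf x ^+ N * radial_fun z x = k 0 by rewrite /k scale0r addr0.
  apply: has_derive_mul_id.
  apply: (@continuous_comp _ _ _ (fun t : R => x + t *: delta_mx 0 i)
     (fun x => conf x ^+ N * radial_fun z x)).
    apply: continuous_to_row => j t.
    have : {for t, continuous (fun s : R => x 0 j + s * (delta_mx 0 i : 'rV[R]_N) 0 j)}.
      apply: addr_at; first exact: cst_at.
      by apply: mulr_at; [exact: cvg_id|exact: cst_at].
    by congr (continuous_at _ _); apply/funext => s; rewrite [RHS]mxE [X in _ = _ + X]mxE.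
  rewrite scale0r addr0; apply: mulr_at; last exact: radial_fun_at.
  by apply: exprn_at; exact: continuous_conf.
have dx : 0 < dotr x x by rewrite lt_neqAle eq_sym d0 dotr_ge0.
have c0 := conf_gt0 xD; have cd := conf_dotr xD.
have y0 : 0 < conf x - 2 by rewrite -cd mulr_gt0.
apply: is_deriveE.
  apply: is_deriveME; last exact: has_derive_coord.
  apply: is_deriveME; first exact: (is_deriveXE N (has_derive_conf i xD)).
  exact: has_derive_radial_fun xD (dz y0).
rewrite eqxx /dflux /m /radial_fun /K /=.
have -> : qf 1 (conf x - 2) = conf x ^+ 2 * dotr x x.
  by rewrite /qf expr2 -mulrA cd; ring.
have -> : conf x ^+ N = conf x ^+ N.-1 * conf x.
  by rewrite -exprSr prednK //; exact: ltnW.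
move: (conf x) (dotr x x) c0 d0 (conf x ^+ N.-1) (z _) (nonlin _ _ _) (x 0 i).
move=> c d c0 d0 cN zz g xi; field.
by rewrite d0 gt_eqF.
Qed.

(** The equation in divergence form. At the origin the quotients x_i^2 / |x|^2 are all 0 by
    convention, and N z 0 = - nonlin (w 0) gives the value. *)
Let sum_dflux x : D x -> \sum_i dflux i x = - (conf x ^+ N * nonlin p lam (radial_fun w x)).
Proof.
move=> xD; rewrite -mulr_sumr sumrB big_split /= -!mulr_suml -mulr_sumr.
have -> : \sum_i x 0 i ^+ 2 = dotr x x by apply: eq_bigr => i _; rewrite expr2.
rewrite sumr_const card_ord -[N%:R * conf x * dotr x x]mulrA conf_dotr // -[RHS]mulrN; congr (_ * _).
have [d0|d0] := eqVneq (dotr x x) 0.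
  rewrite d0 invr0 mulr0 mul0r subr0 /radial_fun conf_eq2 // subrr w0 z0.
  by rewrite -mulr_natr; field.
by rewrite divff // mul1r /radial_fun /K -mulr_natr; ring.
Qed.

Lemma radial_weak_eq phi : test_function D phi ->
  hintegral (fun x => hgrad_dot x (radial_grad x) (gradient phi x)) =
  hintegral (fun x => nonlin p lam (radial_fun w x) * phi x).
Proof.
move=> tphi; have cphi := test_function_cc tphi.
have cpi i := partial_cc i tphi.
have cS i : forall x, D x -> {for x, continuous (flux i)}.
  move=> x xD; apply: mulr_at; last exact: coord_continuous.
  by apply: mulr_at; [apply: exprn_at; exact: continuous_conf|exact: radial_fun_at].
have sumP (F : 'I_N -> 'rV[R]_N -> R) : (forall i, ball_cc (F i)) ->
    ball_cc (fun x => \sum_i F i x) /\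
    \int[lebesgue_row N]_(x in D) (\sum_i F i x) =
    \sum_i \int[lebesgue_row N]_(x in D) F i x.
  move=> cF; elim: (index_enum _) => [|i r [IH1 IH2]].
    have -> : (fun x => \sum_(i <- [::]) F i x) = fun=> 0.
      by apply/funext => x; rewrite big_nil.
    split; last by rewrite big_nil /Rintegral integral0.
    by split; [move=> x; exact: cst_at|exists 0].
  have -> : (fun x => \sum_(j <- i :: r) F j x) = (fun x => F i x + \sum_(j <- r) F j x).
    by apply/funext => x; rewrite big_cons.
  by rewrite ball_ccRD // IH2 big_cons; split => //; exact: ball_ccD.
have sumcc F h := (sumP F h).1; have sumI F h := (sumP F h).2.
transitivity (\sum_i \int[lebesgue_row N]_(x in D) (flux i x * partial i phi x)).
  rewrite -sumI; last by move=> i; apply: ball_ccM => //; exact: cS.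
  rewrite /hintegral; apply: eq_Rintegral => x; rewrite inE => xD.
  rewrite /hgrad_dot /dotr /gradient mulrAC mulr_sumr; apply: eq_bigr => i _.
  rewrite /radial_grad !mxE /flux /radial_fun.
  have c0 : conf x != 0 by rewrite gt_eqF // conf_gt0.
  by field.
transitivity (\sum_i - \int[lebesgue_row N]_(x in D) (dflux i x * phi x)).
  apply: eq_bigr => i _; apply: weak_ibp => //.
  - exact: cS.
  - by move=> x; exact: dflux_at.
  - by move=> x; exact: flux_derive.
rewrite sumrN -sumI; last by move=> i; apply: ball_ccM => // x; exact: dflux_at.
rewrite -mulN1r -RintegralZl; first last.
- apply: (@ball_cc_integrable R N (fun x => \sum_i dflux i x * phi x)).
  by apply: sumcc => i; apply: ball_ccM => // x; exact: dflux_at.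
- exact: measurable_hball.
rewrite /hintegral.
apply: eq_Rintegral => x; rewrite inE => xD.
by rewrite /= -mulr_suml sum_dflux //; ring.
Qed.

End radial.

(** * Integrability of radial functions *)

Section radial_integrability.
Context {R : realType}.
Variable N : nat.
Local Notation D := (@hball R N).
Local Notation mu := (@lebesgue_row R N).
Implicit Types (x : 'rV[R]_N) (h : R -> R).

Lemma powR_growth_bound h (b C T : R) : continuous h -> 0 <= b -> 0 < T ->
  (forall y, T <= y -> h y <= C * (y + 2) `^ b) ->
  exists C', forall y, 0 <= y -> h y <= C' * (y + 2) `^ b.
Proof.
move=> ch b0 T0 H; have [c _ Hc] := evt_max (ltW T0) (fun (x : R) _ => ch x).
exists (Num.max C `|h c|) => y y0.
have P1 : 1 <= (y + 2) `^ b by rewrite -[leLHS](powRr0 (y + 2)); apply: ler_powR => //; lra.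
have [yT|/ltW yT] := leP T y.
  by apply: le_trans (H y yT) _; apply: ler_wpM2r; [exact: powR_ge0|rewrite le_max lexx].
apply: (@le_trans _ _ (h c)); first by apply: Hc; rewrite y0.
apply: (@le_trans _ _ (`|h c| * (y + 2) `^ b)).
  by apply: le_trans (ler_norm _) _; rewrite ler_peMr.
by apply: ler_wpM2r; [exact: powR_ge0|rewrite le_max lexx orbT].
Qed.

(** Since conf x = y + 2, the density conf^N turns the decay of h into a bound by a multiple of
    conf^(1 - th). *)
Lemma radial_hintegrable h (th C T : R) : continuous h -> (forall y, 0 <= y -> 0 <= h y) ->
  0 < th -> th <= 1 -> 0 < T ->
  (forall y, T <= y -> h y <= C * (y + 2) `^ (1 - th - N%:R)) ->
  hintegrable (@radial_fun R N h).
Proof.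
move=> ch h0 th0 th1 T0 H; have mD := @measurable_hball R N.
pose k (y : R) : R := h y * (y + 2) ^+ N.
have ck : continuous k.
  move=> y; apply: (@mulr_at R R h); first exact: ch.
  apply: (@exprn_at R R (fun y => y + 2)).
  by apply: (@addr_at R R id); [exact: cvg_id|exact: cst_at].
have [||C' HC'] := @powR_growth_bound k (1 - th) C T ck _ T0; first by lra.
  move=> y Ty; have y0 : 0 <= y by exact: le_trans (ltW T0) Ty.
  rewrite /k powR_shiftX // -[1 - th](subrK N%:R) powR_shiftD // mulrA.
  by apply: ler_wpM2r; [exact: powR_ge0|exact: H].
have conf0 x : D x -> 0 <= conf x - 2 by move=> /conf_ge2; lra.
have I := integrable_conf_powR N th0 th1.
apply: le_integrable (integrableZl mD C' I) => //.
  apply/measurable_EFinP; apply: open_continuous_measurable_row; first exact: open_hball.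
  move=> x xD; apply: mulr_at; first exact: radial_fun_at.
  by apply: exprn_at; exact: continuous_conf.
move=> x xD /=; rewrite lee_fin ger0_norm.
  apply: le_trans (ler_norm _); have := HC' _ (conf0 x xD).
  by rewrite /k subrK.
by rewrite mulr_ge0 ?h0 ?conf0 // exprn_ge0 // ltW // conf_gt0.
Qed.

End radial_integrability.

(** * Fast decaying radial solutions are weak solutions in H^1 *)

Section radial_solution.
Context {R : realType}.
Variables (N : nat) (p lam al : R) (w z : R -> R).
Hypotheses (N2 : (2 <= N)%N) (p1 : 1 < p).
Hypothesis sol : radial_sol N 1 (nonlin p lam) al w z.
Hypothesis fast : fast_decay N w z.
Local Notation D := (@hball R N).
Local Notation u := (@radial_fun R N w).
Local Notation G := (@radial_grad R N z).
Implicit Types (x : 'rV[R]_N).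

Let cw : continuous w. Proof. by move=> s; case: sol => _ dw _ _ _; exact: is_derive_continuous (dw s). Qed.
Let cz : continuous z. Proof. by case: sol. Qed.
Let wG : is_weak_gradient D u G. Proof. exact: radial_weak_gradient sol. Qed.

Definition grad_sqr (y : R) : R := qf 1 y * z y ^+ 2.

Let cg : continuous grad_sqr.
Proof.
move=> y; apply: (@mulr_at R R (qf 1)); first exact: continuous_qf.
by apply: (@exprn_at R R z); exact: cz.
Qed.

Let cw2 : continuous (fun y => w y ^+ 2).
Proof. by move=> y; apply: (@exprn_at R R w); exact: cw. Qed.

Let grad_sqr_ge0 y : 0 <= y -> 0 <= grad_sqr y.
Proof. by move=> y0; rewrite mulr_ge0 ?sqr_ge0 ?qf_ge0. Qed.

Lemma radial_grad_sqr x : D x -> hgrad_dot x (G x) (G x) = radial_fun grad_sqr x.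
Proof.
move=> xD; rewrite /hgrad_dot /radial_grad /radial_fun /grad_sqr.
have -> : qf 1 (conf x - 2) = conf x ^+ 2 * dotr x x.
  by rewrite /qf expr2 -mulrA conf_dotr //; ring.
have -> v c : dotr (c *: v) (c *: v) = c ^+ 2 * @dotr R N v v.
  by rewrite /dotr mulr_sumr; apply: eq_bigr => i _; rewrite !mxE; ring.
by have c0 := conf_gt0 xD; field; rewrite gt_eqF.
Qed.

Let hD : {ae lebesgue_row N, forall x, D x -> hgrad u x = G x}.
Proof. exact: hgrad_ae. Qed.

Let mh i : measurable_fun D (fun x => hgrad u x 0 i).
Proof. exact: measurable_weak_gradient (hgradP wG). Qed.

Let mG i : measurable_fun D (fun x => G x 0 i).
Proof. exact: measurable_weak_gradient wG. Qed.

Let mrad (f : R -> R) : continuous f -> measurable_fun D (@radial_fun R N f).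
Proof.
move=> cf; apply: open_continuous_measurable_row; first exact: open_hball.
by move=> x; exact: radial_fun_at.
Qed.

Lemma hintegrable_radial_sqr : hintegrable (@radial_fun R N (fun y => w y ^+ 2)).
Proof.
have [C [eta [T [eta0 eta1 T0 H]]]] := fast.
apply: (@radial_hintegrable _ _ _ (2 * eta) C T) => //; try lra.
- by move=> y _; exact: sqr_ge0.
- by move=> y /H[].
Qed.

Lemma hintegrable_radial_grad_sqr : hintegrable (@radial_fun R N grad_sqr).
Proof.
have [C [eta [T [eta0 eta1 T0 H]]]] := fast.
apply: (@radial_hintegrable _ _ _ (2 * eta) C T) => //; try lra.
by move=> y /H[].
Qed.

Lemma radial_H1 : H1 u.
Proof.
split; first by exists G.
- exact: hintegrable_radial_sqr.
apply: ae_hintegrable hintegrable_radial_grad_sqr.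
  exact: measurable_hgrad_dot.
by apply: filterS hD => x h xD; rewrite h // radial_grad_sqr.
Qed.

Lemma radial_weak_solution : weak_solution lam p u.
Proof.
split; first exact: radial_H1.
  apply: (@locally_integrable_continuous R N (radial_fun (fun y => spow p (w y)))).
  move=> x; apply: radial_fun_at => y; apply: (@comp_at R R w); first exact: cw.
  exact: continuous_spow.
move=> phi tphi; have cphi := test_function_cc tphi.
have mphi i : measurable_fun D (fun x => gradient phi x 0 i).
  apply: measurable_funS (@subsetT _ _) _ => //.
  rewrite (_ : (fun _ => _) = partial i phi).
    exact: continuous_measurable_row (partial_cc i tphi).1.
  by apply/funext => x; rewrite mxE.
rewrite (@ae_hintegral _ _ _ (fun x => hgrad_dot x (G x) (gradient phi x))); first last.
- by apply: filterS hD => x h xD; rewrite h.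
- exact: measurable_hgrad_dot.
- exact: measurable_hgrad_dot.
rewrite (radial_weak_eq N2 p1 sol tphi) /hintegral.
have cc (f : R -> R) : continuous f -> ball_cc (fun x => radial_fun f x * phi x * conf x ^+ N).
  move=> cf; rewrite (_ : (fun _ => _) = fun x => radial_fun f x * conf x ^+ N * phi x).
    apply: ball_ccM => // x xD; apply: mulr_at; first exact: radial_fun_at.
    by apply: exprn_at; exact: continuous_conf.
  by apply/funext => x; rewrite mulrAC.
have c1 := cc _ cw.
have c2 : ball_cc (fun x => radial_fun (fun y => spow p (w y)) x * phi x * conf x ^+ N).
  apply: cc => y; apply: (@comp_at R R w); first exact: cw.
  exact: continuous_spow.
rewrite -RintegralZl; first last.
- exact: ball_cc_integrable.
- exact: measurable_hball.
apply/eqP; rewrite subr_eq addrC -ball_ccRD //.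
  by apply/eqP; apply: eq_Rintegral => x _; rewrite /nonlin /radial_fun /spow /=; ring.
by apply: ball_ccM => // x _; exact: cst_at.
Qed.

Lemma hintegrable_radial_energy :
  hintegrable (@radial_fun R N (fun y => grad_sqr y + w y ^+ 2)).
Proof.
pose f1 x : R := radial_fun grad_sqr x * conf x ^+ N.
pose f2 x : R := radial_fun (fun y => w y ^+ 2) x * conf x ^+ N.
rewrite /hintegrable (_ : EFin \o _ = ((EFin \o f1) \+ (EFin \o f2))%E); last first.
  by apply/funext => x /=; rewrite -EFinD -mulrDl.
apply: integrableD; first exact: measurable_hball.
  exact: hintegrable_radial_grad_sqr.
exact: hintegrable_radial_sqr.
Qed.

Lemma sqr_H1norm : H1norm u ^+ 2 = hintegral (@radial_fun R N (fun y => grad_sqr y + w y ^+ 2)).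
Proof.
rewrite /H1norm sqr_sqrtr.
  apply: ae_hintegral.
  - apply: measurable_funD; first exact: measurable_hgrad_dot.
    exact: (mrad cw2).
  - by apply: mrad => y; apply: (@addr_at R R grad_sqr); [exact: cg|exact: cw2].
  by apply: filterS hD => x h xD; rewrite h // radial_grad_sqr.
apply: Rintegral_ge0 => x xD; rewrite mulr_ge0 //.
  rewrite addr_ge0 ?sqr_ge0 // /hgrad_dot mulr_ge0 ?dotr_ge0 // invr_ge0.
  by rewrite exprn_ge0 // ltW // conf_gt0.
by rewrite exprn_ge0 // ltW // conf_gt0.
Qed.

End radial_solution.

(** * A lower bound for the energy near the origin *)

Section energy_lower_bound.
Context {R : realType}.
Variables (N : nat) (s1 s2 : R).
Hypotheses (N2 : (2 <= N)%N) (s10 : 0 < s1) (s12 : s1 < s2).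
Local Notation D := (@hball R N).
Local Notation mu := (@lebesgue_row R N).

Let N0 : 0 < N%:R :> R. Proof. by rewrite ltr0n; exact: ltnW. Qed.
(** On the cube [r b1, r b2]^N, 2 |x|^2 lies between r^2 s1 and r^2 (s1 + s2) / 2. The variable y =
    2 |x|^2 / (1 - |x|^2) is slightly larger, and stopping at the midpoint of s1 and s2 leaves room
    for the denominator. A cube is used because its measure is explicit. *)
Let b1 : R := Num.sqrt (s1 / 2 / N%:R).
Let b2 : R := Num.sqrt ((s1 + s2) / 4 / N%:R).

Let b10 : 0 <= b1. Proof. exact: sqrtr_ge0. Qed.

Let b12 : b1 < b2.
Proof.
have s10_ := s10; have s12_ := s12.
rewrite /b1 /b2 ltr_sqrt; last by rewrite !divr_gt0 //; lra.
by rewrite ltr_pM2r ?invr_gt0 //; lra.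
Qed.

Let sqr_b1 : N%:R * b1 ^+ 2 = s1 / 2.
Proof.
rewrite sqr_sqrtr; first by rewrite mulrC divfK // gt_eqF.
by rewrite !divr_ge0 // ltW.
Qed.

Let sqr_b2 : N%:R * b2 ^+ 2 = (s1 + s2) / 4.
Proof.
have s10_ := s10; have s12_ := s12.
rewrite sqr_sqrtr; first by rewrite mulrC divfK // gt_eqF.
by rewrite !divr_ge0 //; lra.
Qed.

Let Q (r : R) : set 'rV[R]_N := cbox (fun=> r * b1) (fun=> r * b2).

Let Q_dotr r x : 0 < r -> Q r x -> r ^+ 2 * (s1 / 2) <= dotr x x <= r ^+ 2 * ((s1 + s2) / 4).
Proof.
move=> r0 xQ; rewrite -sqr_b1 -sqr_b2 /dotr.
have E (c : R) : r ^+ 2 * (N%:R * c ^+ 2) = \sum_(i < N) (r * c) ^+ 2.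
  by rewrite sumr_const card_ord -mulr_natl; ring.
rewrite !E; apply/andP; split; apply: ler_sum => i _;
  have := xQ i; rewrite /= in_itv /= -expr2 => /andP[h1 h2].
  by rewrite lerXn2r // ?nnegrE ?(le_trans _ h1) // mulr_ge0 // ltW.
have h0 : 0 <= r * b1 by rewrite mulr_ge0 // ltW.
by rewrite lerXn2r // ?nnegrE; lra.
Qed.

(** For r^2 <= eps0 the cube satisfies 1 - |x|^2 >= (s1 + s2) / (2 s2), which is exactly the room
    left below r^2 s2. *)
Let eps0 : R := (s2 - s1) / (2 * s2 * (s1 + s2)).

Let Q_range r x : 0 < r -> r ^+ 2 <= eps0 -> Q r x ->
  D x /\ r ^+ 2 * s1 <= conf x - 2 <= r ^+ 2 * s2.
Proof.
have s10_ := s10; have s12_ := s12.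
move=> r0 re xQ; have /andP[h1 h2] := Q_dotr r0 xQ.
have rr : 0 < r ^+ 2 by rewrite exprn_gt0.
have k1 : r ^+ 2 * (2 * s2 * (s1 + s2)) <= s2 - s1.
  by move: re; rewrite /eps0 ler_pdivlMr // !mulr_gt0 //; lra.
move: h1 h2 rr k1; move: (r ^+ 2) => e h1 h2 e0 k1.
have k2 : (s1 + s2) <= 2 * s2 * (1 - dotr x x).
  have : s2 * (dotr x x) <= s2 * (e * ((s1 + s2) / 4)) by apply: ler_wpM2l => //; lra.
  by lra.
have d1 : 0 < 1 - dotr x x.
  rewrite ltNge; apply/negP => d1.
  have : 2 * s2 * (1 - dotr x x) <= 0 by rewrite mulr_ge0_le0 //; lra.
  by lra.
have xD : D x by rewrite /hball /=; lra.
split=> //; rewrite -conf_dotr // /conf mulrAC ler_pdivlMr // ler_pdivrMr //.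
have es1 : 0 <= e * s1 by rewrite mulr_ge0 ?ltW.
have d0 := dotr_ge0 x.
apply/andP; split.
  by have : e * s1 * dotr x x >= 0 by [exact: mulr_ge0]; lra.
have : e * (s1 + s2) <= e * (2 * s2 * (1 - dotr x x)) by apply: ler_wpM2l => //; exact: ltW.
by lra.
Qed.

Let mu_Q r : 0 < r -> mu (Q r) = ((r * (b2 - b1)) ^+ N)%:E.
Proof.
move=> r0; rewrite /Q /cbox (lebesgue_row_box (A := fun=> `[r * b1, r * b2]%classic)).
  rewrite (eq_bigr (fun=> (r * (b2 - b1))%:E)); first by rewrite prodEFin prodr_const card_ord.
  move=> i _; rewrite lebesgue_measure_itv /= lte_fin ltr_pM2l // b12 -EFinB.
  by rewrite mulrBr.
by move=> i; exact: measurable_itv.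
Qed.

Lemma energy_lower_bound : exists eps C : R, [/\ 0 < eps, 0 < C &
  forall (f : R -> R) (r m : R), continuous f -> (forall y, 0 <= y -> 0 <= f y) ->
  hintegrable (@radial_fun R N f) -> 0 < r -> r ^+ 2 <= eps -> 0 <= m ->
  (forall y, r ^+ 2 * s1 <= y <= r ^+ 2 * s2 -> m <= f y) ->
  C * m * r ^+ N <= hintegral (@radial_fun R N f)].
Proof.
have s10_ := s10; have s12_ := s12.
exists eps0, ((b2 - b1) ^+ N); split.
- by rewrite /eps0 divr_gt0 ?mulr_gt0 //; lra.
- by rewrite exprn_gt0 // subr_gt0.
move=> f r m cf f0 If r0 re m0 mf.
have mD := @measurable_hball R N.
have mQ : measurable (Q r) by exact: measurable_cbox.
have QD : Q r `<=` D by move=> x /(Q_range r0 re)[].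
have mF : measurable_fun D (fun x : 'rV[R]_N => (radial_fun f x * conf x ^+ N)%:E).
  exact: measurable_int If.
rewrite -lee_fin /hintegral /Rintegral fineK; last exact: integrable_fin_num If.
have -> : ((b2 - b1) ^+ N * m * r ^+ N)%:E = (\int[mu]_(x in Q r) m%:E)%E.
  rewrite integral_cst // [X in (_ * X)%E]mu_Q // -EFinM; congr EFin.
  by rewrite exprMn; ring.
have F0 x : D x -> (0 <= (radial_fun f x * conf x ^+ N)%:E)%E.
  move=> xD; rewrite lee_fin mulr_ge0 //.
    by apply: f0; have := conf_ge2 xD; lra.
  by rewrite exprn_ge0 // ltW // conf_gt0.
apply: (@le_trans _ _ (\int[mu]_(x in Q r) (radial_fun f x * conf x ^+ N)%:E)%E).
  apply: ge0_le_integral => //.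
  - exact: measurable_funS mF.
  move=> x xQ; have [xD xr] := Q_range r0 re xQ.
  rewrite lee_fin -[leLHS]mulr1; apply: ler_pM => //; first exact: mf.
  by apply: exprn_ege1; have := conf_ge2 xD; lra.
exact: ge0_subset_integral.
Qed.

End energy_lower_bound.

(** * Solutions of arbitrarily large norm *)

Lemma le_powR_root (R : realType) (g B x : R) : 0 < g -> 0 <= B ->
  B `^ g^-1 <= x -> B <= x `^ g.
Proof.
move=> g0 B0 Bx; have B1 : 0 <= B `^ g^-1 by exact: powR_ge0.
rewrite -[leLHS]powRr1 // -(mulVf (lt0r_neq0 g0)) powRrM.
by rewrite ge0_ler_powR ?nnegrE ?(ltW g0) // (le_trans B1).
Qed.

Lemma large_radial_solution (R : realType) (N : nat) (lam p k : R) :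
  (2 <= N)%N -> lam < ((N%:R - 1) / 2) ^+ 2 -> 1 < p ->
  ((2 < N)%N -> p < (N%:R + 2) / (N%:R - 2)) -> 0 <= k ->
  exists u : 'rV[R]_N -> R, weak_solution lam p u /\ k <= H1norm u.
Proof.
move=> N2 hlam p1 pN k0.
have gap0 : 0 < gap N lam by rewrite /gap /ahalf subr_gt0.
have [c [s1 [s2 [c0 s10 s12 H]]]] := fast_solutions N2 p1 gap0 pN.
have [eps [C [eps0 C0 HC]]] := energy_lower_bound N2 s10 s12.
(* The exponent of alpha in (alpha^2 / e) e^(N/2) with e = alpha^(1-p): energy density times volume
   of the window. Its positivity is the subcriticality of p. *)
pose g : R := 2 + (1 - p) * (N%:R / 2 - 1).
have g0 : 0 < g.
  rewrite /g; have [N3|] := ltnP 2 N; last first.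
    move=> N2'; have -> : N = 2%N by apply/eqP; rewrite eqn_leq N2'.
    by lra.
  have N3' : 0 < N%:R - 2 :> R by rewrite subr_gt0 ltr_nat.
  by have := pN N3; rewrite ltr_pdivlMr //; lra.
pose C1 := C * (2 * s1 * c ^+ 2).
have C10 : 0 < C1 by rewrite !mulr_gt0 // exprn_gt0.
have p10 : 0 < p - 1 by lra.
(* The first lower bound on alpha gives k^2 <= C1 alpha^g, the second makes e small enough for
   [energy_lower_bound]. *)
have [al [w [z [M [alA al0 [sol _] fast Hz]]]]] :=
  H (Num.max ((k ^+ 2 / C1) `^ g^-1) (eps^-1 `^ (p - 1)^-1)).
move: alA; rewrite ge_max => /andP[alk ale].
pose e := al `^ (1 - p).
have e0 : 0 < e by exact: powR_gt0.
have ee : e <= eps.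
  rewrite /e -opprB powRN -[leRHS]invrK lef_pV2 ?posrE ?invr_gt0 ?powR_gt0 //.
  by apply: le_powR_root => //; rewrite invr_ge0 ltW.
have kal : k ^+ 2 <= C1 * al `^ g.
  rewrite mulrC -ler_pdivrMr //; apply: le_powR_root => //.
  by rewrite divr_ge0 ?sqr_ge0 // ltW.
exists (@radial_fun R N w); split; first exact: radial_weak_solution N2 p1 sol fast.
rewrite -(@ler_pXn2r _ 2) ?nnegrE ?sqrtr_ge0 // (sqr_H1norm sol).
pose f (y : R) := grad_sqr z y + w y ^+ 2.
have cw : continuous w.
  by move=> s; case: sol => _ dw _ _ _; exact: is_derive_continuous (dw s).
have cz : continuous z by case: sol.
have cf : continuous f.
  move=> y; apply: (@addr_at R R (grad_sqr z)); last first.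
    by apply: (@exprn_at R R w); exact: cw.
  apply: (@mulr_at R R (qf 1)); first exact: continuous_qf.
  by apply: (@exprn_at R R z); exact: cz.
(* On the window q >= 2 y >= 2 e s1 and |z| >= c alpha / e, so q z^2 is at least this. *)
pose m := 2 * s1 * c ^+ 2 * al ^+ 2 / e.
pose r := Num.sqrt e.
have r2 : r ^+ 2 = e by rewrite sqr_sqrtr // ltW.
have rN : r ^+ N = al `^ ((1 - p) * (N%:R / 2)).
  have -> : r = al `^ ((1 - p) / 2).
    apply/eqP; rewrite -(@eqrXn2 _ 2) ?sqrtr_ge0 ?powR_ge0 // r2 /e.
    by rewrite -powR_mulrn ?powR_ge0 // -powRrM divfK.
  by rewrite -powR_mulrn ?powR_ge0 // -powRrM mulrAC -mulrA.
have Ef : C1 * al `^ g = C * m * r ^+ N.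
  rewrite rN /m /e (_ : g = 2 - (1 - p) + (1 - p) * (N%:R / 2)); last by rewrite /g; ring.
  rewrite powRD ?(gt_eqF al0) ?implybT // powRD ?(gt_eqF al0) ?implybT //.
  by rewrite powRN powR_mulrn ?(ltW al0) // /C1; ring.
apply: le_trans kal _; rewrite Ef; apply: (HC f r m) => //.
- by move=> y y0; rewrite addr_ge0 ?sqr_ge0 // mulr_ge0 ?sqr_ge0 // qf_ge0.
- exact: (hintegrable_radial_energy sol fast).
- by rewrite sqrtr_gt0.
- by rewrite r2.
- by rewrite divr_ge0 ?mulr_ge0 ?sqr_ge0 // ltW.
move=> y; rewrite r2 => ye; have /andP[ye1 _] := ye; have zy := Hz y ye.
have y0 : 0 < y by apply: lt_le_trans ye1; rewrite mulr_gt0.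
rewrite /f -[leLHS]addr0; apply: lerD; last exact: sqr_ge0.
have z2 : (c * al / e) ^+ 2 <= z y ^+ 2.
  rewrite -[leRHS]real_normK ?num_real //.
  by rewrite lerXn2r ?nnegrE // divr_ge0 ?mulr_ge0 // ltW.
have -> : m = (2 * (e * s1)) * (c * al / e) ^+ 2.
  by rewrite /m; field; rewrite gt_eqF.
rewrite /grad_sqr; apply: ler_pM => //; rewrite ?sqr_ge0 ?mulr_ge0 ?(ltW e0) ?(ltW s10) //.
by rewrite /qf; nra.
Qed.

Theorem theorem5p1 (R : realType) (N : nat) (lambda p : R)
  (hN : (2 <= N)%N)
  (hlambda : lambda < ((N%:R - 1) / 2) ^+ 2)
  (hp : 1 < p)
  (hpN : (2 < N)%N -> p < (N%:R + 2) / (N%:R - 2)) :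
  exists u : nat -> 'rV[R]_N -> R,
    (forall k, weak_solution lambda p (u k)) /\
    (H1norm (u k) @[k --> \oo] --> +oo).
Proof.
have /choice[u Hu] : forall k : nat, exists u : 'rV[R]_N -> R,
    weak_solution lambda p u /\ k%:R <= H1norm u.
  by move=> k; exact: large_radial_solution.
exists u; split=> [k|]; first exact: (Hu k).1.
apply/cvgryPge => A; exists (Num.truncn A).+1 => // k /= Ak.
apply: le_trans (Hu k).2; apply: le_trans (ltW (truncnS_gt A)) _.
by rewrite ler_nat.
Qed.
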